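(* Let $\gamma>0$ and let $\{c_\xi\}_{\xi\in\mathcal Z^2}$ be a random field on a complete probability space $(\Omega,\mathcal F,\mathbb P)$ which satisfies $\sup_\xi|c_\xi(\omega)|<\frac1{4\gamma}$ for $\mathbb P$-a.e. $\omega$, is stationary, and is $\alpha$-mixing with $\sum_{n\ge1}\alpha(n)<+\infty$. Then for $\mathbb P$-almost every $\omega\in\Omega$ the following holds. Let $\varepsilon_j\downarrow0$ and let $A_j^0(\omega)\in\mathcal A_{\varepsilon_j}$ be coordinate rectangles converging in the Hausdorff metric to a coordinate rectangle $A(\omega)$. For each $j$ let $A_{\varepsilon_j}(t)(\omega)$ be a discrete flat flow with initial set $A_j^0(\omega)$. Then there is a subsequence (not relabeled) such that $A_{\varepsilon_j}(t)(\omega)$ converges locally in time to $A(t)(\omega)$, where $A(t)(\omega)$ is a coordinate rectangle with sides $S_1(t)(\omega),\dots,S_4(t)(\omega)$ such that $A(0)(\omega)=A(\omega)$ and each side $S_i(t)(\omega)$ moves inward with velocity $v_i(t)(\omega)$ satisfying, with $L_i(t)(\omega):=\mathcal H^1(S_i(t)(\omega))$, $$v_i(t)(\omega)\begin{cases}=\dfrac1\gamma\left\lfloor\dfrac{2\gamma}{L_i(t)(\omega)}\right\rfloor&\text{if }\dfrac{2\gamma}{L_i(t)(\omega)}\notin\mathbb N,\\[3mm]\in\dfrac1\gamma\left[\dfrac{2\gamma}{L_i(t)(\omega)}-1,\ \dfrac{2\gamma}{L_i(t)(\omega)}\right]&\text{if }\dfrac{2\gamma}{L_i(t)(\omega)}\in\mathbb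 N.\end{cases}$$ The differential inclusions are valid until the extinction time, i.e. the first time at which some $L_i(t)(\omega)=0$.
   Context: **Random field.** $\mathcal Z^2:=\{\frac{i+j}2:\ i,j\in\mathbb Z^2,\ |i-j|=1\}$ is the dual lattice. A measure preserving group action $\{\tau_z\}_{z\in\mathbb Z^2}$ on $\Omega$ is a family of measurable maps $\tau_z:\Omega\to\Omega$ with $\tau_{z_1+z_2}=\tau_{z_2}\circ\tau_{z_1}$ and $\mathbb P(\tau_zB)=\mathbb P(B)$ for all $B\in\mathcal F$, $z\in\mathbb Z^2$. The family of real random variables $\{c_\xi\}_{\xi\in\mathcal Z^2}$ is stationary if, for such an action, $c_\xi(\tau_z\omega)=c_{\xi+z}(\omega)$ for all $z\in\mathbb Z^2$, $\xi\in\mathcal Z^2$. It is $\alpha$-mixing (with rate $\alpha$) if there is a sequence $\alpha(n)\to0$ such that for all $I_1,I_2\subset\mathcal Z^2$ with $\mathrm{dist}(I_1,I_2)\ge n$ one has $\sup\{|\mathbb P(A\cap B)-\mathbb P(A)\mathbb P(B)|:A\in\mathcal F_{I_1},B\in\mathcal F_{I_2}\}\le\alpha(n)$, where $\mathcal F_I=\sigma(c_\xi:\xi\in I)$. **Minimizing movement scheme.** For $\varepsilon>0$ let $Q_\varepsilon(x)=x+[-\frac\varepsilon2,\frac\varepsilon2)^2$ and let $\mathcal A_\varepsilon$ be the class of sets of the form $\bigcup_{i\in\mathcal I}Q_\varepsilon(i)$ with $\mathcal I\subset\varepsilon\mathbb Z^2$. For $A\in\mathcal A_\varepsilon$ put $P_\varepsilon^\omega(A)=\sum_{\xi\in\mathcal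 Z^2:\ \varepsilon\xi\in\partial A}\varepsilon(1+\varepsilon c_\xi(\omega))$. For $x\in Q_\varepsilon(i)$, $i\in\varepsilon\mathbb Z^2$, let $d^\varepsilon_\infty(x,\partial A)=\inf\{\|i-j\|_\infty:j\in\varepsilon\mathbb Z^2\setminus A\}$ if $i\in A$, and $=\inf\{\|i-j\|_\infty:j\in\varepsilon\mathbb Z^2\cap A\}$ if $i\notin A$. Set $\tau=\gamma\varepsilon$ and $$E_\varepsilon^\omega(A,F)=P_\varepsilon^\omega(A)+\frac1{\gamma\varepsilon}\int_{A\Delta F}d_\infty^\varepsilon(x,\partial F)\,dx,\qquad A,F\in\mathcal A_\varepsilon.$$ Given an initial set $A_\varepsilon^0(\omega)\in\mathcal A_\varepsilon$, choose recursively $A_\varepsilon^{k+1}(\omega)$ to be any minimizer over $\mathcal A_\varepsilon$ of $A\mapsto E_\varepsilon^\omega(A,A_\varepsilon^k(\omega))$ (the choice may be non-unique). A discrete flat flow is the interpolation $A_\varepsilon(t)(\omega):=A_\varepsilon^{\lfloor t/(\gamma\varepsilon)\rfloor}(\omega)$, $t\ge0$. **Conventions.** A coordinate rectangle is a (non-degenerate) rectangle with all sides parallel to the coordinate axes. $\mathcal H^1$ is the one-dimensional Hausdorff measure. Let $T\in(0,+\infty]$ be the extinction time. Convergence locally in time means convergence in the Hausdorff metric, uniformly for $t$ in compact subsets of $[0,T)$. ''Moves inward with velocity $v_i$'' means that the position of side $S_i(t)$, measured along the coordinate direction orthogonal to it and oriented towards the interior of the rectangle, is a locally Lipschitz function of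 $t\in[0,T)$ with derivative $v_i(t)$ for a.e. $t$; the inclusions are understood for a.e. $t\in[0,T)$. *)

(* Defs.v *)
From HB Require Import structures.
From mathcomp Require Import all_boot all_order all_algebra.
From mathcomp Require Import all_classical all_reals all_analysis.

Set Implicit Arguments.
Unset Strict Implicit.
Unset Printing Implicit Defensive.

Import Order.TTheory GRing.Theory Num.Theory.
Import numFieldNormedType.Exports.

Local Open Scope classical_set_scope.
Local Open Scope ring_scope.

Section plane.
Context {R : realType}.
Implicit Types (x y : R * R) (A B S U : set (R * R)).

(* The library norm on R * R is the sup norm; its topology is the usual one. *)
Definition dist2 x y : R :=
  Num.sqrt ((x.1 - y.1) ^+ 2 + (x.2 - y.2) ^+ 2).

Definition set_dist A B : \bar R :=
  ereal_inf [set (dist2 x y)%:E | x in A & y in B].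

Definition hausdorff_dist A B : \bar R :=
  ereal_inf [set r%:E | r in [set r : R | 0 <= r /\
    (forall x, A x -> exists2 y, B y & dist2 x y <= r) /\
    (forall y, B y -> exists2 x, A x & dist2 x y <= r)]].

(* The singleton [set 0] gives the empty set diameter 0 instead of -oo. *)
Definition diam U : \bar R :=
  ereal_sup ([set 0%E] `|` [set (dist2 x y)%:E | x in U & y in U]).

Definition hausdorff1 S : \bar R :=
  ereal_sup [set ereal_inf [set (\sum_(0 <= n <oo) diam (U n))%E |
      U in [set U : (set (R * R))^nat | S `<=` \bigcup_n U n /\
                                        forall n, (diam (U n) <= delta%:E)%E]] |
    delta in [set delta : R | 0 < delta]].

Definition topological_boundary A : set (R * R) := closure A `\` A°.

(* The four sides of a coordinate rectangle; a rectangle is encoded by the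
   positions p Left < p Right and p Bottom < p Top of the lines carrying them. *)
Inductive side := Left | Right | Bottom | Top.

(* Which part of its topological boundary a rectangle contains is left free:
   unions of half-open cells are half-open rectangles, and the Hausdorff
   distance does not see the difference. *)
Definition rectangle_at (p : side -> R) A : Prop :=
  [/\ p Left < p Right, p Bottom < p Top,
      `]p Left, p Right[ `*` `]p Bottom, p Top[ `<=` A &
      A `<=` `[p Left, p Right] `*` `[p Bottom, p Top]].

Definition coordinate_rectangle A : Prop := exists p, rectangle_at p A.

Definition side_set (p : side -> R) (s : side) : set (R * R) :=
  match s with
  | Left => [set p Left] `*` `[p Bottom, p Top]
  | Right => [set p Right] `*` `[p Bottom, p Top]
  | Bottom => `[p Left, p Right] `*` [set p Bottom]
  | Top => `[p Left, p Right] `*` [set p Top]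
  end.

Definition side_length (p : side -> R) (s : side) : R :=
  fine (hausdorff1 (side_set p s)).

Definition inward (s : side) (r : R) : R :=
  match s with Left | Bottom => r | Right | Top => - r end.

End plane.

Section lattices.
Context {R : realType}.
Implicit Types (x y : R * R) (A F : set (R * R)) (eps gamma : R).

Definition zpt (z : int * int) : R * R := (z.1%:~R, z.2%:~R).

Definition dual_lattice : set (R * R) :=
  [set (2^-1 : R) *: (zpt ij.1 + zpt ij.2) |
    ij in [set ij : (int * int) * (int * int) | dist2 (zpt ij.1) (zpt ij.2) = 1]].

Definition eps_lattice eps : set (R * R) := [set eps *: zpt z | z in setT].

Definition cell eps x : set (R * R) :=
  [set y | x.1 - eps / 2 <= y.1 < x.1 + eps / 2 /\
           x.2 - eps / 2 <= y.2 < x.2 + eps / 2].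

Definition lattice_sets eps : set (set (R * R)) :=
  [set A | exists2 I, I `<=` eps_lattice eps & A = \bigcup_(i in I) cell eps i].

Definition cell_center eps x : R * R :=
  eps *: zpt (Num.floor (x.1 / eps + 2^-1), Num.floor (x.2 / eps + 2^-1)).

Lemma cell_centerP eps x i : 0 < eps -> eps_lattice eps i ->
  cell eps i x <-> cell_center eps x = i.
Proof.
move=> e0 [[a b] _ <-]; rewrite /cell /cell_center /zpt /=.
have aux (u : R) (m : int) :
    (eps * m%:~R - eps / 2 <= u < eps * m%:~R + eps / 2)
    = (Num.floor (u / eps + 2^-1) == m).
  rewrite floor_eq intrD -lerBlDr -ltrBrDr ler_pdivlMr// ltr_pdivrMr//.
  rewrite !mulrBl mulrDl mul1r mulrC [2^-1 * eps]mulrC.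
  congr (_ && (_ < _)); rewrite -addrA; congr (_ + _).
  by rewrite {2}(splitr eps) addrK.
rewrite !aux; split => [[/eqP -> /eqP ->]//|] /= h.
move: (congr1 fst h) (congr1 snd h) => /= /(mulfI (lt0r_neq0 e0)) h1.
by move=> /(mulfI (lt0r_neq0 e0)) h2; split; apply/eqP/(@intr_inj R).
Qed.

Definition dist_inf eps F x : \bar R :=
  let i := cell_center eps x in
  ereal_inf [set (`|i - j|)%:E |
    j in eps_lattice eps `&` (if i \in F then ~` F else F)].

(* Positive minus negative part. Wherever sup |c| < 1 / (4 gamma) and
   eps < 4 gamma every term is positive, and the sum is one in [0, +oo]. *)
Definition perimeter (c : R * R -> R) eps A : \bar R :=
  let term (xi : R * R) := (eps * (1 + eps * c xi))%:E in
  let edges := dual_lattice `&` [set xi | topological_boundary A (eps *: xi)] in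
  (\esum_(xi in edges) (term^\+ xi) - \esum_(xi in edges) (term^\- xi))%E.

Definition energy (c : R * R -> R) gamma eps A F : \bar R :=
  (perimeter c eps A + ((gamma * eps)^-1)%:E *
    \int[(@lebesgue_measure R \x @lebesgue_measure R)]_(x in A `+` F)
      dist_inf eps F x)%E.

Definition minimizer (c : R * R -> R) gamma eps F A : Prop :=
  lattice_sets eps A /\
  forall B, lattice_sets eps B -> (energy c gamma eps A F <= energy c gamma eps B F)%E.

Definition discrete_flat_flow (c : R * R -> R) gamma eps
    (A0 : set (R * R)) (At : R -> set (R * R)) : Prop :=
  exists Ak : nat -> set (R * R),
    [/\ Ak 0%N = A0, forall k, minimizer c gamma eps (Ak k) (Ak k.+1) &
        forall t, 0 <= t -> At t = Ak (Num.truncn (t / (gamma * eps)))].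

End lattices.

Section random_field.
Context {d : measure_display} {T : measurableType d} {R : realType}.
Variable P : probability T R.
Implicit Type c : R * R -> {RV P >-> R}.

Definition measure_preserving_action (tau : int * int -> T -> T) : Prop :=
  [/\ forall z, measurable_fun setT (tau z),
      forall z1 z2, tau (z1 + z2) = tau z2 \o tau z1 &
      forall z (B : set T), measurable B ->
        measurable (tau z @` B) /\ P (tau z @` B) = P B].

(* A random field is a family over dual_lattice; its values elsewhere are
   never used. *)
Definition stationary c : Prop :=
  exists2 tau, measure_preserving_action tau &
    forall z xi w, dual_lattice xi -> c xi (tau z w) = c (xi + zpt z) w.

Definition field_sigma c (I : set (R * R)) : set (set T) :=
  <<s [set E | exists2 xi, I xi &
        exists2 B : set R, measurable B & E = c xi @^-1` B] >>.

Definition alpha_mixing c (alpha : nat -> R) : Prop :=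
  alpha @ \oo --> 0 /\
  forall (n : nat) (I1 I2 : set (R * R)),
    I1 `<=` dual_lattice -> I2 `<=` dual_lattice ->
    (n%:R%:E <= set_dist I1 I2)%E ->
    (ereal_sup [set `|P (A `&` B) - P A * P B| |
        A in field_sigma c I1 & B in field_sigma c I2] <= (alpha n)%:E)%E.

End random_field.

Section evolution.
Context {R : realType}.

Definition lifespan (Text : \bar R) : set R :=
  [set t | 0 <= t /\ (t%:E < Text)%E].

Definition locally_lipschitz_on (D : set R) (f : R -> R) : Prop :=
  forall t, D t -> exists2 U, nbhs t U & [lipschitz f x | x in D `&` U].

Definition converges_locally_in_time (Text : \bar R)
    (Aj : nat -> R -> set (R * R)) (At : R -> set (R * R)) : Prop :=
  forall K : set R, compact K -> K `<=` lifespan Text ->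
  forall e : R, 0 < e -> \forall j \near \oo,
  forall t, K t -> (hausdorff_dist (Aj j t) (At t) < e%:E)%E.

Definition velocity_inclusion (gamma L v : R) : Prop :=
  let q := 2 * gamma / L in
  (q \isn't a Num.nat -> v = gamma^-1 * (Num.floor q)%:~R) /\
  (q \is a Num.nat -> gamma^-1 * (q - 1) <= v <= gamma^-1 * q).

(* Text is the first time at which a side length vanishes: all lengths are
   positive before it, and if it is finite some length tends to 0 there. *)
Definition rectangle_evolution (gamma : R) (A : set (R * R)) (Text : \bar R)
    (At : R -> set (R * R)) : Prop :=
  exists (p : R -> side -> R) (v : side -> R -> R),
    [/\ (forall t, lifespan Text t -> rectangle_at (p t) (At t)), At 0 = A,
        (forall s, locally_lipschitz_on (lifespan Text) (fun t => inward s (p t s))),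
        {ae (@lebesgue_measure R), forall t, lifespan Text t -> forall s,
          is_derive t 1 (fun t => inward s (p t s)) (v s t) /\
          velocity_inclusion gamma (side_length (p t) s) (v s t)} &
        forall T0 : R, Text = T0%:E ->
          exists s, side_length (p t) s @[t --> T0^'-] --> 0].

End evolution.

(* Main.v *)
(* One step.  Divided by eps, the energy of a finite union of cells is a sum of
   weights over its boundary edges plus eps / gamma times the sum of the depths of
   the cells that were changed.  As the weights vary by less than eps / (2 gamma),
   the energy decreases when a competitor is intersected with the old rectangle, is
   cut at a line of cells that it misses, or is filled up to its bounding rectangle;
   so minimizers are rectangles.  Moving one side of the minimizer by one cell then
   shows that a side of length L advances by N cells with
   2 gamma / L - 1 - eta <= N <= 2 gamma / L + eta, because the sums of the field
   over parallel segments of length O(1 / eps) differ by o(1 / eps).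

   Fluctuations.  That estimate must hold for O(1 / eps) lines at once, while second
   moments only bound the probability of an atypical block of m edges by C / m.  But
   two separated blocks of one line are both atypical with probability at most
   (C / m) ^ 2 + alpha q for every q <= m, and averaging over q makes this summable
   over dyadic m even after multiplication by the number of lines.  By
   Borel-Cantelli each line has at most two atypical blocks, which do not matter.

   Limit.  As long as the lengths stay above delta the sides move inwards with
   bounded speed, so their positions converge along an ultrafilter to Lipschitz
   functions, locally uniformly by monotonicity.  At a point of differentiability
   the bounds on N, which is an integer, give the velocity inclusion. *)
Require Import Defs.
From HB Require Import structures.
From mathcomp Require Import all_boot all_order all_algebra.
From mathcomp Require Import all_classical all_reals all_analysis.
From mathcomp Require Import measurable_realfun zify ring lra.

Import Order.TTheory GRing.Theory Num.Theory.
Import numFieldNormedType.Exports.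

Set Implicit Arguments.
Unset Strict Implicit.
Unset Printing Implicit Defensive.

Local Open Scope classical_set_scope.
Local Open Scope ring_scope.

(** * Almost everywhere differentiability *)

(** The threshold [1 / (4 * gamma)] comes from a charging scheme. Divided by [eps], edges weigh
    between [1 - eps * C] and [1 + eps * C], and a changed cell of depth [d] costs
    [d * eps / gamma]. When cells outside the old rectangle are dropped or missing ones are filled
    in, every new edge is paired with an old one, and the excess, at most [2 * eps * C], is charged
    to a changed cell of the same line. A cell is charged at most once in its row and once in its
    column, so [4 * eps * C < eps / gamma] suffices. Cutting off a strip adds penalty instead of
    removing it, so it pays only for strips of bounded width; a crude comparison with the old
    rectangle therefore first confines the missed lines to a depth [D] that does not depend on
    [eps]. Mixing speaks of events only, so the fluctuation estimate is proved for indicators of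
    superlevel sets and carried over to the field by slicing its range. The null set has to serve
    all [eps], all rectangles and all precisions, so randomness is confined to one statement about
    sums along lines, over countably many parameters, and the rest is deterministic. *)

Lemma derivable_near_shift {R : realType} (f g : R -> R) (c x : R) :
  (\forall y \near x, g y = f y - c) -> derivable g x 1 -> derivable f x 1.
Proof.
move=> fg dg; rewrite [f](_ : _ = (fun y => (f y - c) + c)); last first.
  by apply/funext => y; rewrite subrK.
apply: (@derivableD _ _ _ (fun y => f y - c) (cst c)); last exact: derivable_cst.
by apply: near_eq_derivable dg; rewrite ?oner_neq0.
Qed.

Section lipschitz_ae_derivable.
Context {R : realType}.
Notation mu := (@lebesgue_measure R).
Variables (f : R -> R) (K : R).
Hypothesis f_nd : {homo f : x y / x <= y}.
Hypothesis f_lip : forall x y, x <= y -> f y - f x <= K * (y - x).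

Lemma nondecreasing_lipschitz_continuous : continuous f.
Proof.
move=> x; apply/(@cvgrPdist_le _ R^o) => e e0.
near=> y.
have yx : `|x - y| <= e / (`|K| + 1) by near: y; apply: cvgr_dist_le => //; apply: divr_gt0 => //; rewrite ltr_wpDl.
have aux u v : u <= v -> `|v - u| <= e / (`|K| + 1) -> `|f v - f u| <= e.
  move=> uv vu; rewrite ger0_norm ?subr_ge0 ?f_nd//.
  apply: (le_trans (f_lip uv)).
  apply: (@le_trans _ _ ((`|K| + 1) * `|v - u|)).
    rewrite (ger0_norm (x := v - u)) ?subr_ge0//; apply: ler_wpM2r; first by rewrite subr_ge0.
    by rewrite (le_trans (ler_norm K))// lerDl.
  by rewrite mulrC -ler_pdivlMr// ltr_wpDl.
have [xy|/ltW xy] := leP y x; first exact: aux.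
by rewrite distrC; apply: aux => //; rewrite distrC.
Unshelve. all: end_near. Qed.

(** Viewing [f] as a distribution function turns its differentiation into the search for a
    Radon-Nikodym density. *)
Let F : cumulative R R := HB.pack f (isCumulative.Build R _ R f f_nd
  (right_continuousW nondecreasing_lipschitz_continuous)).

Lemma stieltjes_ocitv (a b : R) : a <= b ->
  lebesgue_stieltjes_measure F `]a, b] = (f b - f a)%:E.
Proof.
move=> ab; rewrite /lebesgue_stieltjes_measure/= /measure_extension measurable_mu_extE/=; last exact: is_ocitv.
by rewrite wlength_itv_bnd.
Qed.

(** A cover of a null set by half-open intervals of total length below [e / (K + 1)] has Stieltjes
    content at most [K] times that, hence at most [e]; [K + 1] keeps the divisor positive when
    [K = 0]. *)
Lemma stieltjes_null_dominates : lebesgue_stieltjes_measure F `<< mu.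
Proof.
have K0 : 0 <= K.
  by have := @f_lip 0 1 ler01; rewrite subr0 mulr1; apply: le_trans; rewrite subr_ge0 f_nd.
apply/null_content_dominatesP => A mA muA.
apply/eqP; rewrite eq_le measure_ge0 andbT; apply/lee_addgt0Pr => e e0; rewrite add0e.
have e'0 : 0 < e / (K + 1) by apply: divr_gt0 => //; rewrite ltr_wpDl.
have : (mu A < (e / (K + 1))%:E)%E by rewrite muA lte_fin.
move=> /ereal_inf_lt[_ [B [mB AB] <-] lt].
apply: (@le_trans _ _ (\sum_(k <oo) wlength F (B k))%E).
  by apply: ereal_inf_lbound; exists B.
apply: (@le_trans _ _ (\sum_(k <oo) (K%:E * wlength idfun (B k)))%E); last first.
  rewrite nneseriesZl; last by move=> i _; apply: wlength_ge0.
  apply: (@le_trans _ _ (K%:E * (e / (K + 1))%:E)%E); first by apply: lee_wpmul2l; rewrite ?lee_fin// ltW.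
  rewrite -EFinM lee_fin mulrCA ler_piMr ?(ltW e0)// ler_pdivrMr ?ltr_wpDl// mul1r.
  by rewrite lerDl.
apply: lee_nneseries => [i _ _|i _]; first exact: wlength_ge0.
have /ocitvP[->|[[a b]/= ab ->]] := mB i; first by rewrite !wlength0 mule0.
by rewrite !wlength_itv_bnd ?(ltW ab)//= -EFinM lee_fin f_lip// ltW.
Qed.

(** The Stieltjes measure of [f] is absolutely continuous, so up to a constant [f] is locally the
    indefinite integral of a density, and Lebesgue differentiation applies. Restricting to []-n, n]]
    makes the measure finite and the density integrable. *)
Lemma nondecreasing_lipschitz_ae_derivable : {ae mu, forall x, derivable f x 1}.
Proof.
suff h (n : nat) : {ae mu, forall x, -n%:R < x < n%:R -> derivable f x 1}.
  have /ae_foralln H := h.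
  apply: filterS H => x H; apply: (H (Num.bound `|x|)).
  by rewrite -ltr_norml; exact: archi_boundP.
pose D := `]-n%:R, n%:R]%classic : set (measurableTypeR R).
have mD : measurable D by exact: measurable_itv.
have nn : - n%:R <= n%:R :> R by rewrite (@le_trans _ _ 0)// oppr_le0.
have Dfin : (lebesgue_stieltjes_measure F D < +oo)%E by rewrite stieltjes_ocitv// ltry.
pose nu : {finite_measure set (measurableTypeR R) -> \bar R} := mfrestr mD Dfin.
have nu_mu : nu `<< mu.
  have /null_content_dominatesP H := stieltjes_null_dominates.
  apply/null_content_dominatesP => A mA muA.
  apply/eqP; rewrite eq_le measure_ge0 andbT -(H A mA muA).
  by rewrite /nu/= /mfrestr/mrestr; apply: le_measure; rewrite ?inE//; apply: measurableI.
have [g [g0 gfin gint gE]] := radon_nikodym_sigma_finite nu_mu.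
have gEfin : g = EFin \o (fine \o g) by apply/funext => x /=; rewrite fineK.
rewrite gEfin in gint.
pose h : R -> R := fine \o g.
pose F0 (y : R) : R := \int[mu]_(t in [set` Interval (BRight (- n%:R : R)) (BRight y)]) h t.
have H1 (y : R) : mu.-integrable [set` Interval (BRight (- n%:R : R)) (BRight y)] (EFin \o h).
  by apply: integrableS gint => //; exact: measurable_itv.
have H2 : locally_integrable setT h by apply: open_integrable_locally => //; exact: openT.
have H := @FTC1 R h (BRight (- n%:R : R)) H1 H2; rewrite -/F0 in H.
move: H; apply: filterS; first exact: (ae_filter_ringOfSetsType mu).
move=> x H /andP[nx xn]; have [|dF _] := H; first exact: nx.
have eqF (y : R) : -n%:R < y < n%:R -> F0 y = f y - f (-n%:R).
  move=> yy; have [ny yn] := andP yy.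
  have mI : @measurable _ (measurableTypeR R) [set` Interval (BRight (- n%:R : R)) (BRight y)] by exact: measurable_itv.
  transitivity (fine (nu [set` Interval (BRight (- n%:R : R)) (BRight y)])); first by rewrite gE// [in RHS]gEfin.
  rewrite /nu/= /mfrestr/mrestr setIidl ?stieltjes_ocitv ?(ltW ny)//.
  by move=> z; rewrite /D/= !in_itv/= => /andP[nz zy]; apply/andP; split => //; exact: (le_trans zy (ltW yn)).
apply: derivable_near_shift dF => //.
near=> y; apply: eqF.
by near: y; apply: (@near_in_itvoo _ (-n%:R) n%:R x); rewrite in_itv/= nx.
Unshelve. all: by end_near. Qed.

End lipschitz_ae_derivable.

(** * Weighted edge counts and the shape of minimizers *)

Lemma leq_sum_at (F : nat -> nat) M p : (p < M)%N ->
  (F p <= \sum_(0 <= u < M) F u)%N.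
Proof. by move=> pM; rewrite big_mkord (bigD1 (Ordinal pM))//= leq_addr. Qed.

Lemma leq_sum_at2 (F : nat -> nat) M p q : (p < M)%N -> (q < M)%N -> p != q ->
  (F p + F q <= \sum_(0 <= u < M) F u)%N.
Proof.
move=> pM qM pq; rewrite big_mkord (bigD1 (Ordinal pM))//= leq_add2l.
by rewrite (bigD1 (Ordinal qM))/= ?leq_addr// -val_eqE/= eq_sym.
Qed.

Section variation.
Context {R : realFieldType}.
Implicit Types (f : nat -> bool) (w : nat -> R) (m n u : nat).

(** Weighted count of the boundary edges along one line of cells: [f u] tells whether cell [u]
    belongs to the set, and [w u] weighs the edge between the cells [u] and [u.+1]. *)
Definition variation f w m n : R :=
  \sum_(m <= u < n) w u *+ (f u != f u.+1).

Lemma variation_cat f w m n p : (m <= n)%N -> (n <= p)%N ->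
  variation f w m p = variation f w m n + variation f w n p.
Proof. by move=> mn np; rewrite /variation (big_cat_nat mn np). Qed.

Lemma variation1 f w m : variation f w m m.+1 = w m *+ (f m != f m.+1).
Proof. by rewrite /variation big_nat1. Qed.

Lemma eq_variation f g w m n : (forall u, (m <= u <= n)%N -> f u = g u) ->
  variation f w m n = variation g w m n.
Proof.
move=> fg; apply: eq_big_nat => u /andP[mu un].
by rewrite !fg// ?mu ?un ?(ltnW un)// leqW.
Qed.

Lemma variation_const f w m n b : (forall u, (m <= u <= n)%N -> f u = b) ->
  variation f w m n = 0.
Proof.
move=> fb; rewrite /variation big_nat big1// => u /andP[mu un].
by rewrite !fb ?eqxx ?mulr0n// ?mu ?un ?(ltnW un)// leqW.
Qed.

Arguments variation_cat {f w m} n {p}.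
Arguments variation_const {f w m n} b.

Lemma variation_interval w M a b : (0 < a)%N -> (a < b)%N -> (b <= M)%N ->
  variation (fun u => a <= u < b)%N w 0 M = w a.-1 + w b.-1.
Proof.
case: a => // a _; case: b => //= b; rewrite ltnS => ab bM.
rewrite (variation_cat a) //; last by lia.
rewrite (variation_cat (m := a) a.+1)//; last by lia.
rewrite (variation_cat (m := a.+1) b)//; last by lia.
rewrite (variation_cat (m := b) b.+1)//.
rewrite !variation1 (variation_const false); last by move=> u; lia.
rewrite (variation_const (m := a.+1) true); last by move=> u; lia.
rewrite (variation_const (m := b.+1) false); last by move=> u; lia.
have -> : ((a < a < b.+1)%N != (a < a.+1 < b.+1)%N) = true by lia.
have -> : ((a < b < b.+1)%N != (a < b.+1 < b.+1)%N) = true by lia.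
by rewrite !mulr1n !add0r !addr0.
Qed.

Section bounds.
Variables (w : nat -> R) (wmin wmax : R).
Hypotheses (wmin_ge0 : 0 <= wmin) (wminP : forall u, wmin <= w u)
  (wmaxP : forall u, w u <= wmax).

Lemma variation_ge0 f m n : 0 <= variation f w m n.
Proof. by apply: sumr_ge0 => u _; rewrite mulrn_wge0// (le_trans wmin_ge0). Qed.

Lemma variation_jump f m n : (m <= n)%N -> f m != f n ->
  wmin <= variation f w m n.
Proof.
elim: n => [|n IH]; first by rewrite leqn0 => /eqP ->; rewrite eqxx.
rewrite leq_eqVlt => /predU1P[->|]; first by rewrite eqxx.
rewrite ltnS => mn fmn; rewrite (variation_cat n mn (leqnSn n)) variation1.
have [E|E] := eqVneq (f m) (f n).
  by rewrite -E fmn mulr1n ler_wpDl// variation_ge0.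
by apply: ler_wpDr; [rewrite mulrn_wge0// (le_trans wmin_ge0)|apply: IH].
Qed.

Lemma variation_two f m n y : (m <= y <= n)%N -> f m = false -> f n = false ->
  f y -> 2 * wmin <= variation f w m n.
Proof.
move=> /andP[my yn] fm fn fy; rewrite (variation_cat y my yn) mulr2n mulrDl mul1r.
by apply: lerD; apply: variation_jump => //; rewrite ?fm ?fn fy.
Qed.

Let D := wmax - wmin.

(** A new edge appears at an end of the interval only if the cells on both sides of that end are in
    [f]. The outer one is then removed, and with it an old edge further out, of weight at least
    [wmin]; the excess is at most [D] and is charged to the removed cell. *)
Lemma variation_restrict f M a b : (0 < a)%N -> (a < b)%N -> (b <= M)%N ->
  f 0%N = false -> f M = false ->
  variation (fun u => f u && (a <= u < b)%N) w 0 M <=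
  variation f w 0 M + D * (\sum_(0 <= u < M) (f u && ~~ (a <= u < b)%N))%:R.
Proof.
have D0 : 0 <= D by rewrite subr_ge0 (le_trans (wminP 0%N)).
case: a => // a _; case: b => //= b; rewrite ltnS => ab bM f0 fM.
have aM : (a <= M)%N by lia.
have left : w a *+ f a.+1 <= variation f w 0 a.+1 + D *+ f a.
  case fa1: (f a.+1); last by rewrite mulr0n addr_ge0 ?variation_ge0// mulrn_wge0.
  case fa: (f a); rewrite ?mulr0n ?mulr1n.
    have : wmin <= variation f w 0 a.+1.
      rewrite (variation_cat a)// ler_wpDr ?variation_ge0//.
      by apply: variation_jump; rewrite // f0 fa.
    by have := wmaxP a; rewrite /D; lra.
  rewrite (variation_cat a)// variation1 fa fa1 mulr1n addr0.
  by rewrite ler_wpDl ?variation_ge0.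
have right : w b *+ f b <= variation f w b M + D *+ f b.+1.
  case fb: (f b); last by rewrite mulr0n addr_ge0 ?variation_ge0// mulrn_wge0.
  case fb1: (f b.+1); rewrite ?mulr0n ?mulr1n.
    have : wmin <= variation f w b M.
      by apply: variation_jump; [lia|rewrite fM fb].
    by have := wmaxP b; rewrite /D; lra.
  rewrite (variation_cat b.+1)// variation1 fb fb1 mulr1n addr0.
  by rewrite ler_wpDr ?variation_ge0.
have cnt : D *+ f a + D *+ f b.+1 <=
    D * (\sum_(0 <= u < M) (f u && ~~ (a.+1 <= u < b.+1)%N))%:R.
  rewrite -mulrnDr -[D *+ _]mulr_natr ler_wpM2l// ler_nat.
  have := bM; rewrite leq_eqVlt => /predU1P[bE|bM'].
    rewrite bE fM addn0; apply: leq_trans (leq_sum_at _ _); last exact: (leq_trans ab (ltnW bM)).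
    by rewrite ltnn/= andbT.
  apply: leq_trans (leq_sum_at2 _ (p := a) (q := b.+1) _ _ _) => //; try lia.
have -> : variation (fun u => f u && (a < u < b.+1)%N) w 0 M =
    w a *+ f a.+1 + variation f w a.+1 b + w b *+ f b.
  rewrite (variation_cat a)//.
  rewrite (variation_cat (m := a) a.+1)//; last by lia.
  rewrite (variation_cat (m := a.+1) b)//; last by lia.
  rewrite (variation_cat (m := b) b.+1)//.
  rewrite !variation1 (variation_const false); last by move=> u; lia.
  rewrite (variation_const (m := b.+1) false); last by move=> u; lia.
  rewrite (@eq_variation (fun u => f u && (a < u < b.+1)%N) f); last first.
    by move=> u ?; rewrite andbC; have -> : (a < u < b.+1)%N by lia.
  have -> : ((f a && (a < a < b.+1)%N) != (f a.+1 && (a < a.+1 < b.+1)%N)) = f a.+1.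
    by rewrite ltnn andbF ltnSn ltnS ab andbT; case: (f a.+1).
  have -> : ((f b && (a < b < b.+1)%N) != (f b.+1 && (a < b.+1 < b.+1)%N)) = f b.
    by rewrite ab ltnSn ltnn !andbF andbT; case: (f b).
  by rewrite add0r addr0 addrA.
rewrite (variation_cat a.+1 (p := M))//; last by lia.
by rewrite (variation_cat (m := a.+1) b (p := M))//; [lra|lia].
Qed.

(** If an end cell of the interval is missing from [f], an edge of weight at least [wmin] still
    separates [y] from the outside on that side, and the excess, at most [D], is charged to the
    missing end cell. If the end cell is present, the end edge is already counted. *)
Lemma variation_fill f M a b y : (0 < a)%N -> (b <= M)%N ->
  (forall u, f u -> (a <= u < b)%N) -> f y ->
  w a.-1 + w b.-1 <=
  variation f w 0 M + D * (\sum_(0 <= u < M) ((a <= u < b)%N && ~~ f u))%:R.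
Proof.
have D0 : 0 <= D by rewrite subr_ge0 (le_trans (wminP 0%N)).
case: a => // a _; case: b => [|b] bM fab fy; have := fab _ fy; first by lia.
move=> /andP[ay]; rewrite ltnS => yb /=.
have fF u : ~~ (a.+1 <= u < b.+1)%N -> f u = false.
  by move=> h; apply/negbTE; apply: contra h; exact: fab.
have left : w a <= variation f w 0 y + D *+ ~~ f a.+1.
  case fa1: (f a.+1); rewrite /= ?mulr0n ?mulr1n.
    rewrite (variation_cat a)//; last by lia.
    rewrite (variation_cat (m := a) a.+1)// variation1 fa1 (fF a); last by lia.
    by rewrite mulr1n; have := variation_ge0 f 0 a; have := variation_ge0 f a.+1 y; lra.
  have : wmin <= variation f w 0 y.
    by apply: variation_jump => //; rewrite fy fF.
  by have := wmaxP a; rewrite /D; lra.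
have right : w b <= variation f w y M + D *+ ~~ f b.
  case fb: (f b); rewrite /= ?mulr0n ?mulr1n.
    rewrite (variation_cat b)//; last by lia.
    rewrite (variation_cat (m := b) b.+1)// variation1 fb (fF b.+1); last by lia.
    by rewrite mulr1n; have := variation_ge0 f y b; have := variation_ge0 f b.+1 M; lra.
  have : wmin <= variation f w y M.
    by apply: variation_jump; [lia|rewrite fy fF//; lia].
  by have := wmaxP b; rewrite /D; lra.
have cnt : D *+ ~~ f a.+1 + D *+ ~~ f b <=
    D * (\sum_(0 <= u < M) ((a.+1 <= u < b.+1)%N && ~~ f u))%:R.
  rewrite -mulrnDr -[D *+ _]mulr_natr ler_wpM2l// ler_nat.
  (* An interval of one cell might be charged twice for that cell, but the cell is then [y], which
     is present. *)
  have [E|E] := eqVneq a.+1 b.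
    apply: leq_trans (leq_sum_at _ (p := b) _) => //.
    by rewrite E (_ : b = y) ?fy//; lia.
  apply: leq_trans (leq_sum_at2 _ (p := a.+1) (q := b) _ _ _) => //; try lia.
have yM : (y <= M)%N by lia.
by rewrite (variation_cat y (p := M))//; lra.
Qed.

(** The part of [f] before the gap at [x] has an edge on either side, since [f] is false at [0] and
    at [x]; erasing it creates no new edge. *)
Lemma variation_cut_left f M x : (x <= M)%N -> f 0%N = false -> f x = false ->
  forall y, (y < x)%N -> f y ->
  variation (fun u => f u && (x < u)%N) w 0 M + 2 * wmin <= variation f w 0 M.
Proof.
move=> xM f0 fx y yx fy.
rewrite [in leLHS](variation_cat x (p := M))// [leRHS](variation_cat x)//.
rewrite (variation_const false); last by move=> u ?; rewrite andbC ltnNge; have -> : (u <= x)%N by lia.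
rewrite (@eq_variation (fun u => f u && (x < u)%N) f); last first.
  move=> u /andP[xu _]; have := xu; rewrite leq_eqVlt => /predU1P[<-|->]; last by rewrite andbT.
  by rewrite fx.
have := variation_two (m := 0) (n := x) (y := y) (f := f); rewrite f0 fx fy (ltnW yx).
by move=> /(_ isT erefl erefl isT); lra.
Qed.

Lemma variation_cut_right f M x : (x <= M)%N -> f M = false -> f x = false ->
  forall y, (x < y <= M)%N -> f y ->
  variation (fun u => f u && (u < x)%N) w 0 M + 2 * wmin <= variation f w 0 M.
Proof.
move=> xM f0 fx y /andP[yx yM] fy.
rewrite [in leLHS](variation_cat x (p := M))// [leRHS](variation_cat x)//.
rewrite (variation_const (m := x) false); last by move=> u ?; rewrite andbC ltnNge; have -> : (x <= u)%N by lia.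
rewrite (@eq_variation (fun u => f u && (u < x)%N) f); last first.
  move=> u /andP[_ xu]; have := xu; rewrite leq_eqVlt => /predU1P[->|->]; last by rewrite andbT.
  by rewrite fx.
have := variation_two (m := x) (n := M) (y := y) (f := f); rewrite f0 fx fy (ltnW yx) yM.
by move=> /(_ isT erefl erefl isT); lra.
Qed.

End bounds.
End variation.

Arguments variation_cat {R f w m} n {p}.
Arguments variation_const {R f w m n} b.

Lemma sum_interval M a b :
  (\sum_(0 <= u < M) (a <= u < b)%N = minn b M - a)%N.
Proof.
elim: M => [|M IH]; first by rewrite big_geq//; lia.
by rewrite big_nat_recr//= IH; case: (leqP a M); case: (ltnP M b) => /= ? ?; lia.
Qed.

Definition inrect (x1 x2 y1 y2 i j : nat) : bool :=
  (x1 <= i < x2)%N && (y1 <= j < y2)%N.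

(** For [i] in the interval this is the distance to its complement, so the end cells have depth
    one. *)
Definition depth1 (x1 x2 i : nat) : nat := minn (i.+1 - x1) (x2 - i).

Definition in_box (M : nat) (a : nat -> nat -> bool) : Prop :=
  forall i j, a i j -> (0 < i < M)%N && (0 < j < M)%N.

Lemma sum_depth1_lt M X1 X2 D :
  (\sum_(0 <= u < M) ((X1 <= u < X2)%N && (depth1 X1 X2 u < D)%N) <= 2 * D)%N.
Proof.
apply: (@leq_trans (\sum_(0 <= u < M) ((X1 <= u < X1 + D)%N + (X2 - D <= u < X2)%N))).
  by apply: leq_sum => u _; rewrite /depth1; lia.
by rewrite big_split/= !sum_interval; lia.
Qed.

(** The central lines are met, so a missed line between two met ones would be shallow, with a met
    line on its outer side; the last two hypotheses forbid this. The length [2 * D] guarantees a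
    line of depth exactly [D] on either side. *)
Lemma hull_of_gap (met : nat -> bool) X1 X2 D : (0 < D)%N -> (X1 + 2 * D <= X2)%N ->
  (forall u, met u -> X1 <= u < X2)%N ->
  (forall u, (X1 <= u < X2)%N -> ~~ met u -> (depth1 X1 X2 u < D)%N) ->
  (forall x u, (X1 <= x < X2)%N -> ~~ met x -> (x.+1 - X1 < D)%N -> met u -> (x < u)%N) ->
  (forall x u, (X1 <= x < X2)%N -> ~~ met x -> (X2 - x < D)%N -> met u -> (u < x)%N) ->
  exists x1 x2, [/\ (X1 <= x1 < X1 + D)%N, (x2 <= X2 < x2 + D)%N &
                    forall u, met u = (x1 <= u < x2)%N].
Proof.
move=> D0 XD metX deep left right.
have met1 : met (X1 + D).-1.
  by apply: contraT => h; have := deep (X1 + D).-1; rewrite h /depth1; lia.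
have met2 : met (X2 - D)%N.
  by apply: contraT => h; have := deep (X2 - D)%N; rewrite h /depth1; lia.
have ex1 : exists u, met u by exists (X1 + D).-1.
have bnd u : met u -> (u <= X2)%N by move=> /metX; lia.
case: (ex_minnP ex1) => x1 mx1 x1min; case: (ex_maxnP ex1 bnd) => x2 mx2 x2max.
have := metX _ mx1; have := metX _ mx2; have := x1min _ met1; have := x2max _ met2.
move=> h1 h2 h3 h4; exists x1, x2.+1; split; [lia|lia|] => u.
apply/idP/idP => [mu|/andP[x1u ux2]]; first by rewrite x1min// ltnS x2max.
apply: contraT => nmu; have uX : (X1 <= u < X2)%N by lia.
have := deep _ uX nmu; rewrite /depth1 gtn_min => /orP[h|h].
  by have := left _ _ uX nmu h mx1; lia.
by have := right _ _ uX nmu h mx2; lia.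
Qed.

(** * Energy comparisons inside a box of cells *)

Section box_energy.
Context {R : realFieldType}.
Implicit Types (a b F : nat -> nat -> bool) (wh wv d : nat -> nat -> R) (k : R).

(* [wh i j] weights the edge between the cells (i, j) and (i + 1, j), and
   [wv i j] the edge between (i, j) and (i, j + 1). *)
Definition box_energy M wh wv k d F a : R :=
  \sum_(0 <= j < M) variation (a^~ j) (wh^~ j) 0 M +
  \sum_(0 <= i < M) variation (a i) (wv i) 0 M +
  k * \sum_(0 <= i < M) \sum_(0 <= j < M) d i j *+ (a i j != F i j).

(** Exchanges the two coordinates, so that each result on columns yields the one on rows. *)
Definition tr {A : Type} (f : nat -> nat -> A) : nat -> nat -> A := fun i j => f j i.

Lemma box_energy_tr M wh wv k d F a :
  box_energy M (tr wv) (tr wh) k (tr d) (tr F) (tr a) = box_energy M wh wv k d F a.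
Proof.
rewrite /box_energy [X in X + _]addrC; congr (_ + _ * _).
by rewrite exchange_big.
Qed.

Lemma ler_sum_at (g : nat -> R) M p : (forall u, 0 <= g u) -> (p < M)%N ->
  g p <= \sum_(0 <= u < M) g u.
Proof.
by move=> g0 pM; rewrite big_mkord (bigD1 (Ordinal pM))//= lerDl sumr_ge0.
Qed.

Lemma ler_sum_at2 (g : nat -> nat -> R) M p q : (forall u v, 0 <= g u v) ->
  (p < M)%N -> (q < M)%N ->
  g p q <= \sum_(0 <= u < M) \sum_(0 <= v < M) g u v.
Proof.
move=> g0 pM qM; apply: le_trans (ler_sum_at _ pM); last by move=> u; exact: sumr_ge0.
exact: (ler_sum_at (g := g p)).
Qed.

Lemma sum_nat_restrict (g : nat -> R) (M a b : nat) : (a <= b)%N -> (b <= M)%N ->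
  \sum_(0 <= u < M) g u *+ (a <= u < b)%N = \sum_(a <= u < b) g u.
Proof.
move=> ab bM; rewrite (big_cat_nat (n := a))//=; last exact: leq_trans bM.
rewrite (big_cat_nat (m := a) (n := b))//=.
rewrite big_nat big1 ?add0r; last by move=> u hu; rewrite (_ : (a <= u < b)%N = false) ?mulr0n//; lia.
rewrite [X in _ + X]big_nat [X in _ + X]big1 ?addr0; last by move=> u hu; rewrite (_ : (a <= u < b)%N = false) ?mulr0n//; lia.
by apply: eq_big_nat => u ->; rewrite mulr1n.
Qed.

Section minimizer.
Variables (M X1 X2 Y1 Y2 : nat) (wh wv d : nat -> nat -> R) (k wmin wmax : R).
Notation F := (inrect X1 X2 Y1 Y2).
Notation E := (box_energy M wh wv k d F).
Let Delta := wmax - wmin.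
Hypotheses (X1_gt0 : (0 < X1)%N) (X2M : (X2 <= M)%N)
  (Y1_gt0 : (0 < Y1)%N) (Y2M : (Y2 <= M)%N).
Hypotheses (X12 : (X1 < X2)%N) (Y12 : (Y1 < Y2)%N).
Hypotheses (wmin_ge0 : 0 <= wmin).
Hypotheses (wh_min : forall i j, wmin <= wh i j) (wh_max : forall i j, wh i j <= wmax).
Hypotheses (wv_min : forall i j, wmin <= wv i j) (wv_max : forall i j, wv i j <= wmax).
Hypothesis d_ge1 : forall i j, 1 <= d i j.
Hypothesis k_gt : 2 * Delta < k.

Let Delta_ge0 : 0 <= Delta.
Proof. by rewrite subr_ge0; exact: le_trans (wh_min 0 0) (wh_max 0 0). Qed.
Let k_ge0 : 0 <= k.
Proof. by apply: ltW; apply: le_lt_trans k_gt; rewrite mulr_ge0. Qed.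
Let d_ge0 i j : 0 <= d i j. Proof. exact: le_trans ler01 (d_ge1 i j). Qed.

(** [S] is the set of cells at which the passage from [a] to [b] removes a difference with [F]. Each
    of them costs at most [Delta] in its row and [Delta] in its column and saves at least [k], so by
    [k_gt] a nonempty [S] would make the energy of [b] strictly smaller. *)
Lemma box_energy_compare a b (S : nat -> nat -> bool) :
  (forall j, (j < M)%N -> variation (b^~ j) (wh^~ j) 0 M <=
    variation (a^~ j) (wh^~ j) 0 M + Delta * (\sum_(0 <= i < M) S i j)%:R) ->
  (forall i, (i < M)%N -> variation (b i) (wv i) 0 M <=
    variation (a i) (wv i) 0 M + Delta * (\sum_(0 <= j < M) S i j)%:R) ->
  (forall i j, (a i j != F i j) = (b i j != F i j) || S i j) ->
  (forall i j, ~~ ((b i j != F i j) && S i j)) ->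
  E a <= E b -> forall i j, (i < M)%N -> (j < M)%N -> S i j = false.
Proof.
move=> rows cols aS bS Eab i0 j0 iM jM; apply/negbTE/negP => S0.
pose g i j := (k * d i j - 2 * Delta) *+ S i j.
have g0 i j : 0 <= g i j.
  rewrite /g mulrn_wge0// subr_ge0 (le_trans (ltW k_gt))//.
  by rewrite -[leLHS]mulr1 ler_wpM2l.
have : 0 < \sum_(0 <= i < M) \sum_(0 <= j < M) g i j.
  apply: lt_le_trans (ler_sum_at2 g0 iM jM).
  rewrite /g S0 mulr1n subr_gt0 (lt_le_trans k_gt)//.
  by rewrite -[leLHS]mulr1 ler_wpM2l.
apply/negP; rewrite -leNgt.
have gE : \sum_(0 <= i < M) \sum_(0 <= j < M) g i j =
    k * (\sum_(0 <= i < M) \sum_(0 <= j < M) d i j *+ S i j) -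
    2 * (Delta * (\sum_(0 <= i < M) \sum_(0 <= j < M) S i j)%N%:R).
  rewrite natr_sum !mulr_sumr -sumrB; apply: eq_bigr => i _.
  rewrite natr_sum !mulr_sumr -sumrB; apply: eq_bigr => j _.
  by rewrite /g; case: (S i j); rewrite ?mulr1n ?mulr0n; lra.
have rows' : \sum_(0 <= j < M) variation (b^~ j) (wh^~ j) 0 M <=
    \sum_(0 <= j < M) variation (a^~ j) (wh^~ j) 0 M +
    Delta * (\sum_(0 <= i < M) \sum_(0 <= j < M) S i j)%N%:R.
  rewrite (_ : (\sum_(0 <= i < M) \sum_(0 <= j < M) S i j)%N = (\sum_(0 <= j < M) \sum_(0 <= i < M) S i j)%N); last exact: exchange_big.
  rewrite natr_sum mulr_sumr -big_split/=.
  by rewrite ler_sum_nat// => j /andP[_ jM']; exact: rows.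
have cols' : \sum_(0 <= i < M) variation (b i) (wv i) 0 M <=
    \sum_(0 <= i < M) variation (a i) (wv i) 0 M +
    Delta * (\sum_(0 <= i < M) \sum_(0 <= j < M) S i j)%N%:R.
  rewrite natr_sum mulr_sumr -big_split/=.
  by rewrite ler_sum_nat// => i /andP[_ iM']; exact: cols.
have dE : \sum_(0 <= i < M) \sum_(0 <= j < M) d i j *+ (a i j != F i j) =
    \sum_(0 <= i < M) \sum_(0 <= j < M) d i j *+ (b i j != F i j) +
    \sum_(0 <= i < M) \sum_(0 <= j < M) d i j *+ S i j.
  rewrite -big_split/=; apply: eq_bigr => i _.
  rewrite -big_split/=; apply: eq_bigr => j _.
  rewrite aS; have := bS i j; case: (b i j != F i j); case: (S i j) => //= _;
    by rewrite ?mulr1n ?mulr0n ?addr0 ?add0r.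
move: Eab; rewrite /box_energy dE gE mulrDr; lra.
Qed.

(** The competitor is the intersection with [F], which saves the penalty of the cells outside. Lines
    that meet [F] are handled by [variation_restrict]; lines that miss [F] become empty. *)
Lemma minimizer_subset a : in_box M a ->
  (forall b, in_box M b -> E a <= E b) -> forall i j, a i j -> F i j.
Proof.
move=> aM amin i j aij; have /andP[/andP[i0 iM] /andP[j0 jM]] := aM _ _ aij.
apply/negPn/negP => nF.
have a0 (u : nat) v : ~~ ((0 < u < M)%N && (0 < v < M)%N) -> a u v = false.
  by move=> h; apply/negbTE; apply: contra h; exact: aM.
suff : a i j && ~~ F i j = false by rewrite aij nF.
pose b i j := a i j && F i j.
apply: (@box_energy_compare a b (fun i j => a i j && ~~ F i j)) => //.
- move=> v vM; have [Yv|Yv] := boolP (Y1 <= v < Y2)%N.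
    have h0 : a 0 v = false by apply: a0.
    have hM : a M v = false by apply: a0; rewrite ltnn andbF.
    have := @variation_restrict _ (wh^~ v) wmin wmax wmin_ge0 (wh_min^~ v) (wh_max^~ v) (a^~ v) M X1 X2 X1_gt0 X12 X2M h0 hM.
    rewrite (@eq_variation _ (b^~ v) (fun u => a u v && (X1 <= u < X2)%N)); last first.
      by move=> u _; rewrite /b /inrect Yv andbT.
    move/le_trans; apply; rewrite lerD2l ler_wpM2l// ler_nat.
    by apply: leq_sum => u _; rewrite /inrect Yv andbT.
  rewrite (variation_const false); last by move=> u _; rewrite /b /inrect (negbTE Yv) !andbF.
  by rewrite addr_ge0 ?(variation_ge0 wmin_ge0)// mulr_ge0.
- move=> u uM; have [Xu|Xu] := boolP (X1 <= u < X2)%N.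
    have h0 : a u 0 = false by apply: a0; rewrite andbF.
    have hM : a u M = false by apply: a0; rewrite ltnn !andbF.
    have := @variation_restrict _ (wv u) wmin wmax wmin_ge0 (wv_min u) (wv_max u) (a u) M Y1 Y2 Y1_gt0 Y12 Y2M h0 hM.
    rewrite (@eq_variation _ (b u) (fun v => a u v && (Y1 <= v < Y2)%N)); last first.
      by move=> v _; rewrite /b /inrect Xu.
    move/le_trans; apply; rewrite lerD2l ler_wpM2l// ler_nat.
    by apply: leq_sum => v _; rewrite /inrect Xu.
  rewrite (variation_const false); last by move=> v _; rewrite /b /inrect (negbTE Xu) !andbF.
  by rewrite addr_ge0 ?(variation_ge0 wmin_ge0)// mulr_ge0.
- by move=> u v; rewrite /b; case: (a u v); case: (F u v).
- by move=> u v; rewrite /b; case: (a u v); case: (F u v).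
by apply: amin => u v /andP[+ _]; exact: aM.
Qed.

(** The bounding rectangle lies in [F], so filling it up removes penalty; [variation_fill] applies
    on each of its lines because each one contains a cell of [a]. *)
Lemma minimizer_rect a x1 x2 y1 y2 :
  (X1 <= x1)%N -> (x2 <= X2)%N -> (Y1 <= y1)%N -> (y2 <= Y2)%N ->
  (forall i j, a i j -> inrect x1 x2 y1 y2 i j) ->
  (forall i, (x1 <= i < x2)%N -> exists j, a i j) ->
  (forall j, (y1 <= j < y2)%N -> exists i, a i j) ->
  E a <= E (inrect x1 x2 y1 y2) -> forall i j, a i j = inrect x1 x2 y1 y2 i j.
Proof.
move=> X1x1 x2X2 Y1y1 y2Y2 aR cols rows aE i j.
apply/idP/idP => [/aR//|Rij]; apply/negPn/negP => naij.
have /andP[/andP[x1i ix2] /andP[y1j jy2]] := Rij.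
suff : inrect x1 x2 y1 y2 i j && ~~ a i j = false by rewrite Rij naij.
apply: (@box_energy_compare a (inrect x1 x2 y1 y2) (fun i j => inrect x1 x2 y1 y2 i j && ~~ a i j)) => //.
- move=> v vM; have [yv|yv] := boolP (y1 <= v < y2)%N.
    have [u auv] := rows _ yv.
    rewrite (@eq_variation _ (fun i => inrect x1 x2 y1 y2 i v) (fun u => (x1 <= u < x2)%N)); last first.
      by move=> ? _; rewrite /inrect yv andbT.
    have x1_gt0 : (0 < x1)%N by exact: leq_trans X1x1.
    have x2M : (x2 <= M)%N by exact: leq_trans X2M.
    have av z : a z v -> (x1 <= z < x2)%N by move=> /aR; rewrite /inrect yv andbT.
    have := @variation_fill _ (wh^~ v) wmin wmax wmin_ge0 (wh_min^~ v) (wh_max^~ v) (a^~ v) M x1 x2 u x1_gt0 x2M av auv.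
    rewrite (@variation_interval _ (wh^~ v) M x1 x2 x1_gt0 (leq_ltn_trans x1i ix2) x2M).
    move/le_trans; apply; rewrite lerD2l ler_wpM2l// ler_nat.
    by apply: leq_sum => z _; rewrite /inrect yv andbT.
  rewrite (variation_const false); last by move=> u _; rewrite /inrect (negbTE yv) !andbF.
  by rewrite addr_ge0 ?(variation_ge0 wmin_ge0)// mulr_ge0.
- move=> u uM; have [xu|xu] := boolP (x1 <= u < x2)%N.
    have [v auv] := cols _ xu.
    rewrite (@eq_variation _ (fun j => inrect x1 x2 y1 y2 u j) (fun v => (y1 <= v < y2)%N)); last first.
      by move=> ? _; rewrite /inrect xu.
    have y1_gt0 : (0 < y1)%N by exact: leq_trans Y1y1.
    have y2M : (y2 <= M)%N by exact: leq_trans Y2M.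
    have au z : a u z -> (y1 <= z < y2)%N by move=> /aR; rewrite /inrect xu.
    have := @variation_fill _ (wv u) wmin wmax wmin_ge0 (wv_min u) (wv_max u) (a u) M y1 y2 v y1_gt0 y2M au auv.
    rewrite (@variation_interval _ (wv u) M y1 y2 y1_gt0 (leq_ltn_trans y1j jy2) y2M).
    move/le_trans; apply; rewrite lerD2l ler_wpM2l// ler_nat.
    by apply: leq_sum => z _; rewrite /inrect xu.
  rewrite (variation_const false); last by move=> v _; rewrite /inrect (negbTE xu).
  by rewrite addr_ge0 ?(variation_ge0 wmin_ge0)// mulr_ge0.
- move=> u v; have := aR u v; rewrite /inrect.
  by case: (a u v) => [/(_ isT)|_]; lia.
- by move=> u v; rewrite /inrect; lia.
- exact: leq_trans ix2 (leq_trans x2X2 X2M).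
- exact: leq_trans jy2 (leq_trans y2Y2 Y2M).
Qed.

(** [keep] is the part retained on one side of the missed column [x0], left abstract to treat both
    sides at once. A row that loses cells saves at least [2 * wmin] in edges and gives up at most
    [D] cells of depth at most [D], a penalty of at most [k * D ^ 2]. Edges inside the erased
    columns only disappear. *)
Lemma minimizer_cut a (keep : nat -> bool) x0 D :
  in_box M a -> (forall b, in_box M b -> E a <= E b) ->
  (forall i j, a i j -> F i j) ->
  (forall f w, f 0%N = false -> f M = false -> f x0 = false ->
     (forall u : nat, wmin <= w u) -> forall y, (y < M)%N -> ~~ keep y -> f y ->
     variation (fun u => f u && keep u) w 0 M + 2 * wmin <= variation f w 0 M) ->
  (\sum_(0 <= i < M) (~~ keep i && (X1 <= i < X2)%N) <= D)%N ->
  (forall i j, F i j -> ~~ keep i -> d i j <= D%:R) ->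
  k * (D * D)%:R < 2 * wmin ->
  (forall j, a x0 j = false) ->
  forall i j, a i j -> keep i.
Proof.
move=> aM amin aF cut nkeep dD kD ax0 i j aij; apply/negPn/negP => nki.
have /andP[/andP[i0 iM] /andP[j0 jM]] := aM _ _ aij.
have a0 (u : nat) v : ~~ ((0 < u < M)%N && (0 < v < M)%N) -> a u v = false.
  by move=> h; apply/negbTE; apply: contra h; exact: aM.
pose b i j := a i j && keep i.
(* The rows that lose a cell: only these save edges across columns, and only these pay new
   penalty. *)
pose r v := has (fun u => a u v && ~~ keep u) (iota 0 M).
have rows v : variation (b^~ v) (wh^~ v) 0 M + (2 * wmin) *+ r v <= variation (a^~ v) (wh^~ v) 0 M.
  case rv: (r v); rewrite ?mulr1n ?mulr0n.
    have /hasP[u] := rv; rewrite mem_iota add0n => /andP[_ uM] /andP[auv nku].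
    apply: (@cut (a^~ v) (wh^~ v) _ _ _ _ u) => //; rewrite a0//; lia.
  rewrite addr0 (@eq_variation _ (b^~ v) (a^~ v))// => u /andP[_]; rewrite leq_eqVlt => /predU1P[->|uM].
    by rewrite /b a0// ltnn andbF.
  rewrite /b; case auv: (a u v) => //=; apply/negPn/negP => nku.
  by move/negbT/hasPn: rv => /(_ u); rewrite mem_iota add0n uM auv nku => /(_ isT).
have cols u : variation (b u) (wv u) 0 M <= variation (a u) (wv u) 0 M.
  case ku: (keep u); first by rewrite (@eq_variation _ (b u) (a u))// => v _; rewrite /b ku andbT.
  rewrite (variation_const false); first exact: (variation_ge0 wmin_ge0).
  by move=> v _; rewrite /b ku andbF.
have dist v : \sum_(0 <= u < M) d u v *+ (b u v != F u v) <=
    \sum_(0 <= u < M) d u v *+ (a u v != F u v) + (D * D)%:R *+ r v.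
  apply: (@le_trans _ _ (\sum_(0 <= u < M) (d u v *+ (a u v != F u v) + (D%:R *+ r v) *+ (~~ keep u && (X1 <= u < X2)%N)))).
    rewrite ler_sum_nat// => u /andP[_ uM].
    case auv: (a u v); last by rewrite /b auv/= lerDl !mulrn_wge0.
    have Fuv := aF _ _ auv; have /andP[Xu Yv] := Fuv.
    rewrite /b auv Fuv/= mulr0n add0r Xu andbT.
    case ku: (keep u); rewrite ?mulr0n// !mulr1n.
    have -> : r v by apply/hasP; exists u; rewrite ?mem_iota ?add0n// auv ku.
    by rewrite mulr1n dD// ku.
  rewrite big_split/= lerD2l sumrMnr -mulrnA natrM -[D%:R *+ _ in leLHS]mulr_natr.
  case: (r v); last by rewrite mul0n mulr0 mulr0n.
  by rewrite mul1n mulr1n ler_wpM2l// ler_nat.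
have bM : in_box M b by move=> u v /andP[+ _]; exact: aM.
have := amin b bM; apply/negP; rewrite -ltNge.
have rj : r j by apply/hasP; exists i; rewrite ?mem_iota ?add0n// aij nki.
have rpos : 0 < \sum_(0 <= v < M) (2 * wmin - k * (D * D)%:R) *+ r v.
  apply: lt_le_trans (ler_sum_at _ jM); last by move=> v; rewrite mulrn_wge0// subr_ge0 ltW.
  by rewrite rj mulr1n subr_gt0.
have rows' : \sum_(0 <= v < M) variation (b^~ v) (wh^~ v) 0 M + \sum_(0 <= v < M) (2 * wmin) *+ r v <=
    \sum_(0 <= v < M) variation (a^~ v) (wh^~ v) 0 M by rewrite -big_split/= ler_sum.
have cols' : \sum_(0 <= u < M) variation (b u) (wv u) 0 M <=
    \sum_(0 <= u < M) variation (a u) (wv u) 0 M by rewrite ler_sum.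
have dist' : \sum_(0 <= u < M) \sum_(0 <= v < M) d u v *+ (b u v != F u v) <=
    \sum_(0 <= u < M) \sum_(0 <= v < M) d u v *+ (a u v != F u v) + \sum_(0 <= v < M) (D * D)%:R *+ r v.
  by rewrite exchange_big [X in _ <= X + _]exchange_big -big_split/= ler_sum.
have {}dist' := ler_wpM2l k_ge0 dist'.
have rE : \sum_(0 <= v < M) (2 * wmin - k * (D * D)%:R) *+ r v =
    \sum_(0 <= v < M) (2 * wmin) *+ r v - k * \sum_(0 <= v < M) (D * D)%:R *+ r v.
  rewrite mulr_sumr -sumrB; apply: eq_bigr => v _.
  by case: (r v); rewrite ?mulr1n ?mulr0n; lra.
by move: dist'; rewrite /box_energy mulrDr; lra.
Qed.

End minimizer.
End box_energy.

(** * Depth of the lines of cells that a minimizer misses *)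

Section core.
Context {R : realFieldType}.
Implicit Types (a b F : nat -> nat -> bool).

(** For a cell of the rectangle this is the sup-norm distance to the complement, in cells. *)
Definition depth (X1 X2 Y1 Y2 i j : nat) : nat := minn (depth1 X1 X2 i) (depth1 Y1 Y2 j).

Definition line_missed (M : nat) a (i : nat) : bool := all (fun j => ~~ a i j) (iota 0 M).

Lemma line_missedP M a i : in_box M a -> reflect (forall j, a i j = false) (line_missed M a i).
Proof.
move=> aM; apply: (iffP allP) => [h j|h j _]; last by rewrite h.
apply/negbTE/negP => aij; have := h j; rewrite aij mem_iota add0n.
by have /andP[_ /andP[_ ->]] := aM _ _ aij => /(_ isT).
Qed.

(** The rows of depth greater than [D] make up at least half of the column because
    [4 * D <= Y2 - Y1], whence the factor two; on them the depth of the cell is at least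
    [minn (depth1 X1 X2 i) D]. *)
Lemma sum_depth_ge (X1 X2 Y1 Y2 D i : nat) (d : nat -> R) :
  (X1 <= i < X2)%N -> (Y1 < Y2)%N -> (4 * D <= Y2 - Y1)%N ->
  (forall j, (Y1 <= j < Y2)%N -> d j = (depth X1 X2 Y1 Y2 i j)%:R) ->
  (minn (depth1 X1 X2 i) D)%:R * (Y2 - Y1)%:R <= 2 * \sum_(Y1 <= j < Y2) d j.
Proof.
move=> iX Y12 DY dE.
have le1 : (minn (depth1 X1 X2 i) D * (Y2 - D - (Y1 + D)) <= \sum_(Y1 + D <= j < Y2 - D) depth X1 X2 Y1 Y2 i j)%N.
  rewrite mulnC -sum_nat_const_nat big_nat [leqRHS]big_nat.
  by apply: leq_sum => j hj; rewrite /depth /depth1; lia.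
have le2 : (\sum_(Y1 + D <= j < Y2 - D) depth X1 X2 Y1 Y2 i j <= \sum_(Y1 <= j < Y2) depth X1 X2 Y1 Y2 i j)%N.
  rewrite [leqRHS](big_cat_nat (n := (Y1 + D)%N))/=; [|lia|lia].
  rewrite [X in (_ <= _ + X)%N](big_cat_nat (n := (Y2 - D)%N))/=; [|lia|lia].
  by rewrite addnCA leq_addr.
have -> : \sum_(Y1 <= j < Y2) d j = (\sum_(Y1 <= j < Y2) depth X1 X2 Y1 Y2 i j)%:R.
  by rewrite natr_sum; apply: eq_big_nat.
rewrite -natrM -[2]/(2%:R) -natrM ler_nat.
apply: leq_trans (leq_mul (leqnn 2) (leq_trans le1 le2)).
by rewrite mulnCA leq_mul2l; apply/orP; right; lia.
Qed.

(** Only lines of depth below [D0] can contribute negatively; there are at most [2 * D0] of them,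
    each contributing at least [-2]. *)
Lemma missed_sum_ge (M X1 X2 D0 : nat) (miss : nat -> bool) (phi : nat -> R) :
  (forall i, (X1 <= i < X2)%N -> - 2 *+ (depth1 X1 X2 i < D0)%N <= phi i) ->
  let S := \sum_(0 <= i < M) phi i *+ ((X1 <= i < X2)%N && miss i) in
  - (4 * D0)%:R <= S /\
  forall i, (i < M)%N -> (X1 <= i < X2)%N -> miss i -> 0 <= phi i ->
    phi i - (4 * D0)%:R <= S.
Proof.
move=> phi_ge S.
pose psi i := phi i *+ ((X1 <= i < X2)%N && miss i) + 2 *+ ((X1 <= i < X2)%N && (depth1 X1 X2 i < D0)%N).
have psi_ge0 i : 0 <= psi i.
  rewrite /psi; have [iX|] := boolP (X1 <= i < X2)%N; last by rewrite !mulr0n addr0.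
  have := phi_ge _ iX; rewrite !andTb.
  by case: (miss i); case: (depth1 _ _ _ < _)%N; rewrite ?mulr1n ?mulr0n; lra.
have psiE : \sum_(0 <= i < M) psi i <= S + (4 * D0)%:R.
  rewrite /psi big_split/= lerD2l sumrMnr -[2 *+ _]mulr_natr -natrM ler_nat.
  by rewrite (_ : 4 * D0 = 2 * (2 * D0))%N ?leq_mul2l ?sum_depth1_lt ?orbT// mulnA.
split.
  have : 0 <= \sum_(0 <= i < M) psi i by exact: sumr_ge0.
  by lra.
move=> i iM iX mi phi0.
have := ler_sum_at psi_ge0 iM; rewrite {1}/psi iX mi mulr1n.
have : 0 <= 2 *+ (true && (depth1 X1 X2 i < D0)%N) :> R by rewrite mulrn_wge0.
by lra.
Qed.

Section rectangle.
Variables (M X1 X2 Y1 Y2 D D0 : nat) (wh wv d : nat -> nat -> R) (k wmin wmax lam Lam : R).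
Notation F := (inrect X1 X2 Y1 Y2).
Notation E := (box_energy M wh wv k d F).
Let Delta := wmax - wmin.
Hypotheses (X1_gt0 : (0 < X1)%N) (X2M : (X2 <= M)%N) (Y1_gt0 : (0 < Y1)%N) (Y2M : (Y2 <= M)%N).
Hypotheses (DX : (4 * D <= X2 - X1)%N) (DY : (4 * D <= Y2 - Y1)%N) (D0_gt0 : (0 < D0)%N) (D0D : (D0 <= D)%N).
Hypotheses (wmin_ge0 : 0 <= wmin) (wmin_le1 : wmin <= 1).
Hypotheses (wh_min : forall i j, wmin <= wh i j) (wh_max : forall i j, wh i j <= wmax).
Hypotheses (wv_min : forall i j, wmin <= wv i j) (wv_max : forall i j, wv i j <= wmax).
Hypothesis d_ge1 : forall i j, 1 <= d i j.
Hypothesis dE : forall i j, F i j -> d i j = (depth X1 X2 Y1 Y2 i j)%:R.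
Hypothesis k_gt : 2 * Delta < k.
Hypotheses (lamX : lam <= k * (X2 - X1)%:R) (lamY : lam <= k * (Y2 - Y1)%:R).
Hypothesis LamP : k * (X2 - X1 + (Y2 - Y1))%:R <= Lam.
Hypotheses (lamD0 : 8 <= lam * D0%:R) (lamD : Lam + 2 + (8 * D0)%:R < lam * D%:R / 4).
Hypothesis kD : k * (D * D)%:R < 2 * wmin.

Let D_gt0 : (0 < D)%N. Proof. exact: leq_trans D0D. Qed.
Let X12 : (X1 < X2)%N. Proof. by move: DX D_gt0; clear; lia. Qed.
Let Y12 : (Y1 < Y2)%N. Proof. by move: DY D_gt0; clear; lia. Qed.
Let F_in_box : in_box M F.
Proof. by move=> i j; move: X1_gt0 X2M Y1_gt0 Y2M; rewrite /inrect; clear; lia. Qed.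
Let lam_gt0 : 0 < lam.
Proof.
rewrite ltNge; apply/negP => l0; have : lam * D0%:R <= 0 by rewrite mulr_le0_ge0.
by move: lamD0; lra.
Qed.
Let Delta_ge0 : 0 <= Delta.
Proof. by rewrite subr_ge0; exact: le_trans (wh_min 0 0) (wh_max 0 0). Qed.
Let k_ge0 : 0 <= k.
Proof. by apply: ltW; apply: le_lt_trans k_gt; rewrite mulr_ge0. Qed.
Let d_ge0 i j : 0 <= d i j. Proof. exact: le_trans ler01 (d_ge1 i j). Qed.

(* The cost of leaving the column [i] empty: a lower bound for the penalty of its
   cells, minus the two edges saved. *)
Let colphi (i : nat) : R := k / 4 * (Y2 - Y1)%:R * (minn (depth1 X1 X2 i) D)%:R - 2 * wmin.
Let rowphi (j : nat) : R := k / 4 * (X2 - X1)%:R * (minn (depth1 Y1 Y2 j) D)%:R - 2 * wmin.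

(** Comparison with [F] itself: every met line of [a] has two edges of weight at least [wmin], and
    the perimeter of [F] is at most [2 * wmax] per line. The discrepancy of [2 * Delta] per line is
    absorbed in [Lam], since [2 * Delta < k]. *)
Lemma crude_estimate a : in_box M a -> (forall i j, a i j -> F i j) -> E a <= E F ->
  \sum_(0 <= i < M) colphi i *+ ((X1 <= i < X2)%N && line_missed M a i) +
  \sum_(0 <= j < M) rowphi j *+ ((Y1 <= j < Y2)%N && line_missed M (tr a) j) <= Lam.
Proof.
move=> aM aF aE.
have aM' : in_box M (tr a) by move=> i j /aM; rewrite andbC.
have EF : E F <= 2 * wmax * (X2 - X1 + (Y2 - Y1))%:R.
  rewrite /box_energy [X in _ + k * X]big1 ?mulr0 ?addr0; last first.
    by move=> i _; apply: big1 => j _; rewrite eqxx.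
  rewrite natrD mulrDr addrC; apply: lerD.
    apply: (@le_trans _ _ (\sum_(0 <= i < M) (2 * wmax) *+ (X1 <= i < X2)%N)).
      apply: ler_sum => i _; have [iX|iX] := boolP (X1 <= i < X2)%N.
        rewrite (@eq_variation _ _ (fun j => (Y1 <= j < Y2)%N)); last by move=> j _; rewrite /inrect iX.
        rewrite variation_interval// mulr1n.
        by have := wv_max i Y1.-1; have := wv_max i Y2.-1; lra.
      by rewrite (variation_const false)// => j _; rewrite /inrect (negbTE iX).
    by rewrite sumrMnr sum_interval (minn_idPl X2M) mulr_natr.
  apply: (@le_trans _ _ (\sum_(0 <= j < M) (2 * wmax) *+ (Y1 <= j < Y2)%N)).
    apply: ler_sum => j _; have [jY|jY] := boolP (Y1 <= j < Y2)%N.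
      rewrite (@eq_variation _ _ (fun i => (X1 <= i < X2)%N)); last by move=> i _; rewrite /inrect jY andbT.
      rewrite variation_interval// mulr1n.
      by have := wh_max X1.-1 j; have := wh_max X2.-1 j; lra.
    by rewrite (variation_const false)// => i _; rewrite /inrect (negbTE jY) andbF.
  by rewrite sumrMnr sum_interval (minn_idPl Y2M) mulr_natr.
have cols i : (2 * wmin) *+ ((X1 <= i < X2)%N && ~~ line_missed M a i) <= variation (a i) (wv i) 0 M.
  case: (line_missedP i aM) => [_|h]; rewrite ?andbF ?andbT ?mulr0n ?(variation_ge0 wmin_ge0)//.
  have [iX|iX] := boolP (X1 <= i < X2)%N; last by rewrite mulr0n (variation_ge0 wmin_ge0).
  have [j aij] : exists j, a i j.
    by apply: contrapT => hn; apply: h => j; apply/negbTE/negP => aij; apply: hn; exists j.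
  have /andP[_ /andP[j0 jM]] := aM _ _ aij.
  rewrite mulr1n; apply: (variation_two wmin_ge0 (wv_min i) (y := j)) => //; first by rewrite (ltnW jM).
    by apply/negbTE/negP => /aM; rewrite andbF.
  by apply/negbTE/negP => /aM; rewrite ltnn !andbF.
have rows j : (2 * wmin) *+ ((Y1 <= j < Y2)%N && ~~ line_missed M (tr a) j) <= variation (a^~ j) (wh^~ j) 0 M.
  case: (line_missedP j aM') => [_|h]; rewrite ?andbF ?andbT ?mulr0n ?(variation_ge0 wmin_ge0)//.
  have [jY|jY] := boolP (Y1 <= j < Y2)%N; last by rewrite mulr0n (variation_ge0 wmin_ge0).
  have [i aij] : exists i, a i j.
    by apply: contrapT => hn; apply: h => i; apply/negbTE/negP => aij; apply: hn; exists i.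
  have /andP[/andP[i0 iM] _] := aM _ _ aij.
  rewrite mulr1n; apply: (variation_two wmin_ge0 (wh_min^~ j) (y := i)) => //; first by rewrite (ltnW iM).
    by apply/negbTE/negP => /aM.
  by apply/negbTE/negP => /aM; rewrite ltnn andbF.
(* A cell may lie in a missed column and in a missed row at once, hence the factor two; together
   with the one of [sum_depth_ge] it produces the [k / 4] in [colphi]. *)
have dist : \sum_(0 <= i < M) \sum_(0 <= j < M) d i j *+ (F i j && line_missed M a i) +
    \sum_(0 <= i < M) \sum_(0 <= j < M) d i j *+ (F i j && line_missed M (tr a) j) <=
    2 * \sum_(0 <= i < M) \sum_(0 <= j < M) d i j *+ (a i j != F i j).
  rewrite mulr_sumr -big_split/=; apply: ler_sum => i _.
  rewrite mulr_sumr -big_split/=; apply: ler_sum => j _.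
  have d0 := d_ge0 i j.
  case aij: (a i j).
    rewrite (aF _ _ aij)/=; case: (line_missedP i aM) => [h|_]; first by rewrite h in aij.
    by case: (line_missedP j aM') => [h|_]; [have := h i; rewrite /tr aij|rewrite !mulr0n addr0 mulr0].
  case: (F i j) => /=; last by rewrite !mulr0n addr0 mulr0.
  by case: (line_missed M a i); case: (line_missed M (tr a) j); rewrite ?mulr1n ?mulr0n; lra.
have colsd i : k / 4 * (Y2 - Y1)%:R * (minn (depth1 X1 X2 i) D)%:R *+ ((X1 <= i < X2)%N && line_missed M a i) <=
    k / 2 * \sum_(0 <= j < M) d i j *+ (F i j && line_missed M a i).
  have [/andP[iX mi]|nh] := boolP ((X1 <= i < X2)%N && line_missed M a i); last first.
    by rewrite mulr0n mulr_ge0 ?divr_ge0// sumr_ge0// => j _; rewrite mulrn_wge0.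
  rewrite mulr1n [X in _ / 2 * X](_ : _ = \sum_(0 <= j < M) d i j *+ (Y1 <= j < Y2)%N); last first.
    by apply: eq_bigr => j _; rewrite /inrect iX mi andbT.
  rewrite sum_nat_restrict// ?(ltnW Y12)//.
  have di j : (Y1 <= j < Y2)%N -> d i j = (depth X1 X2 Y1 Y2 i j)%:R.
    by move=> jY; rewrite dE// /inrect iX.
  have := sum_depth_ge iX Y12 DY di.
  by move=> /(ler_wpM2l k_ge0); lra.
have rowsd j : k / 4 * (X2 - X1)%:R * (minn (depth1 Y1 Y2 j) D)%:R *+ ((Y1 <= j < Y2)%N && line_missed M (tr a) j) <=
    k / 2 * \sum_(0 <= i < M) d i j *+ (F i j && line_missed M (tr a) j).
  have [/andP[jY mj]|nh] := boolP ((Y1 <= j < Y2)%N && line_missed M (tr a) j); last first.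
    by rewrite mulr0n mulr_ge0 ?divr_ge0// sumr_ge0// => i _; rewrite mulrn_wge0.
  rewrite mulr1n [X in _ / 2 * X](_ : _ = \sum_(0 <= i < M) d i j *+ (X1 <= i < X2)%N); last first.
    by apply: eq_bigr => i _; rewrite /inrect jY mj !andbT.
  rewrite sum_nat_restrict// ?(ltnW X12)//.
  have dj i : (X1 <= i < X2)%N -> d i j = (depth Y1 Y2 X1 X2 j i)%:R.
    by move=> iX; rewrite dE ?/inrect ?iX// /depth minnC.
  have := sum_depth_ge jY X12 DX dj.
  by move=> /(ler_wpM2l k_ge0); lra.
have colsum : \sum_(0 <= i < M) colphi i *+ ((X1 <= i < X2)%N && line_missed M a i) + 2 * wmin * (X2 - X1)%:R <=
    \sum_(0 <= i < M) variation (a i) (wv i) 0 M +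
    k / 2 * \sum_(0 <= i < M) \sum_(0 <= j < M) d i j *+ (F i j && line_missed M a i).
  have nX : \sum_(0 <= i < M) (2 * wmin) *+ (X1 <= i < X2)%N = 2 * wmin * (X2 - X1)%:R.
    by rewrite sumrMnr sum_interval (minn_idPl X2M) mulr_natr.
  rewrite mulr_sumr -nX -!big_split/=.
  apply: ler_sum => i _; have := cols i; have := colsd i; rewrite /colphi.
  case: (X1 <= i < X2)%N; case: (line_missed M a i); rewrite /= ?mulr1n ?mulr0n; lra.
have rowsum : \sum_(0 <= j < M) rowphi j *+ ((Y1 <= j < Y2)%N && line_missed M (tr a) j) + 2 * wmin * (Y2 - Y1)%:R <=
    \sum_(0 <= j < M) variation (a^~ j) (wh^~ j) 0 M +
    k / 2 * \sum_(0 <= i < M) \sum_(0 <= j < M) d i j *+ (F i j && line_missed M (tr a) j).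
  have nY : \sum_(0 <= j < M) (2 * wmin) *+ (Y1 <= j < Y2)%N = 2 * wmin * (Y2 - Y1)%:R.
    by rewrite sumrMnr sum_interval (minn_idPl Y2M) mulr_natr.
  have -> : \sum_(0 <= i < M) \sum_(0 <= j < M) d i j *+ (F i j && line_missed M (tr a) j) =
    \sum_(0 <= j < M) \sum_(0 <= i < M) d i j *+ (F i j && line_missed M (tr a) j) by exact: exchange_big.
  rewrite mulr_sumr -nY -!big_split/=.
  apply: ler_sum => j _; have := rows j; have := rowsd j; rewrite /rowphi.
  case: (Y1 <= j < Y2)%N; case: (line_missed M (tr a) j); rewrite /= ?mulr1n ?mulr0n; lra.
have {}dist := ler_wpM2l k_ge0 dist.
have kn : 2 * Delta * (X2 - X1 + (Y2 - Y1))%:R <= k * (X2 - X1 + (Y2 - Y1))%:R by rewrite ler_wpM2r// ltW.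
move: aE EF LamP kn colsum rowsum dist; rewrite {1}/box_energy /Delta natrD; lra.
Qed.

(** A missed line of depth at least [D] would by itself contribute more than [Lam + 8 * D0], while
    shallow missed columns and rows take away at most [4 * D0] each in total; this contradicts
    [crude_estimate]. *)
Lemma missed_line_depth a : in_box M a -> (forall i j, a i j -> F i j) -> E a <= E F ->
  (forall i, (X1 <= i < X2)%N -> line_missed M a i -> (depth1 X1 X2 i < D)%N) /\
  (forall j, (Y1 <= j < Y2)%N -> line_missed M (tr a) j -> (depth1 Y1 Y2 j < D)%N).
Proof.
move=> aM aF aE; have est := crude_estimate aM aF aE.
(* From depth [D0] on, a missed line costs at least what it saves, because
   [lam * D0 / 4 >= 2 >= 2 * wmin]. *)
have phi_ge (n m : nat) : lam <= k * n%:R ->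
    - 2 *+ (m < D0)%N <= k / 4 * n%:R * (minn m D)%:R - 2 * wmin.
  move=> ln; have [mD0|mD0] := ltnP m D0.
    rewrite mulr1n; have : 0 <= k / 4 * n%:R * (minn m D)%:R by rewrite !mulr_ge0// divr_ge0.
    by move: wmin_le1; lra.
  rewrite mulr0n.
  have : lam * D0%:R <= k * n%:R * (minn m D)%:R.
    by apply: ler_pM => //; [exact: ltW|rewrite ler_nat leq_min mD0].
  by move: wmin_le1 lamD0; lra.
have phi_big (n m : nat) : lam <= k * n%:R -> (D <= m)%N ->
    Lam + (8 * D0)%:R < k / 4 * n%:R * (minn m D)%:R - 2 * wmin.
  move=> ln Dm; rewrite (minn_idPr Dm).
  have : lam * D%:R <= k * n%:R * D%:R by rewrite ler_wpM2r.
  by move: wmin_le1 lamD; lra.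
have Lam_ge0 : 0 <= Lam by apply: le_trans LamP; rewrite mulr_ge0.
have [col1 col2] := @missed_sum_ge M X1 X2 D0 (line_missed M a) colphi (fun i _ => phi_ge _ _ lamY).
have [row1 row2] := @missed_sum_ge M Y1 Y2 D0 (line_missed M (tr a)) rowphi (fun j _ => phi_ge _ _ lamX).
have D8 : (8 * D0)%:R = (4 * D0)%:R + (4 * D0)%:R :> R by rewrite -natrD -mulnDl.
have D80 : 0 <= (8 * D0)%:R :> R by [].
split=> [i iX mi|j jY mj]; rewrite ltnNge; apply/negP => Dd.
  have big : Lam + (8 * D0)%:R < colphi i := phi_big _ _ lamY Dd.
  have iM : (i < M)%N by case/andP: iX => _ /leq_trans; apply.
  have ci0 : 0 <= colphi i by lra.
  by have := col2 _ iM iX mi ci0; move: est row1 big; rewrite D8; lra.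
have big : Lam + (8 * D0)%:R < rowphi j := phi_big _ _ lamX Dd.
have jM : (j < M)%N by case/andP: jY => _ /leq_trans; apply.
have ci0 : 0 <= rowphi j by lra.
by have := row2 _ jM jY mj ci0; move: est col1 big; rewrite D8; lra.
Qed.

(** By [missed_line_depth] a missed column has fewer than [D] columns beyond it on its outer side,
    all of small depth. Hence [kD] makes [minimizer_cut] applicable, nothing of [a] is left beyond a
    missed column, and [hull_of_gap] concludes. *)
Lemma columns_interval a : in_box M a -> (forall b, in_box M b -> E a <= E b) ->
  exists x1 x2, [/\ (X1 <= x1 < X1 + D)%N, (x2 <= X2 < x2 + D)%N &
    forall i, ~~ line_missed M a i = (x1 <= i < x2)%N].
Proof.
move=> aM amin.
have aF : forall i j, a i j -> F i j.
  exact: (minimizer_subset X1_gt0 X2M Y1_gt0 Y2M X12 Y12 wmin_ge0 wh_min wh_max wv_min wv_max d_ge1 k_gt aM amin).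
have [deep _] := missed_line_depth aM aF (amin F F_in_box).
have met_ex i : ~~ line_missed M a i -> exists j, a i j.
  move=> /line_missedP-/(_ aM) h; apply: contrapT => hn; apply: h => j.
  by apply/negbTE/negP => aij; apply: hn; exists j.
apply: (@hull_of_gap (fun i => ~~ line_missed M a i) X1 X2 D) => //.
- by move: DX D_gt0; clear; lia.
- by move=> i /met_ex[j /aF/andP[]].
- by move=> i iX /negPn; exact: deep.
- move=> x u xX /negPn/line_missedP-/(_ aM) ax xD /met_ex[j auj].
  apply: (@minimizer_cut _ _ _ _ _ _ _ _ _ _ _ _ X1_gt0 X2M Y1_gt0 Y2M X12 Y12 wmin_ge0 wh_min wh_max wv_min k_gt a (fun u => x < u)%N x D aM amin aF _ _ _ kD ax u j auj).
  + move=> f w f0 fM fx w_min y yM; rewrite -leqNgt leq_eqVlt => /predU1P[->|yx fy]; first by rewrite fx.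
    by apply: (variation_cut_left wmin_ge0 w_min _ f0 fx yx fy); case/andP: xX => _ /leq_trans-/(_ _ X2M)/ltnW.
  + apply: (@leq_trans (\sum_(0 <= i < M) (X1 <= i < x.+1)%N)); first by apply: leq_sum => i _; clear; lia.
    by rewrite sum_interval; move: xX xD; clear; lia.
  + move=> i j' Fij; rewrite -leqNgt => ix; rewrite dE// ler_nat /depth /depth1.
    by move: xX xD ix; clear; lia.
- move=> x u xX /negPn/line_missedP-/(_ aM) ax xD /met_ex[j auj].
  apply: (@minimizer_cut _ _ _ _ _ _ _ _ _ _ _ _ X1_gt0 X2M Y1_gt0 Y2M X12 Y12 wmin_ge0 wh_min wh_max wv_min k_gt a (fun u => u < x)%N x D aM amin aF _ _ _ kD ax u j auj).
  + move=> f w f0 fM fx w_min y yM; rewrite -leqNgt leq_eqVlt => /predU1P[<-|yx fy]; first by rewrite fx.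
    apply: (variation_cut_right wmin_ge0 w_min _ fM fx _ fy); last by rewrite yx ltnW.
    by case/andP: xX => _ /leq_trans-/(_ _ X2M)/ltnW.
  + apply: (@leq_trans (\sum_(0 <= i < M) (x <= i < X2)%N)); first by apply: leq_sum => i _; clear; lia.
    by rewrite sum_interval; move: xX xD; clear; lia.
  + move=> i j' Fij; rewrite -leqNgt => ix; rewrite dE// ler_nat /depth /depth1.
    by move: xX xD ix; clear; lia.
Qed.

End rectangle.
End core.

(** * Sides of a minimizer and the number of cells they cross *)

Section one_step.
Context {R : realFieldType}.
Implicit Types (a b : nat -> nat -> bool).

(* [D] bounds the number of cells a side moves in one step, and [lam] and [Lam]
   bound the rescaled side lengths; [D0] is the depth beyond which leaving a
   whole line of cells empty costs more than it saves in perimeter. *)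
Record large_rectangle (M X1 X2 Y1 Y2 D D0 : nat) (wh wv d : nat -> nat -> R)
    (k wmin wmax lam Lam : R) : Prop := LargeRectangle {
  lr_X1 : (0 < X1)%N; lr_X2 : (X2 <= M)%N; lr_Y1 : (0 < Y1)%N; lr_Y2 : (Y2 <= M)%N;
  lr_DX : (4 * D <= X2 - X1)%N; lr_DY : (4 * D <= Y2 - Y1)%N;
  lr_D0 : (0 < D0)%N; lr_D0D : (D0 <= D)%N;
  lr_wmin_ge0 : 0 <= wmin; lr_wmin_le1 : wmin <= 1;
  lr_wh_min : forall i j, wmin <= wh i j; lr_wh_max : forall i j, wh i j <= wmax;
  lr_wv_min : forall i j, wmin <= wv i j; lr_wv_max : forall i j, wv i j <= wmax;
  lr_d_ge1 : forall i j, 1 <= d i j;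
  lr_dE : forall i j, inrect X1 X2 Y1 Y2 i j -> d i j = (depth X1 X2 Y1 Y2 i j)%:R;
  lr_k_gt : 2 * (wmax - wmin) < k;
  lr_lamX : lam <= k * (X2 - X1)%:R; lr_lamY : lam <= k * (Y2 - Y1)%:R;
  lr_Lam : k * (X2 - X1 + (Y2 - Y1))%:R <= Lam;
  lr_lamD0 : 8 <= lam * D0%:R; lr_lamD : Lam + 2 + (8 * D0)%:R < lam * D%:R / 4;
  lr_kD : k * (D * D)%:R < 2 * wmin }.

Lemma inrect_tr x1 x2 y1 y2 : tr (inrect x1 x2 y1 y2) = inrect y1 y2 x1 x2.
Proof. by apply/funext => i; apply/funext => j; rewrite /tr /inrect andbC. Qed.

Lemma large_rectangle_tr M X1 X2 Y1 Y2 D D0 wh wv d k wmin wmax lam Lam :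
  large_rectangle M X1 X2 Y1 Y2 D D0 wh wv d k wmin wmax lam Lam ->
  large_rectangle M Y1 Y2 X1 X2 D D0 (tr wv) (tr wh) (tr d) k wmin wmax lam Lam.
Proof.
move=> L; have [] := L; split=> //; try by move=> i j; rewrite /tr.
  by move=> i j; rewrite -inrect_tr /tr => /(lr_dE L) ->; rewrite /depth minnC.
by rewrite addnC; exact: lr_Lam L.
Qed.

(** Met columns and met rows form intervals, whose product is the bounding rectangle required by
    [minimizer_rect]. *)
Lemma minimizer_is_rect M X1 X2 Y1 Y2 D D0 wh wv d k wmin wmax lam Lam a :
  large_rectangle M X1 X2 Y1 Y2 D D0 wh wv d k wmin wmax lam Lam ->
  in_box M a ->
  (forall b, in_box M b -> box_energy M wh wv k d (inrect X1 X2 Y1 Y2) a <=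
                           box_energy M wh wv k d (inrect X1 X2 Y1 Y2) b) ->
  exists x1 x2 y1 y2, [/\ (X1 <= x1 < X1 + D)%N, (x2 <= X2 < x2 + D)%N,
    (Y1 <= y1 < Y1 + D)%N, (y2 <= Y2 < y2 + D)%N & a = inrect x1 x2 y1 y2].
Proof.
move=> L aM amin; have L' := large_rectangle_tr L.
have aM' : in_box M (tr a) by move=> i j /aM; rewrite andbC.
have amin' b : in_box M b ->
    box_energy M (tr wv) (tr wh) k (tr d) (inrect Y1 Y2 X1 X2) (tr a) <=
    box_energy M (tr wv) (tr wh) k (tr d) (inrect Y1 Y2 X1 X2) b.
  move=> bM; rewrite -inrect_tr box_energy_tr -[b]/(tr (tr b)) box_energy_tr.
  by apply: amin => i j /bM; rewrite andbC.
have [x1 [x2 [x1X x2X xE]]] : exists x1 x2, [/\ (X1 <= x1 < X1 + D)%N, (x2 <= X2 < x2 + D)%N &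
    forall i, ~~ line_missed M a i = (x1 <= i < x2)%N].
  exact: (@columns_interval _ M X1 X2 Y1 Y2 D D0 wh wv d k wmin wmax lam Lam
    (lr_X1 L) (lr_X2 L) (lr_Y1 L) (lr_Y2 L) (lr_DX L) (lr_DY L) (lr_D0 L) (lr_D0D L) (lr_wmin_ge0 L) (lr_wmin_le1 L) (lr_wh_min L) (lr_wh_max L) (lr_wv_min L) (lr_wv_max L) (lr_d_ge1 L) (lr_dE L) (lr_k_gt L) (lr_lamX L) (lr_lamY L) (lr_Lam L) (lr_lamD0 L) (lr_lamD L) (lr_kD L) _ aM amin).
have [y1 [y2 [y1Y y2Y yE]]] : exists y1 y2, [/\ (Y1 <= y1 < Y1 + D)%N, (y2 <= Y2 < y2 + D)%N &
    forall j, ~~ line_missed M (tr a) j = (y1 <= j < y2)%N].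
  exact: (@columns_interval _ M Y1 Y2 X1 X2 D D0 (tr wv) (tr wh) (tr d) k wmin wmax lam Lam
    (lr_X1 L') (lr_X2 L') (lr_Y1 L') (lr_Y2 L') (lr_DX L') (lr_DY L') (lr_D0 L') (lr_D0D L') (lr_wmin_ge0 L') (lr_wmin_le1 L') (lr_wh_min L') (lr_wh_max L') (lr_wv_min L') (lr_wv_max L') (lr_d_ge1 L') (lr_dE L') (lr_k_gt L') (lr_lamX L') (lr_lamY L') (lr_Lam L') (lr_lamD0 L') (lr_lamD L') (lr_kD L') _ aM' amin').
exists x1, x2, y1, y2; split=> //; apply/funext => i; apply/funext => j.
have met b : in_box M b -> forall i, ~~ line_missed M b i -> exists j, b i j.
  move=> bM u /line_missedP-/(_ bM) h; apply: contrapT => hn; apply: h => v.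
  by apply/negbTE/negP => buv; apply: hn; exists v.
have aR u v : a u v -> inrect x1 x2 y1 y2 u v.
  move=> auv; rewrite /inrect -xE -yE; apply/andP; split; apply/line_missedP => //.
    by move/(_ v); rewrite auv.
  by move/(_ u); rewrite /tr auv.
case: L amin => X1g X2M Y1g Y2M DX DY D0g D0D wm0 wm1 whm whM wvm wvM d1 dE kg _ _ _ _ _ _ amin.
apply: (@minimizer_rect _ M X1 X2 Y1 Y2 wh wv d k wmin wmax) => //.
- by move: DX D0g D0D; clear; lia.
- by move: DY D0g D0D; clear; lia.
- by case/andP: x1X.
- by case/andP: x2X.
- by case/andP: y1Y.
- by case/andP: y2Y.
- by move=> u; rewrite -xE; exact: met.
- by move=> v; rewrite -yE; exact: (met (tr a)).
apply: amin => u v; move: x1X x2X y1Y y2Y X1g X2M Y1g Y2M; rewrite /inrect; clear; lia.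
Qed.

Section side.
Variables (M X1 X2 Y1 Y2 : nat) (wh wv d : nat -> nat -> R) (k : R).
Notation E x1 x2 y1 y2 := (box_energy M wh wv k d (inrect X1 X2 Y1 Y2) (inrect x1 x2 y1 y2)).
Hypotheses (X1_gt0 : (0 < X1)%N) (X2M : (X2 <= M)%N) (Y1_gt0 : (0 < Y1)%N) (Y2M : (Y2 <= M)%N).

(** The last bracket is the penalty: all cells of the old rectangle minus those that are kept. *)
Lemma rect_energy x1 x2 y1 y2 : (X1 <= x1)%N -> (x1 < x2)%N -> (x2 <= X2)%N ->
  (Y1 <= y1)%N -> (y1 < y2)%N -> (y2 <= Y2)%N ->
  E x1 x2 y1 y2 =
    \sum_(y1 <= j < y2) wh x1.-1 j + \sum_(y1 <= j < y2) wh x2.-1 j +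
    \sum_(x1 <= i < x2) (wv i y1.-1 + wv i y2.-1) +
    k * (\sum_(0 <= i < M) \sum_(0 <= j < M) d i j *+ inrect X1 X2 Y1 Y2 i j -
         \sum_(x1 <= i < x2) \sum_(y1 <= j < y2) d i j).
Proof.
move=> X1x x12 xX2 Y1y y12 yY2; rewrite /box_energy; congr (_ + _ + _ * _).
- rewrite -big_split/= -(@sum_nat_restrict _ (fun j => wh x1.-1 j + wh x2.-1 j) M y1 y2)//.
  - apply: eq_bigr => j _; have [jy|jy] := boolP (y1 <= j < y2)%N.
      rewrite mulr1n (@eq_variation _ _ (fun i => (x1 <= i < x2)%N)); last by move=> i _; rewrite /inrect jy andbT.
      by rewrite variation_interval// ?(leq_trans X1_gt0)// (leq_trans xX2).
    by rewrite mulr0n (variation_const false)// => i _; rewrite /inrect (negbTE jy) andbF.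
  - exact: ltnW.
  - exact: leq_trans Y2M.
- rewrite -(@sum_nat_restrict _ (fun i => wv i y1.-1 + wv i y2.-1) M x1 x2)//.
  - apply: eq_bigr => i _; have [ix|ix] := boolP (x1 <= i < x2)%N.
      rewrite mulr1n (@eq_variation _ _ (fun j => (y1 <= j < y2)%N)); last by move=> j _; rewrite /inrect ix.
      by rewrite variation_interval// ?(leq_trans Y1_gt0)// (leq_trans yY2).
    by rewrite mulr0n (variation_const false)// => j _; rewrite /inrect (negbTE ix).
  - exact: ltnW.
  - exact: leq_trans X2M.
- rewrite -(@sum_nat_restrict _ (fun i => \sum_(y1 <= j < y2) d i j) M x1 x2)//; [|exact: ltnW|exact: leq_trans X2M].
  rewrite -sumrB; apply: eq_bigr => i _.
  rewrite -(@sum_nat_restrict _ (d i) M)//; [|exact: ltnW|exact: leq_trans Y2M].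
  rewrite -sumrMnl -sumrB; apply: eq_bigr => j _.
  have iX : (x1 <= i < x2)%N -> (X1 <= i < X2)%N by move: X1x xX2; clear; lia.
  have jY : (y1 <= j < y2)%N -> (Y1 <= j < Y2)%N by move: Y1y yY2; clear; lia.
  rewrite /inrect; case: (x1 <= i < x2)%N iX => [/(_ isT)->|_]; case: (y1 <= j < y2)%N jY => [/(_ isT)->|_];
    by rewrite /= ?mulr0n ?mulr1n ?subr0 ?subrr//; case: (_ && _); rewrite ?mulr0n.
Qed.

(** Giving up column [x1] exchanges the edges on its left for those on its right, saves its two end
    edges and adds its penalty. *)
Lemma rect_energy_left x1 x2 y1 y2 : (X1 <= x1)%N -> (x1.+1 < x2)%N -> (x2 <= X2)%N ->
  (Y1 <= y1)%N -> (y1 < y2)%N -> (y2 <= Y2)%N ->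
  E x1.+1 x2 y1 y2 = E x1 x2 y1 y2 +
    (\sum_(y1 <= j < y2) wh x1 j - \sum_(y1 <= j < y2) wh x1.-1 j) -
    (wv x1 y1.-1 + wv x1 y2.-1) + k * \sum_(y1 <= j < y2) d x1 j.
Proof.
move=> X1x x12 xX2 Y1y y12 yY2.
rewrite !rect_energy// ?(ltnW x12)// ?(leqW X1x)//=.
rewrite !(@big_ltn _ _ _ x1 x2)/= ?(ltnW x12)//.
by lra.
Qed.

Lemma rect_energy_right x1 x2 y1 y2 : (X1 <= x1)%N -> (x1 < x2)%N -> (x2 < X2)%N ->
  (Y1 <= y1)%N -> (y1 < y2)%N -> (y2 <= Y2)%N ->
  E x1 x2 y1 y2 = E x1 x2.+1 y1 y2 -
    (\sum_(y1 <= j < y2) wh x2 j - \sum_(y1 <= j < y2) wh x2.-1 j) -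
    (wv x2 y1.-1 + wv x2 y2.-1) + k * \sum_(y1 <= j < y2) d x2 j.
Proof.
move=> X1x x12 xX2 Y1y y12 yY2.
rewrite !rect_energy// ?(ltnW xX2)// ?(leqW x12)//=.
rewrite !(@big_nat_recr _ _ _ x2 x1)/= ?(ltnW x12)//.
by lra.
Qed.

End side.

Section side_bounds.
Variables (M X1 X2 Y1 Y2 D D0 : nat) (wh wv d : nat -> nat -> R) (k wmin wmax lam Lam eta : R).
Notation E x1 x2 y1 y2 := (box_energy M wh wv k d (inrect X1 X2 Y1 Y2) (inrect x1 x2 y1 y2)).
Hypothesis L : large_rectangle M X1 X2 Y1 Y2 D D0 wh wv d k wmin wmax lam Lam.
Hypothesis wh_close : forall x x' y1 y2,
  (X1 <= x.+1)%N -> (x < X2)%N -> (X1 <= x'.+1)%N -> (x' < X2)%N ->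
  (Y1 <= y1)%N -> (y1 <= y2)%N -> (y2 <= Y2)%N ->
  \sum_(y1 <= j < y2) wh x j <= \sum_(y1 <= j < y2) wh x' j + eta.
Variables (x1 x2 y1 y2 : nat).
Hypotheses (x1X : (X1 <= x1 < X1 + D)%N) (x2X : (x2 <= X2 < x2 + D)%N)
  (y1Y : (Y1 <= y1 < Y1 + D)%N) (y2Y : (y2 <= Y2 < y2 + D)%N).
Hypothesis R_min : forall b, in_box M b ->
  E x1 x2 y1 y2 <= box_energy M wh wv k d (inrect X1 X2 Y1 Y2) b.

Let D_gt0 : (0 < D)%N. Proof. by case: L => *; exact: (@leq_trans D0). Qed.
Let k_ge0 : 0 <= k.
Proof.
case: L => _ _ _ _ _ _ _ _ _ _ wm wM _ _ _ _ kg _ _ _ _ _ _.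
by have := wm 0 0; have := wM 0 0; lra.
Qed.
Let R_in_box u1 u2 v1 v2 : (X1 <= u1)%N -> (u2 <= X2)%N -> (Y1 <= v1)%N -> (v2 <= Y2)%N ->
  in_box M (inrect u1 u2 v1 v2).
Proof.
move=> h1 h2 h3 h4 i j; have := lr_X1 L; have := lr_X2 L; have := lr_Y1 L; have := lr_Y2 L.
by move: h1 h2 h3 h4; rewrite /inrect; clear; lia.
Qed.
Let eta_ge0 : 0 <= eta.
Proof.
have X12 : (X1 < X2)%N by have := lr_DX L; move: D_gt0; clear; lia.
have := @wh_close X1 X1 Y1 Y1 (leqnSn _) X12 (leqnSn _) X12 (leqnn _) (leqnn _).
have -> : (Y1 <= Y2)%N by have := lr_DY L; move: D_gt0; clear; lia.
by move=> /(_ isT); rewrite !big_geq// add0r.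
Qed.

Let d_le (x n : nat) : (X1 <= x < X2)%N -> (depth1 X1 X2 x <= n)%N ->
  k * \sum_(y1 <= j < y2) d x j <= k * n%:R * (Y2 - Y1)%:R.
Proof.
move=> xX xn; rewrite -mulrA ler_wpM2l// -natrM.
apply: (@le_trans _ _ (\sum_(y1 <= j < y2) n%:R)).
  rewrite ler_sum_nat// => j jy; rewrite (lr_dE L); last first.
    by move: xX y1Y y2Y jy; rewrite /inrect; clear; lia.
  by rewrite ler_nat /depth; move: xn; clear; lia.
by rewrite -natr_sum ler_nat sum_nat_const_nat mulnC leq_mul2l; move: y1Y y2Y; clear; lia.
Qed.

(** Near the ends of the column the depth may drop below [n], so only the rows at distance at least
    [D] from them are counted; these all belong to the new rectangle. *)
Let d_ge (x n : nat) : (X1 <= x < X2)%N -> (n <= depth1 X1 X2 x)%N -> (n <= D)%N ->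
  k * n%:R * (Y2 - Y1 - 2 * D)%:R <= k * \sum_(y1 <= j < y2) d x j.
Proof.
move=> xX xn nD; rewrite -mulrA ler_wpM2l// -natrM.
have DY := lr_DY L.
rewrite (big_cat_nat (n := (Y1 + D)%N))/=; [|by move: y1Y; clear; lia|by move: D_gt0 DY y2Y; clear; lia].
rewrite (big_cat_nat (m := (Y1 + D)%N) (n := (Y2 - D)%N))/=; [|by move: D_gt0 DY; clear; lia|by move: y2Y; clear; lia].
have s0 u v : 0 <= \sum_(u <= j < v) d x j.
  by apply: sumr_ge0 => j _; exact: le_trans ler01 (lr_d_ge1 L x j).
apply: ler_wpDl => //; apply: ler_wpDr => //.
apply: (@le_trans _ _ (\sum_(Y1 + D <= j < Y2 - D) n%:R)).
  rewrite -natr_sum ler_nat sum_nat_const_nat mulnC leq_mul2r; apply/orP; right.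
  by clear; lia.
rewrite ler_sum_nat// => j jy; rewrite (lr_dE L); last first.
  by move: xX DY jy; rewrite /inrect; clear; lia.
rewrite ler_nat /depth leq_min xn /depth1; move: nD jy; clear; lia.
Qed.

(** Minimality is tested against the rectangle with one side moved by one cell: inwards for the
    lower bounds, where the column given up has depth at most [x1 - X1 + 1], and back outwards for
    the upper bounds, where the column regained has depth [x1 - X1]. [eta] pays for the exchange of
    parallel edges. *)
Lemma side_bounds :
  [/\ 2 * wmin - eta <= k * (x1 - X1).+1%:R * (Y2 - Y1)%:R,
      k * (x1 - X1)%:R * (Y2 - Y1 - 2 * D)%:R <= 2 * wmax + eta,
      2 * wmin - eta <= k * (X2 - x2).+1%:R * (Y2 - Y1)%:R &
      k * (X2 - x2)%:R * (Y2 - Y1 - 2 * D)%:R <= 2 * wmax + eta].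
Proof.
have [DX DY] := (lr_DX L, lr_DY L).
have [[[X1g X2M] Y1g] Y2M] := (lr_X1 L, lr_X2 L, lr_Y1 L, lr_Y2 L).
have [/andP[hx1 hx1D] /andP[hx2 hx2D]] := (x1X, x2X).
have [/andP[hy1 hy1D] /andP[hy2 hy2D]] := (y1Y, y2Y).
have y12 : (y1 < y2)%N by move: DY hy1 hy2 hy1D hy2D; clear; lia.
have x12 : (x1.+1 < x2)%N by move: D_gt0 DX hx1 hx2 hx1D hx2D; clear; lia.
have wmax0 : 0 <= wmax by have := lr_wmin_ge0 L; have := lr_wh_min L 0 0; have := lr_wh_max L 0 0; lra.
split.
- have := rect_energy_left wh wv d k X1g X2M Y1g Y2M hx1 x12 hx2 hy1 y12 hy2.
  have := R_min (@R_in_box x1.+1 x2 y1 y2 (leqW hx1) hx2 hy1 hy2).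
  have := @wh_close x1 x1.-1 y1 y2; rewrite !(leqW hx1)// hy1 hy2 (ltnW y12).
  have -> : (x1 < X2)%N by move: x12 hx2; clear; lia.
  have -> : (X1 <= x1.-1.+1)%N by move: hx1 X1g; clear; lia.
  have -> : (x1.-1 < X2)%N by move: x12 hx2; clear; lia.
  move=> /(_ isT isT isT isT isT isT isT).
  have := @d_le x1 (x1 - X1).+1; rewrite hx1.
  have -> : (x1 < X2)%N by move: x12 hx2; clear; lia.
  have -> : (depth1 X1 X2 x1 <= (x1 - X1).+1)%N by rewrite /depth1; clear; lia.
  move=> /(_ isT isT).
  by have := lr_wv_min L x1 y1.-1; have := lr_wv_min L x1 y2.-1; lra.
(* A side that has not moved cannot be moved back, but then the upper bound is trivial. *)
- have [->|x1ne] := eqVneq x1 X1; first by rewrite subnn mulr0 mul0r; move: eta_ge0; lra.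
  case: (posnP x1) => [E0|]; first by move: X1g hx1; rewrite E0; clear; lia.
  move=> x1g; have xE : x1 = x1.-1.+1 by rewrite prednK.
  have hx : (X1 <= x1.-1)%N by move: hx1 x1ne; clear; lia.
  have := rect_energy_left wh wv d k X1g X2M Y1g Y2M hx (x1 := x1.-1) (x2 := x2) (y1 := y1) (y2 := y2).
  rewrite -xE; move=> /(_ (ltnW x12) hx2 hy1 y12 hy2).
  have := R_min (@R_in_box x1.-1 x2 y1 y2 hx hx2 hy1 hy2).
  have := @wh_close x1.-1.-1 x1.-1 y1 y2; rewrite hy1 hy2 (ltnW y12).
  have -> : (X1 <= x1.-1.-1.+1)%N by move: hx X1g; clear; lia.
  have -> : (x1.-1.-1 < X2)%N by move: x12 hx2; clear; lia.
  have -> : (X1 <= x1.-1.+1)%N by move: hx1 X1g; clear; lia.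
  have -> : (x1.-1 < X2)%N by move: x12 hx2; clear; lia.
  move=> /(_ isT isT isT isT isT isT isT).
  have := @d_ge x1.-1 (x1 - X1); rewrite hx.
  have -> : (x1.-1 < X2)%N by move: x12 hx2; clear; lia.
  have -> : (x1 - X1 <= depth1 X1 X2 x1.-1)%N by rewrite /depth1; move: DX hx1 hx1D x1g; clear; lia.
  have -> : (x1 - X1 <= D)%N by move: hx1 hx1D; clear; lia.
  move=> /(_ isT isT isT).
  by have := lr_wv_max L x1.-1 y1.-1; have := lr_wv_max L x1.-1 y2.-1; lra.
- have xE : x2 = x2.-1.+1 by rewrite prednK//; move: x12; clear; lia.
  have h1 : (x1 < x2.-1)%N by move: x12; clear; lia.
  have h2 : (x2.-1 < X2)%N by move: x12 hx2; clear; lia.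
  have := rect_energy_right wh wv d k X1g X2M Y1g Y2M hx1 h1 h2 hy1 y12 hy2; rewrite -xE.
  have := R_min (@R_in_box x1 x2.-1 y1 y2 hx1 (ltnW h2) hy1 hy2).
  have := @wh_close x2.-1.-1 x2.-1 y1 y2; rewrite hy1 hy2 (ltnW y12) h2.
  have -> : (X1 <= x2.-1.-1.+1)%N by move: hx1 h1; clear; lia.
  have -> : (X1 <= x2.-1.+1)%N by move: hx1 h1; clear; lia.
  have -> : (x2.-1.-1 < X2)%N by move: h2; clear; lia.
  move=> /(_ isT isT isT isT isT isT isT).
  have := @d_le x2.-1 (X2 - x2).+1; rewrite h2.
  have -> : (X1 <= x2.-1)%N by move: hx1 h1; clear; lia.
  have -> : (depth1 X1 X2 x2.-1 <= (X2 - x2).+1)%N by rewrite /depth1; move: hx2; clear; lia.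
  move=> /(_ isT isT).
  by have := lr_wv_min L x2.-1 y1.-1; have := lr_wv_min L x2.-1 y2.-1; lra.
- have [->|x2ne] := eqVneq x2 X2; first by rewrite subnn mulr0 mul0r; move: eta_ge0; lra.
  have h2 : (x2 < X2)%N by move: hx2 x2ne; clear; lia.
  have := rect_energy_right wh wv d k X1g X2M Y1g Y2M hx1 (ltnW x12) h2 hy1 y12 hy2.
  have := R_min (@R_in_box x1 x2.+1 y1 y2 hx1 h2 hy1 hy2).
  have := @wh_close x2 x2.-1 y1 y2; rewrite hy1 hy2 (ltnW y12) h2.
  have -> : (X1 <= x2.+1)%N by move: hx1 x12; clear; lia.
  have -> : (X1 <= x2.-1.+1)%N by move: hx1 x12; clear; lia.
  have -> : (x2.-1 < X2)%N by move: h2; clear; lia.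
  move=> /(_ isT isT isT isT isT isT isT).
  have := @d_ge x2 (X2 - x2); rewrite h2.
  have -> : (X1 <= x2)%N by move: hx1 x12; clear; lia.
  have -> : (X2 - x2 <= depth1 X1 X2 x2)%N by rewrite /depth1; move: DX hx1 hx2D x12; clear; lia.
  have -> : (X2 - x2 <= D)%N by move: hx2D; clear; lia.
  move=> /(_ isT isT isT).
  by have := lr_wv_max L x2 y1.-1; have := lr_wv_max L x2 y2.-1; lra.
Qed.

End side_bounds.
End one_step.

(** * Fluctuations of the field along parallel lines *)

Section second_moment.
Context d (T : measurableType d) (R : realType) (P : probability T R).

Definition pr (A : set T) : R := fine (P A).

Lemma prE A : measurable A -> P A = (pr A)%:E.
Proof. by move=> mA; rewrite /pr fineK// fin_num_measure. Qed.

Lemma pr_ge0 A : 0 <= pr A. Proof. exact: fine_ge0. Qed.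

Lemma pr_le1 A : measurable A -> pr A <= 1.
Proof. by move=> mA; rewrite -lee_fin -prE// probability_le1. Qed.

Lemma pr_bigsetU_le (A : nat -> set T) n (M : R) : (forall i, measurable (A i)) ->
  (forall i, (i < n)%N -> pr (A i) <= M) -> pr (\big[setU/set0]_(i < n) A i) <= n%:R * M.
Proof.
move=> mA AM; have mU : measurable (\big[setU/set0]_(i < n) A i) by exact: bigsetU_measurable.
rewrite -lee_fin -prE//; apply: (le_trans (Boole_inequality P (fun i _ => mA i))).
rewrite (eq_bigr (fun i : 'I_n => (pr (A i))%:E)); last by move=> i _; exact: prE.
rewrite sumEFin lee_fin mulr_natl -[n in leRHS]card_ord -sumr_const.
by apply: ler_sum => i _; exact: AM.
Qed.

Section sums.
Variables (E : nat -> set T) (p : R).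
Hypotheses (mE : forall i, measurable (E i)) (pE : forall i, pr (E i) = p).
Let X i (w : T) : R := \1_(E i) w - p.

Let X_measurable i : measurable_fun setT (X i).
Proof. by apply: measurable_funD => //; exact: measurable_indic. Qed.

Let XX_decomp i j w : (X i w * X j w)%:E =
  ((\1_(E i `&` E j) w)%:E + (- p)%:E * (\1_(E i) w)%:E +
  ((- p)%:E * (\1_(E j) w)%:E + (p ^+ 2)%:E))%E.
Proof. by rewrite -!EFinM -!EFinD /X indicI/=; congr EFin; ring. Qed.

Let integrable_I A : measurable A -> P.-integrable setT (fun w => (\1_A w : R)%:E).
Proof. by move=> mA; apply: integrable_indic. Qed.

Let integrable_XX i j : P.-integrable setT (fun w => (X i w * X j w)%:E).
Proof.
rewrite (_ : (fun w => _) = ((fun w => (\1_(E i `&` E j) w)%:E) \+ (fun w => (- p)%:E * (\1_(E i) w)%:E)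
  \+ ((fun w => (- p)%:E * (\1_(E j) w)%:E) \+ cst (p ^+ 2)%:E))%E); last first.
  by apply/funext => w; exact: XX_decomp.
apply: integrableD => //; apply: integrableD => //.
- by apply: integrable_I; exact: measurableI.
- by apply: integrableZl => //; exact: integrable_I.
- by apply: integrableZl => //; exact: integrable_I.
- exact: finite_measure_integrable_cst.
Qed.

Lemma integral_XX i j : (\int[P]_w (X i w * X j w)%:E = (pr (E i `&` E j) - p ^+ 2)%:E)%E.
Proof.
rewrite (eq_integral (fun w => ((\1_(E i `&` E j) w)%:E + (- p)%:E * (\1_(E i) w)%:E +
  ((- p)%:E * (\1_(E j) w)%:E + (p ^+ 2)%:E))%E)); last by move=> w _; exact: XX_decomp.
have mI := measurableI _ _ (mE i) (mE j).
have i1 : P.-integrable setT (fun w => (\1_(E i `&` E j) w : R)%:E) by exact: integrable_I.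
have i2 k : P.-integrable setT (fun w => ((- p)%:E * (\1_(E k) w)%:E)%E).
  by apply: integrableZl => //; exact: integrable_I.
have i3 : P.-integrable setT (cst (p ^+ 2)%:E) by exact: finite_measure_integrable_cst.
have i4 : P.-integrable setT (fun w => ((\1_(E i `&` E j) w)%:E + (- p)%:E * (\1_(E i) w)%:E)%E) by exact: integrableD.
have i5 : P.-integrable setT (fun w => ((- p)%:E * (\1_(E j) w)%:E + (p ^+ 2)%:E)%E) by exact: integrableD.
rewrite integralD// integralD// integralD//.
rewrite !integralZl//; [|exact: integrable_I..].
have iE B : measurable B -> (\int[P]_x (\1_B x)%:E = (pr B)%:E)%E.
  by move=> mB; rewrite integral_indic// setIT; exact: prE.
have i6 : (\int[P]_x (p ^+ 2)%:E = (p ^+ 2)%:E)%E.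
  by rewrite integral_cst// -[RHS]mule1; congr (_ * _)%E; exact: probability_setT.
rewrite !iE// i6 !pE -!EFinM -!EFinD; congr EFin; ring.
Qed.

Variables (a : nat -> R) (A : R).
Hypothesis (aA : forall n, \sum_(1 <= k < n) a k <= A).
Hypothesis cov_le : forall i j, (i < j)%N -> pr (E i `&` E j) - p ^+ 2 <= a (j - i).

(** For fixed [i] the diagonal term is at most one, and the terms on either side of it are bounded
    by a partial sum of [a]. *)
Lemma sum_cov_le m :
  \sum_(0 <= i < m) \sum_(0 <= j < m) (pr (E i `&` E j) - p ^+ 2) <= m%:R * (1 + 2 * A).
Proof.
apply: (@le_trans _ _ (\sum_(0 <= i < m) (1 + 2 * A))); last first.
  by rewrite sumr_const_nat subn0 [leRHS]mulr_natl.
rewrite ler_sum_nat// => i /andP[_ im].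
rewrite (big_cat_nat (n := i))//=; last exact: ltnW.
rewrite (big_cat_nat (m := i) (n := i.+1))//= big_nat1.
have diag : pr (E i `&` E i) - p ^+ 2 <= 1.
  by rewrite setIid lerBlDr (le_trans (pr_le1 (mE i)))// lerDl sqr_ge0.
have left : \sum_(0 <= j < i) (pr (E i `&` E j) - p ^+ 2) <= A.
  apply: le_trans (aA i.+1); rewrite big_add1/= [leRHS]big_nat_rev/= add0n.
  by rewrite ler_sum_nat// => j /andP[_ ji]; rewrite setIC subnSK//; exact: cov_le.
have right : \sum_(i.+1 <= j < m) (pr (E i `&` E j) - p ^+ 2) <= A.
  apply: le_trans (aA (m - i)); rewrite -[i.+1]add1n big_addn.
  by rewrite ler_sum_nat// => j /andP[j0 _]; rewrite -[in a _](addnK i j); apply: cov_le; lia.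
lra.
Qed.

(** Chebyshev's inequality: summable correlations make the variance of a block sum at most linear in
    its length. *)
Lemma chebyshev_indic m (eta : R) : 0 < eta -> (0 < m)%N ->
  measurable [set w | eta * m%:R < `|\sum_(0 <= i < m) X i w|] /\
  pr [set w | eta * m%:R < `|\sum_(0 <= i < m) X i w|] * (eta ^+ 2 * m%:R) <= 1 + 2 * A.
Proof.
move=> eta0 m0; set B := [set w | _].
have mS : measurable_fun setT (fun w => \sum_(0 <= i < m) X i w).
  by apply: measurable_sum => i; exact: X_measurable.
have mB : measurable B.
  have : measurable_fun setT (fun w => `|\sum_(0 <= i < m) X i w|) by exact: measurableT_comp.
  move=> /(_ measurableT `]eta * m%:R, +oo[%classic (measurable_itv _)).
  rewrite setTI; congr measurable; apply/seteqP; split => w; rewrite /B/= in_itv/= ?andbT//.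
split=> //.
have m0' : 0 < m%:R :> R by rewrite ltr0n.
have : (((eta * m%:R) ^+ 2 * pr B)%:E <= (m%:R * (1 + 2 * A))%:E)%E.
  apply: (@le_trans _ _ (\int[P]_w (\sum_(0 <= i < m) \sum_(0 <= j < m) (X i w * X j w)%:E))%E).
    rewrite EFinM -prE// -[B in P B]setIT.
    rewrite (_ : P (B `&` setT) = \int[P]_w (\1_B w)%:E)%E; last by rewrite integral_indic.
    rewrite -integralZl//; last exact: integrable_I.
    apply: le_integral => //.
    - by apply: integrableZl => //; exact: integrable_I.
    - by apply: (integrable_sum measurableT) => i _; apply: (integrable_sum measurableT) => j _; exact: integrable_XX.
    move=> w _.
    have -> : (\sum_(0 <= i < m) \sum_(0 <= j < m) (X i w * X j w)%:E)%E = ((\sum_(0 <= i < m) X i w) ^+ 2)%:E.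
      rewrite expr2 mulr_suml -sumEFin; apply: eq_bigr => i _.
      by rewrite mulr_sumr -sumEFin.
    rewrite -EFinM lee_fin indicE; case: (boolP (w \in B)) => [/set_mem wB|_]; rewrite ?mulr1 ?mulr0 ?sqr_ge0//.
    rewrite -[leRHS]real_normK ?num_real// ler_pXn2r ?nnegrE ?mulr_ge0 ?(ltW eta0)//.
    exact: ltW.
  rewrite integral_sum//; last by move=> i; apply: (integrable_sum measurableT) => j _; exact: integrable_XX.
  apply: (@le_trans _ _ (\sum_(0 <= i < m) \sum_(0 <= j < m) (pr (E i `&` E j) - p ^+ 2))%:E); last by rewrite lee_fin sum_cov_le.
  rewrite -sumEFin le_eqVlt; apply/orP; left; apply/eqP; apply: eq_bigr => i _.
  rewrite integral_sum//.
  by rewrite -sumEFin; apply: eq_bigr => j _; exact: integral_XX.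
rewrite lee_fin => h; rewrite -(ler_pM2l m0'); apply: le_trans h.
by rewrite le_eqVlt; apply/orP; left; apply/eqP; ring.
Qed.

End sums.
End second_moment.

(** All bad indices lie in the range of two elements that starts at the least one. *)
Lemma sum_sparse_le2 (bad : nat -> bool) n :
  (forall b b', bad b -> bad b' -> (b' <= b.+1)%N) -> (\sum_(0 <= b < n) bad b <= 2)%N.
Proof.
move=> sparse; have [[b0 bb0]|nb] := pselect (exists b, bad b); last first.
  by rewrite big1// => b _; apply/eqP; rewrite eqb0; apply/negP => bb; apply: nb; exists b.
have ex : exists b, bad b by exists b0.
case: (ex_minnP ex) => b1 bb1 b1min.
apply: (@leq_trans (\sum_(0 <= b < n) (b1 <= b < b1 + 2)%N)); last by rewrite sum_interval; lia.
apply: leq_sum => b _; case bb: (bad b) => //.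
by have := b1min _ bb; have := sparse _ _ bb1 bb; lia.
Qed.

(** At most two blocks are atypical; these and the incomplete last block are estimated trivially,
    which gives [3 * m]. Two adjacent blocks may both be atypical, because mixing needs a gap
    between blocks. *)
Lemma prefix_sum_le (R : realFieldType) (g : nat -> R) (m n k : nat) (eta : R) :
  0 <= eta -> (0 < m)%N -> (forall t, `|g t| <= 1) -> (k <= n * m)%N ->
  (forall b b', (b.+1 < b')%N -> (b' < n)%N ->
    ~~ ((eta * m%:R < `|\sum_(0 <= i < m) g (b * m + i)%N|) &&
        (eta * m%:R < `|\sum_(0 <= i < m) g (b' * m + i)%N|))) ->
  `|\sum_(0 <= t < k) g t| <= eta * (n * m)%:R + (3 * m)%:R.
Proof.
move=> eta0 m0 g1 kn sparse.
have short s l : `|\sum_(s <= t < s + l) g t| <= l%:R.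
  apply: (le_trans (ler_norm_sum _ _ _)); rewrite -[leRHS]mulr1 mulr_natl.
  by rewrite -{2}(addKn s l) -sumr_const_nat; exact: ler_sum.
pose bad b := (b < n)%N && (eta * m%:R < `|\sum_(0 <= i < m) g (b * m + i)%N|).
have nbad : (\sum_(0 <= b < n) bad b <= 2)%N.
  apply: sum_sparse_le2 => b b' /andP[bn hb] /andP[bn' hb'].
  by rewrite leqNgt; apply/negP => bb'; have := sparse _ _ bb' bn'; rewrite hb hb'.
have blockE b : \sum_(0 <= i < m) g (b * m + i)%N = \sum_(b * m <= t < b * m + m) g t.
  by rewrite -{2}[(b * m)%N]add0n big_addn addKn; apply: eq_bigr => i _; rewrite addnC.
have block b : (b < n)%N -> `|\sum_(b * m <= t < b * m + m) g t| <= eta * m%:R + m%:R * (bad b)%:R.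
  move=> bn; rewrite /bad bn blockE/=.
  case: ltP => [_|h]; rewrite ?mulr0 ?addr0// mulr1.
  by apply: (le_trans (short _ _)); rewrite lerDr mulr_ge0.
have blocks q : (q <= n)%N -> `|\sum_(0 <= t < q * m) g t| <= \sum_(0 <= b < q) (eta * m%:R + m%:R * (bad b)%:R).
  elim: q => [_|q IH qn]; first by rewrite mul0n !big_geq// normr0.
  rewrite big_nat_recr//= mulSnr (big_cat_nat (n := (q * m)%N))//=; last exact: leq_addr.
  by apply: (le_trans (ler_normD _ _)); apply: lerD; [exact: IH (ltnW qn)|exact: block].
have kE := divn_eq k m; set q := (k %/ m)%N in kE; set l := (k %% m)%N in kE.
have lm : (l < m)%N by rewrite ltn_mod.
have qn : (q <= n)%N by rewrite /q -(mulnK n m0) leq_div2r.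
rewrite kE (big_cat_nat (n := (q * m)%N))//=; last exact: leq_addr.
apply: (le_trans (ler_normD _ _)).
have h1 := short (q * m)%N l; have h2 := blocks _ qn.
have h3 : \sum_(0 <= b < q) (eta * m%:R + m%:R * (bad b)%:R) <= eta * (n * m)%:R + (2 * m)%:R.
  rewrite big_split/= sumr_const_nat subn0 -mulr_sumr -natr_sum; apply: lerD.
    by rewrite -[leLHS]mulr_natr -mulrA -natrM ler_wpM2l// ler_nat mulnC leq_mul2r qn orbT.
  rewrite -natrM ler_nat mulnC leq_mul2r; apply/orP; right.
  by apply: leq_trans nbad; rewrite [leqRHS](big_cat_nat (n := q))//= leq_addr.
have h4 : l%:R <= m%:R :> R by rewrite ler_nat ltnW.
have -> : (3 * m)%:R = (2 * m)%:R + m%:R :> R by rewrite -natrD -mulSnr.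
lra.
Qed.

(** Counting the multiples of [h] below [u] recovers [u] up to [h]; this trades sums of the field
    for counts of threshold events. The minimum accounts for thresholds stopping before [J * h]. *)
Lemma layer_cake_bound (R : realFieldType) (h u : R) J : 0 < h -> 0 <= u ->
  Num.min u (J%:R * h) <= h * (\sum_(0 <= j < J) (j%:R * h < u)%R)%:R <= u + h.
Proof.
move=> h0 u0; elim: J => [|J /andP[IH1 IH2]].
  by rewrite big_geq// mul0r mulr0 ge_min lexx orbT/= addr_ge0// ltW.
rewrite big_nat_recr//= natrD mulrDr.
have Jle : (\sum_(0 <= j < J) (j%:R * h < u)%R <= J)%N.
  by rewrite -[leqRHS]subn0 -[leqRHS]muln1 -sum_nat_const_nat; apply: leq_sum => j _; exact: leq_b1.
have {}Jle : h * (\sum_(0 <= j < J) (j%:R * h < u)%R)%:R <= J%:R * h.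
  by rewrite mulrC ler_wpM2r ?ler_nat// ltW.
have JS : J.+1%:R * h = J%:R * h + h by rewrite -natr1 mulrDl mul1r.
have [Ju|Ju] := ltP (J%:R * h) u.
  move: IH1; rewrite (min_idPr (ltW Ju)) mulr1 JS => IH1; apply/andP; split; last by lra.
  by rewrite ge_min; apply/orP; right; lra.
move: IH1; rewrite (min_idPl Ju) mulr0 addr0 => IH1; rewrite IH2 andbT.
by rewrite ge_min IH1.
Qed.

Lemma bigsetU_mem (T : Type) (F : nat -> set T) n i w : (i < n)%N -> F i w ->
  (\big[setU/set0]_(j < n) F j) w.
Proof. by move=> ltin Fiw; rewrite -bigcup_mkord; exists i. Qed.

Lemma int_window (N : nat) (y : int) : `|y| <= N%:Z ->
  exists2 u : nat, (u <= 2 * N)%N & y = u%:Z - N%:Z.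
Proof. by move=> yN; exists (absz (y + N%:Z)); lia. Qed.

Lemma int_segment (N l : nat) (k : int) : - N%:Z <= k -> k + l%:Z <= N%:Z ->
  exists2 t : nat, (t + l <= 2 * N)%N & k = t%:Z - N%:Z.
Proof. by move=> kN kl; exists (absz (k + N%:Z)); lia. Qed.

(** * Atypical blocks of the random field on parallel lines *)

Section random_field_facts.
Context d (T : measurableType d) (R : realType) (P : probability T R).
Variables (c : R * R -> {RV P >-> R}) (alpha : nat -> R).

Lemma field_preimage_measurable xi (B : set R) : measurable B -> measurable (c xi @^-1` B).
Proof. by move=> mB; rewrite -[X in measurable X]setTI; exact: measurable_funP. Qed.

Lemma field_sigma_measurable I U : field_sigma c I U -> measurable U.
Proof.
apply: smallest_sub; first exact: sigma_algebra_measurable.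
by move=> _ [xi _ [B mB ->]]; exact: field_preimage_measurable.
Qed.

Lemma field_sigma_preimage I xi (B : set R) : measurable B -> I xi ->
  field_sigma c I (c xi @^-1` B).
Proof. by move=> mB Ixi; apply: sub_sigma_algebra; exists xi => //; exists B. Qed.

(* The group action need not be by bijections, but [tau z] has full range. *)
Lemma stationary_pr xi z (B : set R) : stationary c -> dual_lattice xi -> measurable B ->
  pr P (c (xi + zpt z) @^-1` B) = pr P (c xi @^-1` B).
Proof.
move=> [tau [_ _ Ptau] st] dxi mB.
set E := c xi @^-1` B; set E' := c (xi + zpt z) @^-1` B.
have mE : measurable E by exact: field_preimage_measurable.
have mE' : measurable E' by exact: field_preimage_measurable.
have [mimE' PE'] := Ptau z _ mE'.
have [mrng Prng] := Ptau z setT measurableT.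
have imE : tau z @` E' = E `&` (tau z @` setT).
  apply/seteqP; split => [w [v E'v <-]|w [Ew [v _ vw]]].
    by split; [rewrite /E/= st|exists v].
  by exists v => //; rewrite /E'/= -st// vw.
apply/eqP; rewrite eq_le; apply/andP; split; rewrite -lee_fin -!prE//.
  by rewrite -PE' imE le_measure ?inE//; exact: measurableI.
rewrite -[leRHS]PE' imE.
apply: (@le_trans _ _ (P (E `&` (tau z @` setT)) + P (~` (tau z @` setT)))%E); last first.
  have -> : P (~` (tau z @` setT)) = 0%E.
    by rewrite probability_setC// Prng probability_setT subee.
  by rewrite adde0.
rewrite -measureU//; last by rewrite -setIA setICr setI0.
- apply: le_measure; rewrite ?inE//.
    by apply: measurableU; [exact: measurableI|exact: measurableC].
  by move=> w Ew; have [h|h] := pselect ((tau z @` setT) w); [left|right].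
- exact: measurableI.
- exact: measurableC.
Qed.

Lemma mixing_pr I1 I2 n U V : alpha_mixing c alpha ->
  I1 `<=` dual_lattice -> I2 `<=` dual_lattice ->
  (forall x y, I1 x -> I2 y -> n%:R <= dist2 x y) ->
  field_sigma c I1 U -> field_sigma c I2 V ->
  `|pr P (U `&` V) - pr P U * pr P V| <= alpha n.
Proof.
move=> [_ mix] I1d I2d I12 sU sV.
have mU := field_sigma_measurable sU; have mV := field_sigma_measurable sV.
have I12' : (n%:R%:E <= set_dist I1 I2)%E.
  by apply: le_ereal_inf_tmp => _ [x I1x [y I2y <-]]; rewrite lee_fin I12.
rewrite -lee_fin; apply: le_trans (mix n I1 I2 I1d I2d I12').
apply: ereal_sup_ubound; exists U => //; exists V => //.
by rewrite !prE//; exact: measurableI.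
Qed.

Lemma alpha_ge0 n : alpha_mixing c alpha -> 0 <= alpha n.
Proof.
move=> mix; apply: le_trans (normr_ge0 _) (@mixing_pr set0 set0 n set0 set0 mix _ _ _ _ _) => //.
- by apply: sigma_algebra0; exact: smallest_sigma_algebra.
- by apply: sigma_algebra0; exact: smallest_sigma_algebra.
Qed.

Section line.
(** [e x y] is edge number [y] on line number [x] of a family of parallel lines; the two
    orientations of edges are two instances. *)
Variable e : int -> int -> R * R.
Hypotheses (e_dual : forall x y, dual_lattice (e x y))
  (e_dist : forall x y y', dist2 (e x y) (e x y') = (`|y - y'|%N)%:R)
  (e_shift : forall x y, exists z, e x y = e 0 0 + zpt z).
Hypotheses (c_stat : stationary c) (c_mix : alpha_mixing c alpha).
Variable A : R.
Hypothesis alpha_sum : forall n, \sum_(1 <= k < n) alpha k <= A.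

Section event.
Variables (B : set R) (eta : R) (L : nat).
Hypotheses (mB : measurable B) (eta_gt0 : 0 < eta) (L_gt0 : (0 < L)%N).
Let p := pr P (c (e 0 0) @^-1` B).

(** The shift by [L * m] centres the window of natural indices at the origin. *)
Let Ev (m u t : nat) := c (e (u%:Z - (L * m)%:Z) (t%:Z - (L * m)%:Z)) @^-1` B.

Let mEv m u t : measurable (Ev m u t).
Proof. exact: field_preimage_measurable. Qed.

Let pEv m u t : pr P (Ev m u t) = p.
Proof.
by rewrite /Ev; have [z ->] := e_shift (u%:Z - (L * m)%:Z) (t%:Z - (L * m)%:Z); exact: stationary_pr.
Qed.

Let Bad (m u b : nat) := [set w | eta * m%:R < `|\sum_(0 <= i < m) (\1_(Ev m u (b * m + i)%N) w - p)|].

Let C := (1 + 2 * A) / eta ^+ 2.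

Let A_ge0 : 0 <= A. Proof. by have := alpha_sum 1; rewrite big_geq. Qed.
Let C_ge0 : 0 <= C. Proof. by rewrite divr_ge0 ?sqr_ge0// addr_ge0// mulr_ge0. Qed.

Let Bad_pr m u b : (0 < m)%N -> measurable (Bad m u b) /\ pr P (Bad m u b) <= C / m%:R.
Proof.
move=> m0; have m0' : 0 < m%:R :> R by rewrite ltr0n.
have [] := @chebyshev_indic _ T R P (fun i => Ev m u (b * m + i)%N) p (fun i => mEv _ _ _)
  (fun i => pEv _ _ _) alpha A alpha_sum _ m eta eta_gt0 m0.
  move=> i j ij.
  have := @mixing_pr [set e (u%:Z - (L * m)%:Z) ((b * m + i)%N%:Z - (L * m)%:Z)]
    [set e (u%:Z - (L * m)%:Z) ((b * m + j)%N%:Z - (L * m)%:Z)] (j - i)%N (Ev m u (b * m + i)%N) (Ev m u (b * m + j)%N) c_mix.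
  rewrite !pEv -expr2 => h; apply: (le_trans (ler_norm _)); apply: h.
  - by move=> _ ->.
  - by move=> _ ->.
  - by move=> _ _ -> ->; rewrite e_dist ler_nat; lia.
  - exact: field_sigma_preimage.
  - exact: field_sigma_preimage.
move=> mBad h; split=> //; rewrite /C.
have e2 : 0 < eta ^+ 2 by rewrite exprn_gt0.
by rewrite ler_pdivlMr// ler_pdivlMr// mulrAC -mulrA.
Qed.

(** Mixing concerns events of the sigma-algebra generated by the block, so measurability in the
    whole space is not enough. *)
Let Bad_sigma m u b : field_sigma c [set e (u%:Z - (L * m)%:Z) ((b * m + i)%N%:Z - (L * m)%:Z) | i in [set i | (i < m)%N]] (Bad m u b).
Proof.
set I := image _ _.
pose G := [set E | exists2 xi, I xi & exists2 B : set R, measurable B & E = c xi @^-1` B].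
have mS : measurable_fun setT ((fun w => \sum_(i < m) (\1_(Ev m u (b * m + i)%N) w - p)) : g_sigma_algebraType G -> R).
  apply: measurable_sum => i; apply: measurable_funB => //.
  apply: measurable_indic; apply: sub_sigma_algebra.
  exists (e (u%:Z - (L * m)%:Z) ((b * m + i)%N%:Z - (L * m)%:Z)); last by exists B.
  by exists (i : nat) => //=; exact: ltn_ord.
have : measurable_fun setT ((fun w => `|\sum_(i < m) (\1_(Ev m u (b * m + i)%N) w - p)|) : g_sigma_algebraType G -> R).
  exact: measurableT_comp.
move=> /(_ measurableT `]eta * m%:R, +oo[%classic (measurable_itv _)).
rewrite setTI /field_sigma -/G; congr (<<s G >> _).
by apply/seteqP; split => w; rewrite /Bad/= in_itv/= ?andbT big_mkord.
Qed.

(** With a whole block between them the two blocks are more than [m] apart, so [alpha q] is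
    available for every [q <= m]; [D_pr] averages over this choice. *)
Let Bad_pair m u b b' q : (0 < m)%N -> (q <= m)%N -> (b.+1 < b')%N ->
  pr P (Bad m u b `&` Bad m u b') <= (C / m%:R) ^+ 2 + alpha q.
Proof.
move=> m0 qm bb'.
have [mb pb] := @Bad_pr _ u b m0; have [mb' pb'] := @Bad_pr _ u b' m0.
have := @mixing_pr _ _ q _ _ c_mix _ _ _ (@Bad_sigma m u b) (@Bad_sigma m u b').
move=> H; have {}H : `|pr P (Bad m u b `&` Bad m u b') - pr P (Bad m u b) * pr P (Bad m u b')| <= alpha q.
  apply: H; [by move=> _ [i _ <-]|by move=> _ [i _ <-]|].
  move=> _ _ [i/= im <-] [j/= jm <-]; rewrite e_dist ler_nat.
  by have : (b.+2 * m <= b' * m)%N by [rewrite leq_mul2r bb' orbT]; rewrite !mulSn; lia.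
move: H => /ler_normlW; rewrite lerBlDr addrC => h; apply: (le_trans h).
by rewrite lerD2r expr2 ler_pM// ?pr_ge0.
Qed.

(** Failure at scale [r]: some line of the window carries two non-adjacent atypical blocks. *)
Let D (r : nat) := let m := (2 ^ r.+1)%N in
  \big[setU/set0]_(u < (2 * L * m).+1) \big[setU/set0]_(b < 2 * L) \big[setU/set0]_(b' < 2 * L)
    (if (b.+1 < b')%N then Bad m u b `&` Bad m u b' else set0).

Let mD r : measurable (D r).
Proof.
have m0 : (0 < 2 ^ r.+1)%N by rewrite expn_gt0.
have mBad u b : measurable (Bad (2 ^ r.+1) u b) by have [] := @Bad_pr _ u b m0.
do 3! apply: bigsetU_measurable => ? _.
by case: ifP => // _; exact: measurableI.
Qed.

Let D_pr_q r q : (q <= 2 ^ r.+1)%N ->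
  pr P (D r) <= 12 * L%:R ^+ 3 * (C ^+ 2 / (2 ^ r.+1)%:R + (2 ^ r.+1)%:R * alpha q).
Proof.
set m := (2 ^ r.+1)%N => qm.
have m0 : (0 < m)%N by rewrite expn_gt0.
have mBad u b : measurable (Bad m u b) by have [] := @Bad_pr _ u b m0.
have mIf (u b b' : nat) : measurable (if (b.+1 < b')%N then Bad m u b `&` Bad m u b' else set0).
  by case: ifP => // _; exact: measurableI.
pose M := (C / m%:R) ^+ 2 + alpha q.
have M0 : 0 <= M by rewrite addr_ge0 ?sqr_ge0// alpha_ge0.
have : pr P (D r) <= (2 * L * m).+1%:R * ((2 * L)%:R * ((2 * L)%:R * M)).
  pose U3 u b b' : set T := if (b.+1 < b')%N then Bad m u b `&` Bad m u b' else set0.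
  pose U2 u b := \big[setU/set0]_(b' < 2 * L) U3 u b b'.
  pose U1 u := \big[setU/set0]_(b < 2 * L) U2 u b.
  have mU2 u b : measurable (U2 u b) by apply: bigsetU_measurable => i _; exact: mIf.
  have mU1 u : measurable (U1 u) by exact: bigsetU_measurable.
  apply: (@pr_bigsetU_le _ _ _ P U1) => // u _.
  apply: (@pr_bigsetU_le _ _ _ P (U2 u)) => // b _.
  apply: (@pr_bigsetU_le _ _ _ P (U3 u b)) => [b'|b' _]; first exact: mIf.
  by rewrite /U3; case: ifP => [bb'|_]; [exact: Bad_pair|rewrite /pr measure0].
move/le_trans; apply.
have m0' : 0 < m%:R :> R by rewrite ltr0n.
have -> : C ^+ 2 / m%:R + m%:R * alpha q = m%:R * M.
  by rewrite /M; field; rewrite gt_eqF.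
(* The number of lines is linear in [m]; with the bound [(2 * L) ^ 2] on the pairs of blocks this
   gives the factor [12 * L ^ 3]. *)
have h : (2 * L * m).+1%:R <= 3 * L%:R * m%:R :> R.
  by rewrite -[3]/(3%:R) -!natrM ler_nat; nia.
have -> : 12 * L%:R ^+ 3 * (m%:R * M) = (3 * L%:R * m%:R) * ((2 * L)%:R * ((2 * L)%:R * M)).
  by rewrite !natrM; ring.
by rewrite ler_wpM2r// !mulr_ge0.
Qed.

(* [alpha q] multiplied by [2 ^ r] need not be summable over [r]; its average over a
   dyadic block of [q] is. *)
Let D_pr r : pr P (D r) <=
  12 * L%:R ^+ 3 * (C ^+ 2 / (2 ^ r.+1)%:R + 2 * \sum_(2 ^ r <= q < 2 ^ r.+1) alpha q).
Proof.
have r0 : 0 < (2 ^ r)%:R :> R by rewrite ltr0n expn_gt0.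
rewrite -(ler_pM2l r0).
have E2 : (2 ^ r.+1 - 2 ^ r = 2 ^ r)%N by rewrite expnS mul2n -addnn addnK.
have -> : (2 ^ r)%:R * pr P (D r) = \sum_(2 ^ r <= q < 2 ^ r.+1) pr P (D r).
  by rewrite sumr_const_nat E2 mulr_natl.
apply: (@le_trans _ _ (\sum_(2 ^ r <= q < 2 ^ r.+1) 12 * L%:R ^+ 3 * (C ^+ 2 / (2 ^ r.+1)%:R + (2 ^ r.+1)%:R * alpha q))).
  by rewrite ler_sum_nat// => q /andP[_ qr]; apply: D_pr_q; exact: ltnW.
rewrite -mulr_sumr big_split/= sumr_const_nat E2 -mulr_sumr -[_ *+ 2 ^ r]mulr_natl.
rewrite le_eqVlt; apply/orP; left; apply/eqP.
set S := \sum_(_ <= _ < _) _.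
have -> : (2 ^ r.+1)%:R = 2 * (2 ^ r)%:R :> R by rewrite expnS natrM.
by ring.
Qed.

(** The dyadic ranges of [q] are disjoint, so their sums of [alpha] add up to at most [A]; the other
    term is geometric. *)
Let D_sum n : \sum_(0 <= r < n) pr P (D r) <= 12 * L%:R ^+ 3 * (C ^+ 2 + 2 * A).
Proof.
apply: (@le_trans _ _ (\sum_(0 <= r < n) 12 * L%:R ^+ 3 * (C ^+ 2 / (2 ^ r.+1)%:R + 2 * \sum_(2 ^ r <= q < 2 ^ r.+1) alpha q))).
  by apply: ler_sum => r _; exact: D_pr.
rewrite -mulr_sumr ler_wpM2l ?mulr_ge0 ?exprn_ge0// big_split/=; apply: lerD.
  rewrite -mulr_sumr ler_piMr ?sqr_ge0//.
  suff -> : \sum_(0 <= r < n) ((2 ^ r.+1)%:R)^-1 = 1 - ((2 ^ n)%:R)^-1 :> R.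
    by rewrite gerBl invr_ge0.
  elim: n => [|n IH]; first by rewrite big_geq// expn0 invr1 subrr.
  rewrite big_nat_recr//= IH expnS natrM.
  have : (2 ^ n)%:R != 0 :> R by rewrite pnatr_eq0 -lt0n expn_gt0.
  by move=> h; field.
rewrite -mulr_sumr ler_wpM2l//; apply: le_trans (alpha_sum (2 ^ n)).
rewrite le_eqVlt; apply/orP; left; apply/eqP.
elim: n => [|n IH]; first by rewrite !big_geq.
rewrite big_nat_recr//= IH -big_cat_nat//; first by rewrite expn_gt0.
by rewrite leq_exp2l.
Qed.

(** Borel-Cantelli over the dyadic scales; at a scale without failure [prefix_sum_le] applies to all
    lines of the window at once. *)
Lemma indicator_prefix_ae : {ae P, forall w, exists r0, forall r, (r0 <= r)%N ->
  forall u k : nat, let m := (2 ^ r.+1)%N in (u <= 2 * L * m)%N -> (k <= 2 * L * m)%N ->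
  `|\sum_(0 <= t < k) (\1_(c (e (u%:Z - (L * m)%:Z) (t%:Z - (L * m)%:Z)) @^-1` B) w - p)| <=
  eta * (2 * L * m)%:R + (3 * m)%:R}.
Proof.
have null : P (lim_sup_set D) = 0%E.
  apply: lim_sup_set_cvg0 => //.
  apply: (@le_lt_trans _ _ (12 * L%:R ^+ 3 * (C ^+ 2 + 2 * A))%:E); last exact: ltry.
  apply: lime_le; first exact: is_cvg_nneseries.
  apply: nearW => n.
  rewrite (eq_bigr (fun r => (pr P (D r))%:E)); last by move=> r _; exact: prE.
  by rewrite sumEFin lee_fin D_sum.
exists (lim_sup_set D); split => //.
  by apply: bigcap_measurable => // n _; apply: bigcup_measurable => k _.
move=> w /=; apply: contra_notP => nlim.
have [r0 hr0] : exists r0, forall r, (r0 <= r)%N -> ~ D r w.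
  apply: contrapT => hn; apply: nlim => n _; apply: contrapT => hn'.
  by apply: hn; exists n => r nr Dr; apply: hn'; exists r.
exists r0 => r /hr0 nD u k uL kL; set m := (2 ^ r.+1)%N in uL kL *.
have m0 : (0 < m)%N by rewrite expn_gt0.
have p01 : 0 <= p <= 1 by rewrite pr_ge0 pr_le1//; exact: field_preimage_measurable.
apply: (@prefix_sum_le R (fun t => \1_(Ev m u t) w - p) m (2 * L) k eta (ltW eta_gt0) m0) => //.
  move=> t; rewrite indicE; case: (_ \in _) => /=; rewrite ?sub0r ?normrN ger0_norm; case/andP: p01 => //; lra.
move=> b b' bb' b'L; apply/negP => /andP[hb hb']; apply: nD.
pose U3 u b b' : set T := if (b.+1 < b')%N then Bad m u b `&` Bad m u b' else set0.
pose U2 u b := \big[setU/set0]_(b' < 2 * L) U3 u b b'.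
pose U1 u := \big[setU/set0]_(b < 2 * L) U2 u b.
have bL : (b < 2 * L)%N by rewrite (ltn_trans _ b'L)// (ltn_trans _ bb').
apply: (@bigsetU_mem _ U1 (2 * L * m).+1 u w) => //.
apply: (@bigsetU_mem _ (U2 u) (2 * L) b w) => //.
by apply: (@bigsetU_mem _ (U3 u b) (2 * L) b' w) => //; rewrite /U3 bb'.
Qed.

End event.

(** Blocks are controlled at dyadic lengths only; this places an arbitrary large real scale between
    two consecutive ones. *)
Lemma dyadic_scale (K : nat) (r0 : nat) (n : R) : (0 < K)%N -> (K * 2 ^ r0.+1)%:R <= n ->
  exists2 r, (r0 <= r)%N & (K * 2 ^ r.+1)%:R <= n < (2 * (K * 2 ^ r.+1))%:R.
Proof.
move=> K0 Kn.
have n0 : 0 <= n by apply: le_trans Kn.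
pose Q r := n < (2 * (K * 2 ^ r.+1))%:R.
have ex : exists r, Q r.
  exists (Num.bound n); rewrite /Q.
  apply: (lt_le_trans (archi_boundP n0)); rewrite ler_nat.
  apply: (leq_trans (ltnW (ltn_expl (Num.bound n) (isT : 1 < 2)%N))).
  by rewrite expnS mulnCA !mulnA leq_pmull// !muln_gt0 K0.
have ex' : exists r, Q r && (r0 <= r)%N.
  have [r Qr] := ex; exists (maxn r r0); rewrite leq_maxr andbT.
  apply: lt_le_trans Qr _; rewrite ler_nat !leq_mul2l; apply/orP; right; apply/orP; right.
  by rewrite leq_exp2l// ltnS leq_maxl.
case: (ex_minnP ex') => r /andP[Qr r0r] rmin; exists r => //; apply/andP; split; last exact: Qr.
have [->//|rr0] := eqVneq r r0.
rewrite leNgt; apply/negP => h.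
case: r Qr r0r rmin rr0 h => [|r]; first by rewrite leqn0 => _ /eqP -> _ /eqP.
move=> Qr r0r rmin rr0 h; have := rmin r; rewrite ltnn; move/implyP.
rewrite /Q [(2 * (K * _))%N]mulnCA -expnS h/=.
by move: r0r; rewrite leq_eqVlt eq_sym (negbTE rr0)/= ltnS => ->.
Qed.

(** By stationarity each threshold event has the same probability on all lines, so its counts on two
    lines agree up to a small multiple of [n]; summing over the thresholds recovers the sums of the
    field. *)
Lemma parallel_lines_ae (M0 theta : R) (Lam : nat) : 0 < M0 -> 0 < theta -> (0 < Lam)%N ->
  {ae P, forall w, (forall xi, dual_lattice xi -> `|c xi w| <= M0) ->
    exists n0 : R, forall n : R, n0 <= n -> forall (x x' k0 : int) (l : nat),
    `|x|%:~R <= Lam%:R * n -> `|x'|%:~R <= Lam%:R * n ->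
    - (Lam%:R * n) <= k0%:~R -> (k0 + l%:Z)%:~R <= Lam%:R * n ->
    \sum_(0 <= i < l) c (e x (k0 + i%:Z)) w <= \sum_(0 <= i < l) c (e x' (k0 + i%:Z)) w + theta * n}.
Proof.
move=> M00 theta0 Lam0.
have Lam0' : 0 < Lam%:R :> R by rewrite ltr0n.
(* Three errors get [theta * n / 3] each: [J] makes the mesh [h] of thresholds fine, [K] makes the
   trivially estimated blocks short compared with [n], and [eta] bounds the deviation on typical
   blocks. [L] gives [Lam * n <= L * m] as soon as [n < 2 * K * m]. *)
pose J := (Num.bound (12 * Lam%:R * M0 / theta)).+1.
pose K := (Num.bound (72 * M0 / theta)).+1.
pose eta := theta / (96 * M0 * Lam%:R).
have eta0 : 0 < eta by rewrite divr_gt0// !mulr_gt0.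
pose h := 2 * M0 / J%:R.
have J0 : 0 < J%:R :> R by rewrite ltr0n.
have h0 : 0 < h by rewrite divr_gt0// mulr_gt0.
have JP : 12 * Lam%:R * M0 <= theta * J%:R.
  rewrite -ler_pdivrMl// mulrC (le_trans (ltW (archi_boundP _)))// ?ler_nat//.
  by rewrite !mulr_ge0// ?invr_ge0 ltW.
have KP : 72 * M0 <= theta * K%:R.
  rewrite -ler_pdivrMl// mulrC (le_trans (ltW (archi_boundP _)))// ?ler_nat//.
  by rewrite !mulr_ge0// ?invr_ge0 ltW.
pose L := (2 * Lam * K)%N.
have L0 : (0 < L)%N by rewrite !muln_gt0 Lam0.
pose B (j : nat) : set R := [set v | j%:R * h < v + M0].
have mB j : measurable (B j).
  rewrite (_ : B j = `]j%:R * h - M0, +oo[%classic); first exact: measurable_itv.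
  by apply/seteqP; split => v; rewrite /B/= in_itv/= andbT ltrBlDr.
have aeB : {ae P, forall w, forall j, exists r0, forall r, (r0 <= r)%N ->
  forall u k : nat, let m := (2 ^ r.+1)%N in (u <= 2 * L * m)%N -> (k <= 2 * L * m)%N ->
  `|\sum_(0 <= t < k) (\1_(c (e (u%:Z - (L * m)%:Z) (t%:Z - (L * m)%:Z)) @^-1` B j) w - pr P (c (e 0 0) @^-1` B j))| <=
  eta * (2 * L * m)%:R + (3 * m)%:R}.
  by apply: ae_foralln => j; exact: indicator_prefix_ae.
apply: filterS aeB => w /choice[r_ r_P] cM.
(* Only finitely many thresholds occur, so one starting scale serves them all. *)
pose r0 := \max_(j < J) r_ j.
exists (K * 2 ^ r0.+1)%:R => n nK x x' k0 l xn x'n k0n kln.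
have [r r0r /andP[rn nr]] := @dyadic_scale K r0 n isT nK.
set m := (2 ^ r.+1)%N in rn nr.
have m0 : (0 < m)%N by rewrite expn_gt0.
have Ln : Lam%:R * n <= (L * m)%:R.
  have -> : (L * m)%:R = Lam%:R * (2 * (K * m))%:R :> R by rewrite -natrM; congr (_%:R); rewrite /L -!mulnA mulnCA.
  by rewrite ler_wpM2l// ltW.
have key (y : int) : `|y|%:~R <= Lam%:R * n -> exists2 u : nat, (u <= 2 * L * m)%N & y = u%:Z - (L * m)%:Z.
  move=> /le_trans/(_ Ln); rewrite -[_%:R]/((L * m)%:Z%:~R) ler_int => /int_window[u uL ->].
  by exists u => //; rewrite -mulnA.
have [u uL xE] := key _ xn; have [u' u'L x'E] := key _ x'n.
have k0L : - (L * m)%:Z <= k0.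
  by rewrite -(@ler_int R) intrN (le_trans _ k0n)// lerN2.
have klL : k0 + l%:Z <= (L * m)%:Z.
  by rewrite -(@ler_int R) (le_trans kln).
have [t0 t0l k0E] : exists2 t : nat, (t + l <= 2 * L * m)%N & k0 = t%:Z - (L * m)%:Z.
  by rewrite -mulnA; exact: int_segment.
pose N j v : nat := (\sum_(0 <= i < l) (j%:R * h < c (e v (k0 + i%:Z)) w + M0)%R)%N.
(* A segment is the difference of two prefixes, whence the factor two. *)
have prefix j (v : nat) : (j < J)%N -> (v <= 2 * L * m)%N ->
    `|(N j (v%:Z - (L * m)%:Z))%:R - l%:R * pr P (c (e 0 0) @^-1` B j)| <=
    2 * (eta * (2 * L * m)%:R + (3 * m)%:R).
  move=> jJ vL.
  have rj : (r_ j <= r)%N by apply: leq_trans r0r; exact: (@leq_bigmax _ (fun j : 'I_J => r_ j) (Ordinal jJ)).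
  have p1 := r_P j r rj v t0 vL (leq_trans (leq_addr _ _) t0l).
  have p2 := r_P j r rj v (t0 + l)%N vL t0l.
  rewrite -/m in p1 p2.
  have -> : (N j (v%:Z - (L * m)%:Z))%:R - l%:R * pr P (c (e 0 0) @^-1` B j) =
    \sum_(t0 <= t < t0 + l) (\1_(c (e (v%:Z - (L * m)%:Z) (t%:Z - (L * m)%:Z)) @^-1` B j) w - pr P (c (e 0 0) @^-1` B j)).
    rewrite -{1}[t0]add0n big_addn addKn sumrB sumr_const_nat subn0 mulr_natl; congr (_ - _).
    rewrite /N natr_sum; apply: eq_bigr => i _; rewrite indicE.
    have -> : (i + t0)%N%:Z - (L * m)%:Z = k0 + i%:Z by rewrite k0E PoszD -addrA addrC.
    by congr ((nat_of_bool _)%:R); apply/idP/idP => [hB|/set_mem//]; apply/mem_set.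
  move: p2; rewrite (big_cat_nat (n := t0))//= ?leq_addr// => p2.
  by move: p1 p2; rewrite !ler_norml; lra.
have cake v i : dual_lattice (e v (k0 + i%:Z)) ->
    c (e v (k0 + i%:Z)) w + M0 <= h * (\sum_(0 <= j < J) (j%:R * h < c (e v (k0 + i%:Z)) w + M0)%R)%:R <=
    c (e v (k0 + i%:Z)) w + M0 + h.
  move=> dual; have := cM _ dual; rewrite ler_norml => /andP[c1 c2].
  have u0 : 0 <= c (e v (k0 + i%:Z)) w + M0 by lra.
  have := @layer_cake_bound R h _ J h0 u0; rewrite (min_idPl _)//.
  by rewrite /h mulrC divfK ?gt_eqF//; lra.
have lines v : \sum_(0 <= i < l) c (e v (k0 + i%:Z)) w + l%:R * M0 <= h * \sum_(0 <= j < J) (N j v)%:R <=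
    \sum_(0 <= i < l) c (e v (k0 + i%:Z)) w + l%:R * M0 + l%:R * h.
  have -> : h * \sum_(0 <= j < J) (N j v)%:R =
      \sum_(0 <= i < l) h * (\sum_(0 <= j < J) (j%:R * h < c (e v (k0 + i%:Z)) w + M0)%R)%:R.
    rewrite -mulr_sumr; congr (_ * _); rewrite -!natr_sum; congr (_%:R).
    by rewrite /N exchange_big.
  have cst (z : R) : l%:R * z = \sum_(0 <= i < l) z by rewrite sumr_const_nat subn0 mulr_natl.
  rewrite !cst -!big_split/=; apply/andP; split; apply: ler_sum => i _.
    by case/andP: (cake v i (e_dual _ _)).
  by case/andP: (cake v i (e_dual _ _)).
have comp : \sum_(0 <= j < J) (N j x)%:R <= \sum_(0 <= j < J) (N j x')%:R +
    J%:R * (4 * (eta * (2 * L * m)%:R + (3 * m)%:R)).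
  have -> : J%:R * (4 * (eta * (2 * L * m)%:R + (3 * m)%:R)) = \sum_(0 <= j < J) (4 * (eta * (2 * L * m)%:R + (3 * m)%:R)).
    by rewrite sumr_const_nat subn0 mulr_natl.
  rewrite -big_split/= ler_sum_nat// => j /andP[_ jJ].
  have := prefix j u jJ uL; have := prefix j u' jJ u'L; rewrite -xE -x'E !ler_norml.
  by lra.
have /andP[l1 _] := lines x; have /andP[_ l2] := lines x'.
have {}comp := ler_wpM2l (ltW h0) comp.
have hJ : h * J%:R = 2 * M0 by rewrite /h divfK// gt_eqF.
have n_ge0 : 0 <= n by apply: le_trans rn.
have ln : l%:R <= 2 * Lam%:R * n.
  have : (k0 + l%:Z)%:~R - k0%:~R <= Lam%:R * n + Lam%:R * n by lra.
  by rewrite intrD addrC addKr; lra.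
have lh : l%:R * h <= theta / 3 * n.
  have : l%:R * h <= 2 * Lam%:R * n * h by rewrite ler_wpM2r// ltW.
  move/le_trans; apply.
  have : Lam%:R * h * 6 <= theta.
    by rewrite /h mulrA mulrAC ler_pdivrMr//; lra.
  by move/(ler_wpM2r n_ge0); lra.
have Km : K%:R * m%:R <= n by rewrite -natrM.
have e1 : 2 * M0 * (4 * (eta * (2 * L * m)%:R)) <= theta / 3 * n.
  have -> : 2 * M0 * (4 * (eta * (2 * L * m)%:R)) = theta / 3 * (K%:R * m%:R).
    rewrite /eta /L !natrM; field.
    by rewrite !gt_eqF.
  by rewrite ler_wpM2l// divr_ge0// ltW.
have e2 : 2 * M0 * (4 * (3 * m)%:R) <= theta / 3 * n.
  have : 72 * M0 * m%:R <= theta * K%:R * m%:R by rewrite ler_wpM2r.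
  have : theta * (K%:R * m%:R) <= theta * n by rewrite ler_wpM2l// ltW.
  by rewrite natrM; lra.
have : h * (J%:R * (4 * (eta * (2 * L * m)%:R + (3 * m)%:R))) =
  2 * M0 * (4 * (eta * (2 * L * m)%:R)) + 2 * M0 * (4 * (3 * m)%:R) by rewrite mulrA hJ; ring.
by move: comp; rewrite mulrDr; lra.
Qed.

End line.
End random_field_facts.

(** * Unions of cells and their energy *)

Section cells.
Context {R : realType}.
Implicit Types (eps : R) (z : int * int) (I J : set (int * int)) (x p : R * R).

Definition cell_index eps x : int * int :=
  (Num.floor (x.1 / eps + 2^-1), Num.floor (x.2 / eps + 2^-1)).

(** Unions of cells as preimages of index sets: set operations on them become those on the
    indices. *)
Definition cells eps I : set (R * R) := cell_index eps @^-1` I.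

Lemma scale_pair eps x : eps *: x = (eps * x.1, eps * x.2).
Proof. by []. Qed.

Lemma scale_zpt_inj eps : 0 < eps -> injective (fun z => eps *: zpt z : R * R).
Proof.
move=> e0 [a b] [a' b'] [].
by do 2! move=> /(mulfI (lt0r_neq0 e0))/intr_inj ->.
Qed.

Lemma cell_indexP eps z x : 0 < eps ->
  cell_index eps x = z <->
  (eps * z.1%:~R - eps / 2 <= x.1 < eps * z.1%:~R + eps / 2) /\
  (eps * z.2%:~R - eps / 2 <= x.2 < eps * z.2%:~R + eps / 2).
Proof.
move=> e0; have := @cell_centerP R eps x (eps *: zpt z) e0; rewrite /cell scale_pair/=.
move=> /(_ (ex_intro2 _ _ z I erefl))[h1 h2]; split=> [xz|/h1]; last exact: scale_zpt_inj.
by apply: h2; rewrite -xz.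
Qed.

Lemma cell_index_center eps z : 0 < eps -> cell_index eps (eps *: zpt z) = z.
Proof. by move=> e0; apply/cell_indexP => //; rewrite scale_pair/=; split; apply/andP; split; lra. Qed.

Lemma cellE eps z : 0 < eps -> cell eps (eps *: zpt z) = cell_index eps @^-1` [set z].
Proof. by move=> e0; apply/seteqP; split => x; rewrite /cell scale_pair/= => /cell_indexP; exact. Qed.

Lemma lattice_setsE eps A : 0 < eps -> lattice_sets eps A <-> exists I, A = cells eps I.
Proof.
move=> e0; split=> [[S Slat ->]|[I ->]].
  exists [set z | S (eps *: zpt z)]; apply/seteqP; split => [x [i Si]|x /= h].
    have [z _ zi] := Slat _ Si; rewrite -zi cellE//= => xz.
    by rewrite /cells/= xz zi.
  by exists (eps *: zpt (cell_index eps x)) => //; rewrite cellE.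
exists [set eps *: zpt z | z in I]; first by move=> _ [z _ <-]; exists z.
apply/seteqP; split => [x Ix|x [_ [z Iz <-]]]; last by rewrite cellE// /cells/= => ->.
by exists (eps *: zpt (cell_index eps x)); [exists (cell_index eps x)|rewrite cellE].
Qed.

(** Midpoint, before scaling by [eps], between the cells [z] and [right_cell z]. The step from cell
    to cell is horizontal; the edge itself is a vertical segment. *)
Definition hedge z : R * R := (z.1%:~R + 2^-1, z.2%:~R).
Definition vedge z : R * R := (z.1%:~R, z.2%:~R + 2^-1).
Definition right_cell z : int * int := (z.1 + 1, z.2).
Definition up_cell z : int * int := (z.1, z.2 + 1).

Lemma hedge_dual z : dual_lattice (hedge z).
Proof.
exists (z, right_cell z) => /=.
  rewrite /dist2/= intrD opprD addrA subrr sub0r sqrrN expr1n subrr expr0n addr0.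
  exact: sqrtr1.
by rewrite scale_pair /hedge /zpt /right_cell/=; congr pair; rewrite ?intrD; lra.
Qed.

Lemma vedge_dual z : dual_lattice (vedge z).
Proof.
exists (z, up_cell z) => /=.
  rewrite /dist2/= subrr expr0n add0r intrD opprD addrA subrr sub0r sqrrN expr1n.
  exact: sqrtr1.
by rewrite scale_pair /vedge /zpt /up_cell/=; congr pair; rewrite ?intrD; lra.
Qed.

Lemma sum_sqr_eq1 (a b : int) : a ^+ 2 + b ^+ 2 = 1 ->
  [\/ a = 1 /\ b = 0, a = -1 /\ b = 0, a = 0 /\ b = 1 | a = 0 /\ b = -1].
Proof.
move=> ab; have a1 : -1 <= a <= 1 by nia.
have b1 : -1 <= b <= 1 by nia.
have [a0|[a0|a0]] : a = -1 \/ a = 0 \/ a = 1 by lia.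
- by apply: Or42; split=> //; nia.
- have [b0|[b0|b0]] : b = -1 \/ b = 0 \/ b = 1 by lia.
  + exact: Or44.
  + by nia.
  + exact: Or43.
- by apply: Or41; split=> //; nia.
Qed.

Lemma dual_latticeP xi : dual_lattice xi -> exists z, xi = hedge z \/ xi = vedge z.
Proof.
move=> [[[i1 i2] [j1 j2]]/= d1 <-].
have /sum_sqr_eq1 : (i1 - j1) ^+ 2 + (i2 - j2) ^+ 2 = 1.
  apply: (@intr_inj R); rewrite intrD !rmorphXn/= !intrB.
  by rewrite -[LHS]sqr_sqrtr ?addr_ge0 ?sqr_ge0//; move: d1; rewrite /dist2/= => ->; rewrite expr1n.
move=> [] [a b].
- exists (j1, j2); left; have -> : i1 = j1 + 1 by move: a; clear; lia.
  have -> : i2 = j2 by move: b; clear; lia.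
  by rewrite scale_pair /hedge/=; congr pair; rewrite ?intrD; lra.
- exists (i1, i2); left; have -> : j1 = i1 + 1 by move: a; clear; lia.
  have -> : j2 = i2 by move: b; clear; lia.
  by rewrite scale_pair /hedge/=; congr pair; rewrite ?intrD; lra.
- exists (j1, j2); right; have -> : i2 = j2 + 1 by move: b; clear; lia.
  have -> : i1 = j1 by move: a; clear; lia.
  by rewrite scale_pair /vedge/=; congr pair; rewrite ?intrD; lra.
- exists (i1, i2); right; have -> : j2 = i2 + 1 by move: b; clear; lia.
  have -> : j1 = i1 by move: a; clear; lia.
  by rewrite scale_pair /vedge/=; congr pair; rewrite ?intrD; lra.
Qed.

Lemma hedge_inj : injective hedge.
Proof.
by move=> [a b] [a' b'] []/= => /addIr/intr_inj -> /intr_inj ->.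
Qed.

Lemma vedge_inj : injective vedge.
Proof.
by move=> [a b] [a' b'] []/= => /intr_inj -> /addIr/intr_inj ->.
Qed.

(** Twice the first coordinate is odd on one side and even on the other. *)
Lemma hedge_neq_vedge z z' : hedge z <> vedge z'.
Proof.
move=> [h _]; have : 2 * z.1%:~R + 1 = 2 * z'.1%:~R :> R by lra.
rewrite -[2]/(2%:~R) -[1]/(1%:~R) -!intrM -intrD => /intr_inj; lia.
Qed.

(** At an edge midpoint [p] the map [f] is the cell index: its value [k'] is the cell containing
    [p], and the other cell [k] comes arbitrarily close. The asymmetry reflects the half-open
    cells. *)
Lemma boundary_two (K : Type) (f : R * R -> K) p (k k' : K) (S : set K) :
  (\forall x \near p, f x = k \/ f x = k') ->
  (forall U, nbhs p U -> exists2 x, U x & f x = k) -> f p = k' ->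
  topological_boundary (f @^-1` S) p <-> ~ (S k <-> S k').
Proof.
move=> near_p kU fp; rewrite /topological_boundary; split.
  move=> [cl nint] Skk'.
  have [[Sk Sk']|nS] : (S k /\ S k') \/ (~ S k /\ ~ S k').
    by have [Sk|Sk] := pselect (S k); [left; split=> //; apply/Skk'|right; split=> // /Skk'].
    apply: nint; rewrite /interior/=; apply: filterS near_p => x [] /= fx; by rewrite /preimage/= fx.
  have [x [Sfx fx]] := cl _ near_p; move: Sfx; rewrite /preimage/=.
  by case: fx => ->; case: nS.
move=> nS; split.
  move=> U Up; have [Sk'|Sk'] := pselect (S k').
    by exists p; split; [rewrite /preimage/= fp|exact: nbhs_singleton].
  have Sk : S k by apply: contrapT => nSk; apply: nS; split.
  by have [x Ux fx] := kU _ Up; exists x; split=> //; rewrite /preimage/= fx.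
move=> intp; apply: nS; split=> [_|_].
  by have := nbhs_singleton intp; rewrite /preimage/= fp.
by have [x + fx] := kU _ intp; rewrite /preimage/= fx.
Qed.

Lemma near_box p (r : R) : 0 < r -> \forall x \near p, `|x.1 - p.1| < r /\ `|x.2 - p.2| < r.
Proof.
move=> r0; apply/nbhs_ballP; exists r => //= x [h1 h2].
by split; rewrite distrC; [exact: h1|exact: h2].
Qed.

Lemma boundary_hedge eps I z : 0 < eps ->
  topological_boundary (cells eps I) (eps *: hedge z) <-> ~ (I z <-> I (right_cell z)).
Proof.
move=> e0; rewrite scale_pair/=; apply: boundary_two.
- apply: filterS (near_box _ (divr_gt0 e0 (ltr0n R 2))) => x /=; rewrite !ltr_norml => -[/andP[a b] /andP[c d]].
  have [h|h] := ltP x.1 (eps * (z.1%:~R + 2^-1)).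
    by left; apply/cell_indexP => //; split; apply/andP; split; lra.
  by right; apply/cell_indexP => //=; rewrite intrD; split; apply/andP; split; lra.
- move=> U /nbhs_ballP[r /= r0 rU].
  pose t := Num.min (r / 2) (eps / 2).
  have t0 : 0 < t by rewrite lt_min !divr_gt0.
  have tr : t <= r / 2 by rewrite ge_min lexx.
  have te : t <= eps / 2 by rewrite ge_min lexx orbT.
  exists (eps * (z.1%:~R + 2^-1) - t, eps * z.2%:~R).
    apply: rU; split => /=; rewrite /ball/=; last by rewrite subrr normr0.
    by rewrite opprB addrC subrK gtr0_norm//; lra.
  by apply/cell_indexP => //=; split; apply/andP; split; lra.
- by apply/cell_indexP => //=; rewrite intrD; split; apply/andP; split; lra.
Qed.

Lemma boundary_vedge eps I z : 0 < eps ->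
  topological_boundary (cells eps I) (eps *: vedge z) <-> ~ (I z <-> I (up_cell z)).
Proof.
move=> e0; rewrite scale_pair/=; apply: boundary_two.
- apply: filterS (near_box _ (divr_gt0 e0 (ltr0n R 2))) => x /=; rewrite !ltr_norml => -[/andP[a b] /andP[c d]].
  have [h|h] := ltP x.2 (eps * (z.2%:~R + 2^-1)).
    by left; apply/cell_indexP => //; split; apply/andP; split; lra.
  by right; apply/cell_indexP => //=; rewrite intrD; split; apply/andP; split; lra.
- move=> U /nbhs_ballP[r /= r0 rU].
  pose t := Num.min (r / 2) (eps / 2).
  have t0 : 0 < t by rewrite lt_min !divr_gt0.
  have tr : t <= r / 2 by rewrite ge_min lexx.
  have te : t <= eps / 2 by rewrite ge_min lexx orbT.
  exists (eps * z.1%:~R, eps * (z.2%:~R + 2^-1) - t).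
    apply: rU; split => /=; rewrite /ball/=; first by rewrite subrr normr0.
    by rewrite opprB addrC subrK gtr0_norm//; lra.
  by apply/cell_indexP => //=; split; apply/andP; split; lra.
- by apply/cell_indexP => //=; rewrite intrD; split; apply/andP; split; lra.
Qed.

Section box.
Variables M N : nat.
Definition box_pt (i j : nat) : int * int := (i%:Z - N%:Z, j%:Z - N%:Z).
Definition box_seq : seq (int * int) := [seq box_pt i j | i <- iota 0 M, j <- iota 0 M].

Lemma box_pt_inj i j i' j' : box_pt i j = box_pt i' j' -> i = i' /\ j = j'.
Proof. by move=> [/addIr[->] /addIr[->]]. Qed.

Lemma box_seq_uniq : uniq box_seq.
Proof.
apply: allpairs_uniq; rewrite ?iota_uniq// => -[i j] [i' j'] _ _ /= /box_pt_inj[-> ->]//.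
Qed.

Lemma mem_box_seq z : z \in box_seq -> exists i j, [/\ (i < M)%N, (j < M)%N & z = box_pt i j].
Proof.
move=> /allpairsP[[i j] /= [+ + ->]]; rewrite !mem_iota !add0n/= => iM jM.
by exists i, j.
Qed.

Lemma box_pt_mem i j : (i < M)%N -> (j < M)%N -> box_pt i j \in box_seq.
Proof. by move=> iM jM; apply/allpairsP; exists (i, j); rewrite /= !mem_iota !add0n. Qed.

Lemma sum_box (V : nmodType) (g : int * int -> V) (p : pred (int * int)) :
  \sum_(z <- box_seq | p z) g z =
  \sum_(0 <= i < M) \sum_(0 <= j < M) g (box_pt i j) *+ p (box_pt i j).
Proof.
rewrite big_mkcond/= big_allpairs_dep/= /index_iota !subn0.
by apply: eq_bigr => i _; apply: eq_bigr => j _; case: (p _).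
Qed.

End box.
End cells.

(** * Perimeter and penalty of unions of cells as finite sums *)

Section energy.
Context {R : realType}.
Implicit Types (eps : R) (z : int * int) (I J S : set (int * int)).
Notation mu2 := (@lebesgue_measure R \x @lebesgue_measure R)%E.

Definition sup_dist z z' : nat := maxn `|z.1 - z'.1| `|z.2 - z'.2|.

(** [dist_inf] is constant on each cell; this is its value there, as [dist_infE] shows. *)
Definition cell_dist eps J z : \bar R := dist_inf eps (cells eps J) (eps *: zpt z).

Lemma norm_zptB eps z z' : 0 < eps ->
  `|eps *: zpt z - eps *: zpt z'| = eps * (sup_dist z z')%:R :> R.
Proof.
move=> e0; rewrite -scalerBr normrZ gtr0_norm//; congr (_ * _).
rewrite prod_normE/= -!intrB -!intr_norm -!abszE /sup_dist.
rewrite -[in LHS]/((`|z.1 - z'.1|%N)%:R : R) -[X in Num.max _ X]/((`|z.2 - z'.2|%N)%:R : R).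
by case: leqP => h; [rewrite (max_idPr _)|rewrite (max_idPl _)] => //; rewrite ler_nat// ltnW.
Qed.

Lemma dist_infE eps J x : 0 < eps -> dist_inf eps (cells eps J) x = cell_dist eps J (cell_index eps x).
Proof.
move=> e0; rewrite /cell_dist /dist_inf.
by have -> : cell_center eps (eps *: zpt (cell_index eps x)) = cell_center eps x
  by rewrite {1}/cell_center -/(cell_index _ _) cell_index_center.
Qed.

Lemma cell_distE eps J z : 0 < eps -> cell_dist eps J z =
  ereal_inf [set (eps * (sup_dist z z')%:R)%:E | z' in [set z' | J z' <-> ~ J z]].
Proof.
move=> e0; rewrite /cell_dist /dist_inf.
have -> : cell_center eps (eps *: zpt z) = eps *: zpt z.
  by rewrite /cell_center -/(cell_index _ _) cell_index_center.
have inJ z' : cells eps J (eps *: zpt z') <-> J z' by rewrite /cells/= cell_index_center.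
congr ereal_inf; apply/seteqP; split => [_ [_ [[z' _ <-]] h <-]|_ [z' h <-]].
  exists z'; last by rewrite norm_zptB.
  move: h; case: ifPn => [/set_mem/inJ Jz|/negP nJ]/=.
    by move=> nJ'; split=> // Jz'; case: nJ'; apply/inJ.
  by move=> /inJ Jz'; split=> // _ Jz; apply: nJ; apply/mem_set/inJ.
exists (eps *: zpt z'); last by rewrite norm_zptB.
split; first by exists z'.
case: ifPn => [/set_mem/inJ Jz|/negP nJ]/=.
  by move=> /inJ /h; exact.
by apply/inJ/h => Jz; apply: nJ; apply/mem_set/inJ.
Qed.

Lemma cell_dist_ge eps J z : 0 < eps -> (eps%:E <= cell_dist eps J z)%E.
Proof.
move=> e0; rewrite cell_distE//; apply: le_ereal_inf_tmp => _ [z' h <-].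
rewrite lee_fin ler_peMr ?(ltW e0)// ler1n lt0n; apply/eqP => d0.
have zz' : z = z'.
  by move: d0; rewrite /sup_dist; case: z {h} => a b; case: z' => a' b' /= ?; congr pair; lia.
by move: h; rewrite /= zz'; tauto.
Qed.

Definition int_rect (x1 x2 y1 y2 : int) : set (int * int) :=
  [set z | (x1 <= z.1 < x2) /\ (y1 <= z.2 < y2)].

Lemma int_rect_box N x1 x2 y1 y2 i j :
  int_rect (x1%:Z - N%:Z) (x2%:Z - N%:Z) (y1%:Z - N%:Z) (y2%:Z - N%:Z) (box_pt N i j) <->
  inrect x1 x2 y1 y2 i j.
Proof.
rewrite /int_rect /inrect /box_pt/= !lerD2r !ltrD2r.
by split=> [[h1 h2]|/andP[h1 h2]]; [apply/andP; split|split].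
Qed.

(** The rectangle is left in a straight line through the nearest side; [x1] and [y1] are positive so
    that the cell before the first one has a natural index. Conversely, cells closer than the depth
    are still in the rectangle. *)
Lemma cell_dist_rect eps N x1 x2 y1 y2 i j : 0 < eps -> (0 < x1)%N -> (0 < y1)%N ->
  inrect x1 x2 y1 y2 i j ->
  cell_dist eps (int_rect (x1%:Z - N%:Z) (x2%:Z - N%:Z) (y1%:Z - N%:Z) (y2%:Z - N%:Z)) (box_pt N i j) =
  (eps * (depth x1 x2 y1 y2 i j)%:R)%:E.
Proof.
move=> e0 x10 y10 Rij; set J := int_rect _ _ _ _.
have Jz : J (box_pt N i j) by apply/int_rect_box.
have out i' j' : ~~ inrect x1 x2 y1 y2 i' j' ->
    (cell_dist eps J (box_pt N i j) <= (eps * (sup_dist (box_pt N i j) (box_pt N i' j'))%:R)%:E)%E.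
  move=> nR; rewrite cell_distE//; apply: ereal_inf_lbound.
  exists (box_pt N i' j') => //=; split=> // /int_rect_box h; by rewrite h in nR.
have sd i' j' n : (maxn (absz (i%:Z - i'%:Z)) (absz (j%:Z - j'%:Z)) <= n)%N -> ~~ inrect x1 x2 y1 y2 i' j' ->
    (cell_dist eps J (box_pt N i j) <= (eps * n%:R)%:E)%E.
  move=> h /out/le_trans; apply; rewrite lee_fin ler_pM2l// ler_nat.
  by apply: leq_trans h; rewrite /sup_dist /box_pt/= !opprB !addrA !subrK.
apply/eqP; rewrite eq_le; apply/andP; split.
  have [e|[e|[e|e]]] : depth x1 x2 y1 y2 i j = (i.+1 - x1)%N \/
      (depth x1 x2 y1 y2 i j = (x2 - i)%N \/ (depth x1 x2 y1 y2 i j = (j.+1 - y1)%N \/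
      depth x1 x2 y1 y2 i j = (y2 - j)%N)) by rewrite /depth /depth1; clear; lia.
  - by rewrite e; apply: (sd x1.-1 j); move: Rij x10; rewrite /inrect; clear; lia.
  - by rewrite e; apply: (sd x2 j); move: Rij; rewrite /inrect; clear; lia.
  - by rewrite e; apply: (sd i y1.-1); move: Rij y10; rewrite /inrect; clear; lia.
  - by rewrite e; apply: (sd i y2); move: Rij; rewrite /inrect; clear; lia.
rewrite cell_distE//; apply: le_ereal_inf_tmp => _ [z' h <-].
rewrite lee_fin ler_pM2l// ler_nat leqNgt; apply/negP => lt.
have nJ : ~ J z' by move=> /h; exact.
apply: nJ; move: lt Rij; rewrite /J /int_rect /sup_dist /depth /depth1 /inrect /box_pt/=.
by clear; case: z' => u v /= h1 h2; split; lia.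
Qed.

(** The infimum would be [+oo] if there were no cell of the other kind; here any cell of [J] bounds
    it. *)
Lemma cell_dist_fin eps J z : 0 < eps -> J !=set0 -> ~ J z -> cell_dist eps J z \is a fin_num.
Proof.
move=> e0 [z' Jz'] nJz; rewrite fin_numE; apply/andP; split; apply/eqP => h.
  by have := cell_dist_ge J z e0; rewrite h leeNy_eq.
have : (cell_dist eps J z <= (eps * (sup_dist z z')%:R)%:E)%E.
  by rewrite cell_distE//; apply: ereal_inf_lbound; exists z'.
by rewrite h leye_eq.
Qed.

Lemma cell_dist_rect_fin eps N x1 x2 y1 y2 i j : 0 < eps ->
  (0 < x1)%N -> (x1 < x2)%N -> (0 < y1)%N -> (y1 < y2)%N ->
  cell_dist eps (int_rect (x1%:Z - N%:Z) (x2%:Z - N%:Z) (y1%:Z - N%:Z) (y2%:Z - N%:Z)) (box_pt N i j)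
    \is a fin_num.
Proof.
move=> e0 x10 x12 y10 y12; set J := int_rect _ _ _ _.
have [h|h] := pselect (J (box_pt N i j)).
  by have /int_rect_box h' := h; rewrite /J cell_dist_rect.
apply: cell_dist_fin => //.
by exists (box_pt N x1 y1); apply/int_rect_box; rewrite /inrect !leqnn x12 y12.
Qed.

Lemma cells_measurable eps I : 0 < eps ->
  @measurable _ (measurableTypeR R * measurableTypeR R)%type (cells eps I).
Proof.
move=> e0.
have mcell z : @measurable _ (measurableTypeR R * measurableTypeR R)%type (cells eps [set z]).
  rewrite (_ : cells eps [set z] =
    `[eps * z.1%:~R - eps / 2, eps * z.1%:~R + eps / 2[%classic `*`
    `[eps * z.2%:~R - eps / 2, eps * z.2%:~R + eps / 2[%classic).
    by apply: measurableX; exact: measurable_itv.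
  by apply/seteqP; split => x; rewrite /cells/= !in_itv/= => /cell_indexP; exact.
rewrite (_ : cells eps I = \bigcup_z (if z \in I then cells eps [set z] else set0)).
  apply: countable_bigcupT_measurable; first exact: countableP.
  by move=> z; case: ifP.
apply/seteqP; split => [x Ix|x [z _]].
  by exists (cell_index eps x) => //; rewrite mem_set.
by case: ifPn => // /set_mem Iz; rewrite /cells/= => ->.
Qed.

Lemma cell_measure eps z : 0 < eps -> mu2 (cells eps [set z]) = (eps ^+ 2)%:E.
Proof.
move=> e0; rewrite (_ : cells eps [set z] =
    `[eps * z.1%:~R - eps / 2, eps * z.1%:~R + eps / 2[%classic `*`
    `[eps * z.2%:~R - eps / 2, eps * z.2%:~R + eps / 2[%classic).
  rewrite product_measure1E; [|exact: measurable_itv..].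
  rewrite /= !lebesgue_measure_itv/= !lte_fin !ifT; [|lra..].
  by rewrite -!EFinB -EFinM; congr EFin; rewrite expr2; congr (_ * _); lra.
by apply/seteqP; split => x; rewrite /cells/= !in_itv/= => /cell_indexP; exact.
Qed.

Lemma dist_inf_measurable eps J I : 0 < eps ->
  measurable_fun (cells eps I : set (measurableTypeR R * measurableTypeR R)) (dist_inf eps (cells eps J)).
Proof.
move=> e0 _ Y mY.
rewrite (_ : _ `&` _ = cells eps (I `&` [set z | Y (cell_dist eps J z)])).
  exact: cells_measurable.
by apply/seteqP; split => x; rewrite /cells/= /preimage/= dist_infE.
Qed.

Lemma dist_inf_ge0 eps J x : 0 < eps -> (0 <= dist_inf eps (cells eps J) x)%E.
Proof.
move=> e0; rewrite dist_infE//; apply: le_trans (cell_dist_ge J _ e0).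
by rewrite lee_fin ltW.
Qed.

Lemma integral_cells eps J (s : seq (int * int)) : 0 < eps -> uniq s ->
  (\int[mu2]_(x in cells eps [set` s]) dist_inf eps (cells eps J) x =
   \sum_(z <- s) cell_dist eps J z * (eps ^+ 2)%:E)%E.
Proof.
move=> e0 us.
have E : cells eps [set` s] = \big[setU/set0]_(z <- s) cells eps [set z].
  rewrite -bigcup_seq; apply/seteqP; split => [x xs|x [z zs]].
    by exists (cell_index eps x).
  by rewrite /cells/= => ->.
rewrite E ge0_integral_bigsetU//=.
- apply: eq_bigr => z _.
  rewrite (eq_integral (cst (cell_dist eps J z))); last first.
    by move=> x; rewrite inE /cells/= => xz; rewrite dist_infE// xz.
  by rewrite integral_cst; [congr (_ * _)%E; exact: cell_measure|exact: cells_measurable].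
- by move=> z; exact: cells_measurable.
- by move=> z z' _ _ [x []]; rewrite /cells/= => <-.
- by rewrite -E; exact: dist_inf_measurable.
- by move=> x _; exact: dist_inf_ge0.
Qed.

(** Each cell contributes at least [eps * eps ^ 2], so infinitely many would make the integral
    infinite. *)
Lemma integral_cells_finite eps J I : 0 < eps ->
  (\int[mu2]_(x in cells eps I) dist_inf eps (cells eps J) x < +oo)%E -> finite_set I.
Proof.
move=> e0 fin; apply: contrapT => /infinite_set_fset inf.
have e3 : 0 < eps ^+ 3 by rewrite exprn_gt0.
set v := (\int[mu2]_(x in _) _)%E in fin.
have v0 : (0 <= v)%E by apply: integral_ge0 => x _; exact: dist_inf_ge0.
have vf : v = (fine v)%:E by rewrite fineK// ge0_fin_numE.
have [X XI nX] := inf (Num.bound (fine v / eps ^+ 3)).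
have : (\int[mu2]_(x in cells eps [set` finmap.enum_fset X]) dist_inf eps (cells eps J) x <= v)%E.
  apply: ge0_subset_integral.
  - exact: cells_measurable.
  - exact: cells_measurable.
  - exact: dist_inf_measurable.
  - by move=> x _; exact: dist_inf_ge0.
  - by move=> x; exact: XI.
rewrite integral_cells//; last exact: finmap.fset_uniq.
apply/negP; rewrite -ltNge vf.
apply: (@lt_le_trans _ _ (\sum_(z <- finmap.enum_fset X) (eps ^+ 3)%:E)%E); last first.
  apply: lee_sum => z _; rewrite exprSr EFinM muleC; apply: lee_pmul => //; rewrite ?lee_fin ?(ltW e0)//.
    by rewrite exprn_ge0// ltW.
  exact: cell_dist_ge.
rewrite sumEFin lte_fin big_const_seq count_predT iter_addr_0 -[_ *+ _]mulr_natl -ltr_pdivrMr//.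
apply: (lt_le_trans (archi_boundP _)); last by rewrite ler_nat.
by rewrite divr_ge0 ?fine_ge0// ltW.
Qed.

Lemma asbool_not_iff (A B : Prop) : `[< ~ (A <-> B) >] = (`[< A >] != `[< B >]).
Proof.
case: (asboolP A) => hA; case: (asboolP B) => hB; [rewrite asboolF|rewrite asboolT|rewrite asboolT|rewrite asboolF] => //;
  tauto.
Qed.

Section perimeter.
Variables (eps C : R) (c : R * R -> R).
Hypotheses (eps_gt0 : 0 < eps) (cC : forall xi, dual_lattice xi -> `|c xi| <= C) (eC : eps * C <= 1).

Let term xi : R := eps * (1 + eps * c xi).

Let term_ge0 xi : dual_lattice xi -> 0 <= term xi.
Proof.
move=> dxi; rewrite /term mulr_ge0 ?(ltW eps_gt0)//.
have := cC dxi; rewrite ler_norml => /andP[h _].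
have : eps * - C <= eps * c xi by rewrite ler_pM2l.
by move: eC; rewrite mulrN => h1 h2; lra.
Qed.

(** The bound [eps * C <= 1] makes every term nonnegative, so the negative part vanishes. *)
Lemma perimeterE A : perimeter c eps A =
  (\esum_(xi in dual_lattice `&` [set xi | topological_boundary A (eps *: xi)]) (term xi)%:E)%E.
Proof.
rewrite /perimeter; set edges := dual_lattice `&` _.
have -> : (\esum_(xi in edges) ((fun xi => (eps * (1 + eps * c xi))%:E)^\- xi) = 0)%E.
  apply: esum1 => xi [dxi _]; rewrite funenegE -EFinN.
  by apply/max_idPr; rewrite lee_fin oppr_le0; exact: term_ge0.
rewrite sube0; apply: eq_esum => xi [dxi _]; rewrite funeposE.
by apply/max_idPl; rewrite lee_fin; exact: term_ge0.
Qed.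

Lemma perimeter_ge0 A : (0 <= perimeter c eps A)%E.
Proof. by rewrite perimeterE; apply: esum_ge0 => xi [dxi _]; rewrite lee_fin term_ge0. Qed.

(** The strict bounds keep the first and the last line of the box free, so that every boundary edge
    is seen by a sum over the edges [0] to [M - 1]. *)
Definition boxed M N I : Prop :=
  forall z, I z -> exists i j, [/\ (0 < i < M)%N, (0 < j < M)%N & z = box_pt N i j].

Lemma perimeter_box M N I : boxed M N I ->
  perimeter c eps (cells eps I) =
  (eps * (\sum_(0 <= j < M) variation (fun i => `[< I (box_pt N i j) >])
                              (fun i => 1 + eps * c (hedge (box_pt N i j))) 0 M +
          \sum_(0 <= i < M) variation (fun j => `[< I (box_pt N i j) >])
                              (fun j => 1 + eps * c (vedge (box_pt N i j))) 0 M))%:E.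
Proof.
move=> Ibox; rewrite perimeterE.
pose sH := [seq z <- box_seq M N | `[< ~ (I z <-> I (right_cell z)) >]].
pose sV := [seq z <- box_seq M N | `[< ~ (I z <-> I (up_cell z)) >]].
pose s := map hedge sH ++ map vedge sV : seq (R * R).
have us : uniq s.
  rewrite cat_uniq !map_inj_uniq; [|exact: vedge_inj|exact: hedge_inj].
  rewrite !filter_uniq ?box_seq_uniq// andbT; apply/hasPn => _ /mapP[z _ ->].
  by apply/negP => /mapP[z' _ /esym/hedge_neq_vedge].
have rightE i j : right_cell (box_pt N i j) = box_pt N i.+1 j.
  by rewrite /right_cell /box_pt/=; congr pair; lia.
have upE i j : up_cell (box_pt N i j) = box_pt N i j.+1.
  by rewrite /up_cell /box_pt/=; congr pair; lia.
have edgesE : dual_lattice `&` [set xi | topological_boundary (cells eps I) (eps *: xi)] = [set` s].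
  apply/seteqP; split => xi.
    move=> [/dual_latticeP[z [->|->]]] /=.
      move=> /(boundary_hedge _ _ eps_gt0) nI; rewrite mem_cat; apply/orP; left.
      apply/mapP; exists z => //; rewrite mem_filter; apply/andP; split; first exact/asboolP.
      have [Iz|nIz] := pselect (I z).
        by have [i [j [/andP[_ iM] /andP[_ jM] ->]]] := Ibox _ Iz; exact: box_pt_mem.
      have [Iz|nIz'] := pselect (I (right_cell z)); last by case: nI; split.
      have [i [j [/andP[i0 iM] /andP[_ jM] zE]]] := Ibox _ Iz.
      have -> : z = box_pt N i.-1 j.
        move: zE i0; rewrite /right_cell /box_pt; case: z {nI nIz Iz} => u v /= [h1 ->]; clear -h1 => i0.
        by congr pair; lia.
      by apply: box_pt_mem => //; rewrite (leq_ltn_trans (leq_pred _)).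
    move=> /(boundary_vedge _ _ eps_gt0) nI; rewrite mem_cat; apply/orP; right.
    apply/mapP; exists z => //; rewrite mem_filter; apply/andP; split; first exact/asboolP.
    have [Iz|nIz] := pselect (I z).
      by have [i [j [/andP[_ iM] /andP[_ jM] ->]]] := Ibox _ Iz; exact: box_pt_mem.
    have [Iz|nIz'] := pselect (I (up_cell z)); last by case: nI; split.
    have [i [j [/andP[_ iM] /andP[j0 jM] zE]]] := Ibox _ Iz.
    have -> : z = box_pt N i j.-1.
      move: zE j0; rewrite /up_cell /box_pt; case: z {nI nIz Iz} => u v /= [-> h1]; clear -h1 => j0.
      by congr pair; lia.
    by apply: box_pt_mem => //; rewrite (leq_ltn_trans (leq_pred _)).
  rewrite /= mem_cat => /orP[] /mapP[z]; rewrite mem_filter => /andP[/asboolP nI _] ->.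
    by split; [exact: hedge_dual|apply/boundary_hedge].
  by split; [exact: vedge_dual|apply/boundary_vedge].
rewrite edgesE esum_fset; [|exact: finite_seq|]; last first.
  by move=> xi; rewrite inE -edgesE => -[dxi _]; rewrite lee_fin term_ge0.
rewrite -fsbig_seq// sumEFin big_cat/= !big_map !big_filter !sum_box mulrDr; congr EFin; congr (_ + _).
  rewrite exchange_big mulr_sumr; apply: eq_bigr => j _; rewrite /variation mulr_sumr; apply: eq_bigr => i _.
  rewrite /term -mulrnAr; congr (_ * (_ *+ nat_of_bool _)); rewrite rightE.
  exact: asbool_not_iff.
rewrite mulr_sumr; apply: eq_bigr => i _; rewrite /variation mulr_sumr; apply: eq_bigr => j _.
rewrite /term -mulrnAr; congr (_ * (_ *+ nat_of_bool _)); rewrite upE.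
exact: asbool_not_iff.
Qed.

(** A cell at distance [eps * d] has penalty [eps * d * eps ^ 2 / (gamma * eps)], which is [eps]
    times [eps / gamma * d]; this is the origin of the factor [eps / gamma]. *)
Lemma energy_box (gamma : R) M N I x1 x2 y1 y2 : 0 < gamma -> boxed M N I ->
  (0 < x1)%N -> (x1 < x2)%N -> (x2 <= M)%N -> (0 < y1)%N -> (y1 < y2)%N -> (y2 <= M)%N ->
  let J := int_rect (x1%:Z - N%:Z) (x2%:Z - N%:Z) (y1%:Z - N%:Z) (y2%:Z - N%:Z) in
  energy c gamma eps (cells eps I) (cells eps J) =
  (eps * box_energy M (fun i j => 1 + eps * c (hedge (box_pt N i j)))
    (fun i j => 1 + eps * c (vedge (box_pt N i j))) (eps / gamma)
    (fun i j => fine (cell_dist eps J (box_pt N i j)) / eps) (inrect x1 x2 y1 y2)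
    (fun i j => `[< I (box_pt N i j) >]))%:E.
Proof.
move=> g0 Ibox x10 x12 x2M y10 y12 y2M J.
pose pen : R := (eps / gamma) * \sum_(0 <= i < M) \sum_(0 <= j < M)
  (fine (cell_dist eps J (box_pt N i j)) / eps) *+ (`[< I (box_pt N i j) >] != inrect x1 x2 y1 y2 i j).
suff H : (((gamma * eps)^-1)%:E * \int[mu2]_(x in cells eps I `+` cells eps J) dist_inf eps (cells eps J) x)%E =
    (eps * pen)%:E.
  by rewrite /energy (perimeter_box Ibox) H -EFinD -mulrDr.
rewrite {}/pen.
pose K := (I `\` J) `|` (J `\` I).
pose s := [seq z <- box_seq M N | `[< K z >]].
have dfin i j : cell_dist eps J (box_pt N i j) = (fine (cell_dist eps J (box_pt N i j)))%:E.
  by rewrite fineK// cell_dist_rect_fin.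
have Jbox z : J z -> exists i j, [/\ (i < M)%N, (j < M)%N & z = box_pt N i j].
  move=> [/= h1 h2]; exists (absz (z.1 + N%:Z)), (absz (z.2 + N%:Z)).
  move: h1 h2 x2M y2M; case: z => u v /=; rewrite /box_pt; clear => h1 h2 h3 h4.
  by split; [lia|lia|congr pair; lia].
have -> : cells eps I `+` cells eps J = cells eps [set` s].
  rewrite (_ : cells eps I `+` cells eps J = cells eps K); last first.
    by [].

  congr cells; apply/seteqP; split => z /=.
    move=> Kz; rewrite mem_filter; apply/andP; split; first exact/asboolP.
    case: Kz => -[].
      by move=> /Ibox[i [j [/andP[_ iM] /andP[_ jM] ->]]] _; exact: box_pt_mem.
    by move=> /Jbox[i [j [iM jM ->]]] _; exact: box_pt_mem.
  by rewrite mem_filter => /andP[/asboolP].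
rewrite integral_cells//; last by rewrite filter_uniq// box_seq_uniq.
rewrite big_filter.
have e0 := lt0r_neq0 eps_gt0.
have -> : (\sum_(z <- box_seq M N | `[< K z >]) cell_dist eps J z * (eps ^+ 2)%:E =
  (\sum_(z <- box_seq M N | `[< K z >]) fine (cell_dist eps J z) * eps ^+ 2)%:E)%E.
  rewrite -sumEFin big_seq_cond [RHS]big_seq_cond; apply: eq_bigr => z /andP[zb _].
  by have [i [j [_ _ ->]]] := mem_box_seq zb; rewrite {1}dfin EFinM.
rewrite sum_box -EFinM; congr EFin.
rewrite mulr_sumr mulr_sumr mulr_sumr; apply: eq_bigr => i _.
rewrite mulr_sumr mulr_sumr mulr_sumr; apply: eq_bigr => j _.
have -> : `[< K (box_pt N i j) >] = (`[< I (box_pt N i j) >] != inrect x1 x2 y1 y2 i j).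
  have JE : `[< J (box_pt N i j) >] = inrect x1 x2 y1 y2 i j.
    by apply/asboolP/idP => h; [exact: (int_rect_box N x1 x2 y1 y2 i j).1|exact: (int_rect_box N x1 x2 y1 y2 i j).2].
  rewrite -JE /K; apply/asboolP/idP => /=.
    by move=> [[a b]|[a b]]; [rewrite (asboolT a) (asboolF b)|rewrite (asboolT a) (asboolF b)].
  have [a|a] := pselect (I (box_pt N i j)); have [b|b] := pselect (J (box_pt N i j)).
  - by rewrite !asboolT.
  - by left.
  - by right.
  - by rewrite !asboolF.
rewrite -!mulrnAr; case: (_ != _); rewrite ?mulr0n ?mulr0// !mulr1n.
by field; rewrite e0 gt_eqF.
Qed.

End perimeter.
End energy.

(** * Reduction of the lattice problem to a finite box *)

Section lattice_step.
Context {R : realType}.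
Implicit Types (eps gamma theta : R) (z : int * int) (I J : set (int * int)).
Notation mu2 := (@lebesgue_measure R \x @lebesgue_measure R)%E.

Lemma finite_lattice_bounded I : finite_set I ->
  exists K : nat, forall z, I z -> (absz z.1 <= K)%N /\ (absz z.2 <= K)%N.
Proof.
move=> /finite_seqP[s ->]; exists (\max_(z <- s) maxn (absz z.1) (absz z.2)) => z /= zs.
have := @leq_bigmax_seq _ s xpredT (fun z : int * int => maxn (absz z.1) (absz z.2)) z zs isT.
by rewrite geq_max => /andP.
Qed.

Lemma natz_coord (N : nat) (X : int) : (absz X < N)%N ->
  exists x : nat, [/\ (0 < x)%N, (x < 2 * N)%N & X = x%:Z - N%:Z].
Proof. by move=> h; exists (absz (X + N%:Z)); split; lia. Qed.

Lemma int_rect_finite (X1 X2 Y1 Y2 : int) : finite_set (int_rect X1 X2 Y1 Y2).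
Proof.
pose N := (absz X1 + absz X2 + absz Y1 + absz Y2).+1.
apply: (@sub_finite_set _ _ [set` box_seq (2 * N) N]); last exact: finite_seq.
move=> [u v] [/= h1 h2].
have [a [_ aN ->]] : exists x : nat, [/\ (0 < x)%N, (x < 2 * N)%N & u = x%:Z - N%:Z].
  by apply: natz_coord; rewrite /N; lia.
have [b [_ bN ->]] : exists x : nat, [/\ (0 < x)%N, (x < 2 * N)%N & v = x%:Z - N%:Z].
  by apply: natz_coord; rewrite /N; lia.
exact: box_pt_mem.
Qed.

Definition lattice_of (N : nat) (a : nat -> nat -> bool) : set (int * int) :=
  [set z | exists i j, a i j /\ z = box_pt N i j].

Lemma lattice_of_box N a i j : `[< lattice_of N a (box_pt N i j) >] = a i j.
Proof.
apply/asboolP/idP => [[i' [j' [aij /box_pt_inj[-> ->]]]]//|aij].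
by exists i, j.
Qed.

Lemma lattice_of_rect N x1 x2 y1 y2 : lattice_of N (inrect x1 x2 y1 y2) =
  int_rect (x1%:Z - N%:Z) (x2%:Z - N%:Z) (y1%:Z - N%:Z) (y2%:Z - N%:Z).
Proof.
apply/seteqP; split => [_ [i [j [+ ->]]]|z Jz]; first by move=> /int_rect_box.
exists (absz (z.1 + N%:Z)), (absz (z.2 + N%:Z)).
have zE : z = box_pt N (absz (z.1 + N%:Z)) (absz (z.2 + N%:Z)).
  by move: Jz => [/= h1 h2]; case: z h1 h2 => u v /= h1 h2; congr pair; lia.
by split=> //; apply/(int_rect_box N); rewrite -zE.
Qed.

Lemma lattice_of_boxed M N a : in_box M a -> boxed M N (lattice_of N a).
Proof. by move=> aM _ [i [j [/aM/andP[iM jM] ->]]]; exists i, j. Qed.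

Section field.
Variables (eps C gamma : R) (c : R * R -> R).
Hypotheses (eps_gt0 : 0 < eps) (cC : forall xi, dual_lattice xi -> `|c xi| <= C) (eC : eps * C <= 1).
Hypothesis gamma_gt0 : 0 < gamma.

Let wh N i j := 1 + eps * c (hedge (box_pt N i j)).
Let wv N i j := 1 + eps * c (vedge (box_pt N i j)).
Let rect_dist N x1 x2 y1 y2 i j :=
  fine (cell_dist eps (int_rect (x1%:Z - N%:Z) (x2%:Z - N%:Z) (y1%:Z - N%:Z) (y2%:Z - N%:Z)) (box_pt N i j)) / eps.

(** The perimeter is nonnegative, so the penalty is finite, and by [integral_cells_finite] only
    finitely many cells are changed. *)
Lemma finite_energy_finite J I : finite_set J ->
  (energy c gamma eps (cells eps I) (cells eps J) < +oo)%E -> finite_set I.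
Proof.
move=> Jfin; rewrite /energy => h.
have p0 := perimeter_ge0 eps_gt0 cC eC (cells eps I).
have i0 : (0 <= \int[mu2]_(x in cells eps I `+` cells eps J) dist_inf eps (cells eps J) x)%E.
  by apply: integral_ge0 => x _; exact: dist_inf_ge0.
have g0 : 0 < (gamma * eps)^-1 by rewrite invr_gt0 mulr_gt0.
have : finite_set ((I `\` J) `|` (J `\` I)).
  apply: (@integral_cells_finite _ eps J) => //.
  rewrite ltey; apply/eqP => ioo; move: h.
  rewrite (_ : cells eps ((I `\` J) `|` (J `\` I)) = cells eps I `+` cells eps J) // in ioo.
  by rewrite ioo gt0_muley ?lte_fin// addey ?ltxx// gt_eqF// (lt_le_trans _ p0)// ltNyr.
move=> h2; apply: (@sub_finite_set _ _ (((I `\` J) `|` (J `\` I)) `|` J)); last by rewrite finite_setU.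
by move=> z Iz; have [Jz|nJz] := pselect (J z); [right|left; left].
Qed.

(** The old rectangle is a competitor of finite energy, so the minimizer has finitely many cells;
    only then can a box containing both be chosen. *)
Lemma minimizer_box (X1 X2 Y1 Y2 : int) A : X1 < X2 -> Y1 < Y2 ->
  minimizer c gamma eps (cells eps (int_rect X1 X2 Y1 Y2)) A ->
  exists (N x1 x2 y1 y2 : nat) a,
    [/\ X1 = x1%:Z - N%:Z, X2 = x2%:Z - N%:Z, Y1 = y1%:Z - N%:Z & Y2 = y2%:Z - N%:Z] /\
    [/\ (0 < x1)%N, (x2 <= 2 * N)%N, (0 < y1)%N & (y2 <= 2 * N)%N] /\
    [/\ in_box (2 * N) a, A = cells eps (lattice_of N a) &
        forall b, in_box (2 * N) b ->
        box_energy (2 * N) (wh N) (wv N) (eps / gamma) (rect_dist N x1 x2 y1 y2) (inrect x1 x2 y1 y2) a <=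
        box_energy (2 * N) (wh N) (wv N) (eps / gamma) (rect_dist N x1 x2 y1 y2) (inrect x1 x2 y1 y2) b].
Proof.
move=> X12 Y12 [lA Amin].
have [I AE] := (lattice_setsE A eps_gt0).1 lA; subst A.
set J := int_rect X1 X2 Y1 Y2.
pose N0 := (absz X1 + absz X2 + absz Y1 + absz Y2).+1.
have coords N : (N0 <= N)%N -> exists x1 x2 y1 y2 : nat,
    [/\ X1 = x1%:Z - N%:Z, X2 = x2%:Z - N%:Z, Y1 = y1%:Z - N%:Z & Y2 = y2%:Z - N%:Z] /\
    [/\ (0 < x1)%N, (x1 < x2)%N, (x2 <= 2 * N)%N & [/\ (0 < y1)%N, (y1 < y2)%N & (y2 <= 2 * N)%N]].
  rewrite /N0 => hN.
  have [x1 [x1g x1N x1E]] : exists x : nat, [/\ (0 < x)%N, (x < 2 * N)%N & X1 = x%:Z - N%:Z].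
    by apply: natz_coord; move: hN; clear; lia.
  have [x2 [x2g x2N x2E]] : exists x : nat, [/\ (0 < x)%N, (x < 2 * N)%N & X2 = x%:Z - N%:Z].
    by apply: natz_coord; move: hN; clear; lia.
  have [y1 [y1g y1N y1E]] : exists x : nat, [/\ (0 < x)%N, (x < 2 * N)%N & Y1 = x%:Z - N%:Z].
    by apply: natz_coord; move: hN; clear; lia.
  have [y2 [y2g y2N y2E]] : exists x : nat, [/\ (0 < x)%N, (x < 2 * N)%N & Y2 = x%:Z - N%:Z].
    by apply: natz_coord; move: hN; clear; lia.
  exists x1, x2, y1, y2; split=> //; split=> //.
  - by move: X12; rewrite x1E x2E; clear; lia.
  - exact: ltnW.
  - by split=> //; [move: Y12; rewrite y1E y2E; clear; lia|exact: ltnW].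
have energyE N x1 x2 y1 y2 a :
    [/\ X1 = x1%:Z - N%:Z, X2 = x2%:Z - N%:Z, Y1 = y1%:Z - N%:Z & Y2 = y2%:Z - N%:Z] ->
    [/\ (0 < x1)%N, (x1 < x2)%N, (x2 <= 2 * N)%N & [/\ (0 < y1)%N, (y1 < y2)%N & (y2 <= 2 * N)%N]] ->
    in_box (2 * N) a ->
    energy c gamma eps (cells eps (lattice_of N a)) (cells eps J) =
    (eps * box_energy (2 * N) (wh N) (wv N) (eps / gamma) (rect_dist N x1 x2 y1 y2) (inrect x1 x2 y1 y2) a)%:E.
  move=> [e1 e2 e3 e4] [h1 h2 h3 [h4 h5 h6]] aM.
  have := energy_box eps_gt0 cC eC gamma_gt0 (@lattice_of_boxed (2 * N) N a aM) h1 h2 h3 h4 h5 h6.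
  rewrite /J e1 e2 e3 e4 => -> /=; congr (eps * box_energy _ _ _ _ _ _ _)%:E.
  by apply/funext => i; apply/funext => j; exact: lattice_of_box.
have Ifin : finite_set I.
  apply: (@finite_energy_finite J); first exact: int_rect_finite.
  apply: le_lt_trans (Amin _ ((lattice_setsE _ eps_gt0).2 (ex_intro _ J erefl))) _.
  have [x1 [x2 [y1 [y2 [E [h1 h2 h3 [h4 h5 h6]]]]]]] := coords N0 (leqnn _).
  have RM : in_box (2 * N0) (inrect x1 x2 y1 y2).
    by move=> i j; move: h1 h3 h4 h6; rewrite /inrect; clear; lia.
  have JE : J = lattice_of N0 (inrect x1 x2 y1 y2).
    by rewrite lattice_of_rect /J; case: E => -> -> -> ->.
  by rewrite {1}JE (energyE _ _ _ _ _ _ E)// ltry.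
have [K IK] := finite_lattice_bounded Ifin.
pose N := (N0 + K).+1.
have [x1 [x2 [y1 [y2 [E [h1 h2 h3 [h4 h5 h6]]]]]]] : exists x1 x2 y1 y2 : nat,
    [/\ X1 = x1%:Z - N%:Z, X2 = x2%:Z - N%:Z, Y1 = y1%:Z - N%:Z & Y2 = y2%:Z - N%:Z] /\
    [/\ (0 < x1)%N, (x1 < x2)%N, (x2 <= 2 * N)%N & [/\ (0 < y1)%N, (y1 < y2)%N & (y2 <= 2 * N)%N]].
  by apply: coords; rewrite /N leqW// leq_addr.
pose a i j := `[< I (box_pt N i j) >].
have aM : in_box (2 * N) a.
  move=> i j /asboolP /IK[]; rewrite /box_pt/= /N; clear; lia.
have IE : I = lattice_of N a.
  apply/seteqP; split => [z Iz|_ [i [j [/asboolP + ->]]]//].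
  have [i [_ _ z1]] : exists x : nat, [/\ (0 < x)%N, (x < 2 * N)%N & z.1 = x%:Z - N%:Z].
    by apply: natz_coord; have [] := IK _ Iz; rewrite /N; clear; lia.
  have [j [_ _ z2]] : exists x : nat, [/\ (0 < x)%N, (x < 2 * N)%N & z.2 = x%:Z - N%:Z].
    by apply: natz_coord; have [] := IK _ Iz; rewrite /N; clear; lia.
  have zE : z = box_pt N i j by case: z z1 z2 {Iz} => u v /= -> ->.
  by exists i, j; split=> //; apply/asboolP; rewrite -zE.
exists N, x1, x2, y1, y2, a; split=> //; split=> //; split=> //; first by rewrite -IE.
move=> b bM.
have := Amin _ ((lattice_setsE _ eps_gt0).2 (ex_intro _ (lattice_of N b) erefl)).
by rewrite IE !(energyE _ _ _ _ _ _ E)// lee_fin ler_pM2l.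
Qed.

End field.

(** One inequality suffices, since [x] and [x'] may be exchanged. *)
Definition line_sums_close (e : int -> int -> R * R) (c : R * R -> R) (B theta : R) : Prop :=
  forall (x x' k0 : int) (l : nat), `|x|%:~R <= B -> `|x'|%:~R <= B ->
    - B <= k0%:~R -> (k0 + l%:Z)%:~R <= B ->
    \sum_(0 <= i < l) c (e x (k0 + i%:Z)) <= \sum_(0 <= i < l) c (e x' (k0 + i%:Z)) + theta.

Lemma weight_sums_close e c B theta eps (N x x' y1 y2 : nat) : 0 < eps ->
  line_sums_close e c B theta -> (y1 <= y2)%N ->
  `|x%:Z - N%:Z|%:~R <= B -> `|x'%:Z - N%:Z|%:~R <= B ->
  - B <= (y1%:Z - N%:Z)%:~R -> (y2%:Z - N%:Z)%:~R <= B ->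
  \sum_(y1 <= j < y2) (1 + eps * c (e (x%:Z - N%:Z) (j%:Z - N%:Z))) <=
  \sum_(y1 <= j < y2) (1 + eps * c (e (x'%:Z - N%:Z) (j%:Z - N%:Z))) + eps * theta.
Proof.
move=> e0 close y12 xB x'B y1B y2B.
have := close (x%:Z - N%:Z) (x'%:Z - N%:Z) (y1%:Z - N%:Z) (y2 - y1)%N xB x'B y1B.
have -> : y1%:Z - N%:Z + (y2 - y1)%N%:Z = y2%:Z - N%:Z by move: y12; clear; lia.
move=> /(_ y2B) h.
have sumE (u : nat) : \sum_(y1 <= j < y2) (1 + eps * c (e (u%:Z - N%:Z) (j%:Z - N%:Z))) =
    (y2 - y1)%:R + eps * \sum_(0 <= i < y2 - y1) c (e (u%:Z - N%:Z) (y1%:Z - N%:Z + i%:Z)).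
  rewrite big_split/= sumr_const_nat -mulr_sumr; congr (_ + eps * _).
  rewrite -{1}[y1]add0n big_addn; apply: eq_bigr => i _; congr (c (e _ _)).
  by clear; lia.
by rewrite !sumE -addrA -mulrDr lerD2l ler_pM2l.
Qed.

End lattice_step.

(** * One step of the scheme for small [eps] *)

Section one_step.
Context {R : realType}.
Implicit Types (eps gamma theta eta delta : R) (q : side -> int) (p : side -> R).

(** [q Right] and [q Top] are the first indices outside the rectangle, so all four sides lie half a
    cell before the centre with index [q s]. *)
Definition side_pos eps q : side -> R := fun s => eps * ((q s)%:~R - 2^-1).

Definition rect_cells eps q : set (R * R) :=
  cells eps (int_rect (q Left) (q Right) (q Bottom) (q Top)).

(** Length of the side [s] in terms of positions; [side_lengthE] identifies it with the Hausdorff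
    measure. *)
Definition extent p (s : side) : R :=
  match s with Left | Right => p Top - p Bottom | Bottom | Top => p Right - p Left end.

Definition step_bounds gamma eta eps p p' : Prop := forall s, exists n : nat,
  [/\ inward s (p' s) - inward s (p s) = eps * n%:R,
      2 * gamma / extent p s - 1 - eta <= n%:R &
      n%:R <= 2 * gamma / extent p s + eta].

Lemma small_enough (s : seq (R * R)) : all (fun ab => 0 < ab.2) s ->
  exists2 e0, 0 < e0 & forall e : R, 0 < e -> e < e0 -> all (fun ab => e * ab.1 < ab.2) s.
Proof.
elim: s => [|[a b] s IH]/=; first by exists 1.
move=> /andP[b0 /IH[e1 e10 H]].
have a1 : 0 < `|a| + 1 by rewrite ltr_wpDl.
exists (Num.min e1 (b / (`|a| + 1))); first by rewrite lt_min e10 divr_gt0.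
move=> e e0; rewrite lt_min ltr_pdivlMr// => /andP[/(H _ e0) -> h]; rewrite andbT.
apply: le_lt_trans h; rewrite ler_pM2l//; have := ler_norm a; lra.
Qed.

(** [Y] is a length in cells and [n] the number of cells crossed. Multiplied by [gamma], the last
    two hypotheses place [n * L] between [2 * gamma - L] and [2 * gamma] up to errors, which the
    smallness conditions bound by fractions of [eta * delta]. *)
Lemma step_arith gamma delta eta theta eps (C Y D n L : R) :
  0 < gamma -> 0 < delta -> 0 < eps -> 0 <= C -> 0 <= D -> 0 <= n -> theta <= 1 ->
  eps * C <= 2^-1 -> gamma * theta <= eta * delta / 4 -> eps * (2 * C * gamma) <= eta * delta / 4 ->
  eps * (4 * D) <= delta -> eps * (16 * D * gamma) <= eta * delta ^+ 2 / 2 ->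
  L = eps * Y -> delta <= L ->
  2 * (1 - eps * C) - theta <= eps / gamma * (n + 1) * Y ->
  eps / gamma * n * (Y - 2 * D) <= 2 * (1 + eps * C) + theta ->
  2 * gamma / L - 1 - eta <= n /\ n <= 2 * gamma / L + eta.
Proof.
move=> g0 d0 e0 C0 D0 n0 t1 eC gt eCg eD eDg LE dL lo up.
have L0 : 0 < L by exact: lt_le_trans dL.
have lo' : (2 * (1 - eps * C) - theta) * gamma <= n * L + L.
  rewrite -ler_pdivlMr//; apply: le_trans lo _; rewrite LE.
  by rewrite le_eqVlt; apply/orP; left; apply/eqP; field; rewrite gt_eqF.
have up' : n * (L - 2 * D * eps) <= (2 * (1 + eps * C) + theta) * gamma.
  rewrite -ler_pdivrMr//; apply: le_trans up; rewrite LE.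
  by rewrite le_eqVlt; apply/orP; left; apply/eqP; field; rewrite gt_eqF.
have eta_delta : 0 <= eta * delta.
  have : 0 <= eps * (2 * C * gamma) by rewrite !mulr_ge0// ltW.
  lra.
have eta0 : delta * eta <= L * eta by rewrite ler_wpM2r// -(pmulr_lge0 _ d0).
(* A crude bound on [n], needed to absorb the loss [n * (2 * D * eps)] caused by the shortened
   column. *)
have nd : n * delta <= 8 * gamma.
  have : n * (delta / 2) <= n * (L - 2 * D * eps) by rewrite ler_wpM2l//; lra.
  have : (2 * (1 + eps * C) + theta) * gamma <= 4 * gamma by rewrite ler_pM2r//; lra.
  lra.
have nD : n * (2 * D * eps) <= eta * delta / 2.
  rewrite -(ler_pM2r d0).
  have -> : n * (2 * D * eps) * delta = (n * delta) * (2 * D * eps) by ring.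
  apply: (@le_trans _ _ (8 * gamma * (2 * D * eps))).
    by rewrite ler_wpM2r// !mulr_ge0// ltW.
  by move: eDg; rewrite expr2; lra.
have up2 : n * L <= 2 * gamma + eta * delta by lra.
split.
  by rewrite lerBlDr lerBlDr ler_pdivrMr//; lra.
by rewrite -lerBlDr ler_pdivlMr//; lra.
Qed.

Theorem minimizer_step gamma (C : R) delta (Lam : R) eta theta : 0 < gamma -> 0 <= C -> 4 * C * gamma < 1 ->
  0 < delta -> 0 < Lam -> 0 < theta -> theta <= 1 -> gamma * theta <= eta * delta / 4 ->
  exists2 eps0, 0 < eps0 & forall eps c q A, 0 < eps -> eps < eps0 ->
    (forall xi, dual_lattice xi -> `|c xi| <= C) ->
    line_sums_close (fun x y => hedge (x, y)) c ((Lam + 1) / eps) (theta / eps) ->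
    line_sums_close (fun x y => vedge (y, x)) c ((Lam + 1) / eps) (theta / eps) ->
    (forall s, `|side_pos eps q s| <= Lam) ->
    (forall s, delta <= extent (side_pos eps q) s) ->
    minimizer c gamma eps (rect_cells eps q) A ->
    exists2 q', A = rect_cells eps q' & step_bounds gamma eta eps (side_pos eps q) (side_pos eps q').
Proof.
move=> g0 C0 Cg d0 Lam0 t0 t1 gt.
have eta0 : 0 < eta * delta.
  by have := mulr_gt0 g0 t0; lra.
have lam0 : 0 < delta / gamma by rewrite divr_gt0.
(* [k] times a number of cells is a length divided by [gamma], so [delta / gamma] and
   [4 * Lam / gamma] are bounds free of [eps], and [D0] and [D] can be fixed before [eps]. *)
pose D0 := (Num.bound (8 * gamma / delta)).+1.
pose D := (D0 + Num.bound ((4 * Lam / gamma + 2 + (8 * D0)%:R) * 4 / (delta / gamma))).+1.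
have D0P : 8 <= delta / gamma * D0%:R.
  rewrite mulrC -ler_pdivrMr// invf_div mulrA ltW//.
  apply: lt_le_trans (archi_boundP _) _; first by rewrite !mulr_ge0 ?invr_ge0// ltW.
  by rewrite ler_nat /D0 leqW.
have DP : 4 * Lam / gamma + 2 + (8 * D0)%:R < delta / gamma * D%:R / 4.
  rewrite ltr_pdivlMr// [ltRHS]mulrC -ltr_pdivrMr//.
  apply: lt_le_trans (archi_boundP _) _; last by rewrite ler_nat /D leqW// leq_addl.
  rewrite divr_ge0 ?(ltW lam0)// mulr_ge0// addr_ge0 ?ler0n// addr_ge0//.
  by rewrite divr_ge0 ?(ltW g0)// mulr_ge0// ltW.
have eta2 : 0 < eta * delta ^+ 2 / 2 by rewrite expr2 mulrA divr_gt0// mulr_gt0.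
(* [eps * (D * D) < gamma] makes cutting profitable, [eps * (4 * D) < delta] makes the rectangle
   wide enough, and [eps < 1 / 2] keeps the edges next to it inside the window of size [Lam + 1].
   The other conditions serve [step_arith]. *)
have [eps0 eps00 H] := @small_enough [:: (C, 2^-1); (1, 2^-1); (4 * D%:R, delta); ((D * D)%:R, gamma);
  (2 * C * gamma, eta * delta / 4); (16 * D%:R * gamma, eta * delta ^+ 2 / 2)]
  ltac:(by rewrite /= g0 d0 eta2 invr_gt0 ltr0n divr_gt0).
exists eps0 => // eps c q A e0 /(H _ e0) /= /andP[eC /andP[e1 /andP[e4D /andP[eDD /andP[eCg /andP[eDg _]]]]]].
move=> cC close_h close_v qLam qdelta qA {H eps0 eps00}.
have eC1 : eps * C <= 1 by lra.
have qX : delta <= eps * ((q Right)%:~R - (q Left)%:~R).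
  by have := qdelta Bottom; rewrite /extent /side_pos; lra.
have qY : delta <= eps * ((q Top)%:~R - (q Bottom)%:~R).
  by have := qdelta Left; rewrite /extent /side_pos; lra.
have qX' : q Left < q Right.
  by rewrite -(ltr_int R) -subr_gt0 -(pmulr_rgt0 _ e0) (lt_le_trans d0).
have qY' : q Bottom < q Top.
  by rewrite -(ltr_int R) -subr_gt0 -(pmulr_rgt0 _ e0) (lt_le_trans d0).
have [N [X1 [X2 [Y1 [Y2 [a [[XE1 XE2 YE1 YE2] [[X10 X2M Y10 Y2M] [aM AE amin]]]]]]]]] :=
  minimizer_box e0 cC eC1 g0 qX' qY' qA.
have X12 : (X1 < X2)%N by move: qX'; rewrite XE1 XE2; clear; lia.
have Y12 : (Y1 < Y2)%N by move: qY'; rewrite YE1 YE2; clear; lia.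
have XR : (q Right)%:~R - (q Left)%:~R = (X2 - X1)%:R :> R.
  by rewrite XE1 XE2 natrB ?(ltnW X12)// !intrD !intrN; ring.
have YR : (q Top)%:~R - (q Bottom)%:~R = (Y2 - Y1)%:R :> R.
  by rewrite YE1 YE2 natrB ?(ltnW Y12)// !intrD !intrN; ring.
rewrite XR in qX; rewrite YR in qY.
have qB s : `|eps * (q s)%:~R| <= Lam + eps / 2.
  have := qLam s; rewrite /side_pos mulrBr => h.
  have -> : eps * (q s)%:~R = eps * (q s)%:~R - eps * 2^-1 + eps / 2 by ring.
  by apply: le_trans (ler_normD _ _) _; rewrite lerD// gtr0_norm ?divr_gt0.
have D_ge0 : 0 <= D%:R :> R by exact: ler0n.
pose wh i j := 1 + eps * c (hedge (box_pt N i j)).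
pose wv i j := 1 + eps * c (vedge (box_pt N i j)).
have wC xi : dual_lattice xi -> 1 - eps * C <= 1 + eps * c xi /\ 1 + eps * c xi <= 1 + eps * C.
  move=> /cC; rewrite ler_norml => /andP[h1 h2].
  have : eps * (- C) <= eps * c xi by rewrite ler_pM2l.
  have : eps * c xi <= eps * C by rewrite ler_pM2l.
  rewrite mulrN; lra.
have e_neq0 := lt0r_neq0 e0; have g_neq0 := lt0r_neq0 g0.
have LR : large_rectangle (2 * N) X1 X2 Y1 Y2 D D0 wh wv
    (fun i j => fine (cell_dist eps (int_rect (X1%:Z - N%:Z) (X2%:Z - N%:Z) (Y1%:Z - N%:Z) (Y2%:Z - N%:Z))
       (box_pt N i j)) / eps) (eps / gamma) (1 - eps * C) (1 + eps * C) (delta / gamma) (4 * Lam / gamma).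
  have four (u : nat) : delta <= eps * u%:R -> (4 * D <= u)%N.
    move=> h; rewrite -(ler_nat R) -(ler_pM2l e0) natrM.
    by apply: le_trans h; exact: ltW.
  split=> //.
  - exact: four.
  - exact: four.
  - by rewrite /D leqW// leq_addr.
  - by lra.
  - by rewrite gerBl mulr_ge0// ltW.
  - by move=> i j; have [] := wC _ (hedge_dual (box_pt N i j)).
  - by move=> i j; have [] := wC _ (hedge_dual (box_pt N i j)).
  - by move=> i j; have [] := wC _ (vedge_dual (box_pt N i j)).
  - by move=> i j; have [] := wC _ (vedge_dual (box_pt N i j)).
  - move=> i j; rewrite ler_pdivlMr// mul1r -lee_fin fineK; first exact: cell_dist_ge.
    exact: cell_dist_rect_fin.
  - by move=> i j ij; rewrite cell_dist_rect//= mulrC mulKf.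
  (* Here [4 * C * gamma < 1] enters: it is the condition that a changed cell outweighs two
     exchanged edges. *)
  - have -> : 2 * (1 + eps * C - (1 - eps * C)) = eps * (4 * C * gamma) / gamma by field.
    by rewrite ltr_pdivlMr// divfK// -[ltRHS]mulr1 ltr_pM2l.
  - by rewrite mulrAC ler_pdivrMr// divfK.
  - by rewrite mulrAC ler_pdivrMr// divfK.
  - rewrite mulrAC ler_pdivrMr// divfK// natrD -XR -YR.
    have := qLam Left; have := qLam Right; have := qLam Bottom; have := qLam Top.
    rewrite !ler_norml /side_pos => /andP[h1 h2] /andP[h3 h4] /andP[h5 h6] /andP[h7 h8].
    lra.
  - have := eDD; rewrite -ltr_pdivlMl// => h.
    have : eps / gamma * (D * D)%:R < 1 by rewrite mulrAC ltr_pdivrMr// mul1r.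
    lra.
have [x1 [x2 [y1 [y2 [x1X x2X y1Y y2Y aE]]]]] := minimizer_is_rect LR aM amin.
subst a.
have bnd (n : nat) (z1 z2 : int) : (exists s1, z1 = q s1) -> (exists s2, z2 = q s2) ->
    z1 <= n.+1%:Z - N%:Z -> n%:Z - N%:Z < z2 -> `|n%:Z - N%:Z|%:~R <= (Lam + 1) / eps.
  move=> [s1 ->] [s2 ->] h1 h2; rewrite ler_pdivlMr// intr_norm -[X in _ * X](gtr0_norm e0) -normrM ler_norml.
  have := qB s1; have := qB s2; rewrite !ler_norml => /andP[_ h3] /andP[h4 _].
  have h5 : eps * (q s1)%:~R <= eps * (n%:Z - N%:Z + 1)%:~R.
    by rewrite ler_pM2l// ler_int; move: h1; clear; lia.
  have h6 : eps * (n%:Z - N%:Z)%:~R <= eps * (q s2)%:~R.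
    by rewrite ler_pM2l// ler_int ltW.
  move: h5 h6; rewrite intrD mulrDr mulr1 => h5 h6.
  by rewrite ![_ * eps]mulrC; apply/andP; split; lra.
have bnd2 s : - ((Lam + 1) / eps) <= (q s)%:~R /\ (q s)%:~R <= (Lam + 1) / eps.
  have := qB s; rewrite ler_norml => /andP[h3 h4].
  by split; [rewrite -mulNr ler_pdivrMr//|rewrite ler_pdivlMr//]; lra.
have close_wh x x' v1 v2 :
    (X1 <= x.+1)%N -> (x < X2)%N -> (X1 <= x'.+1)%N -> (x' < X2)%N ->
    (Y1 <= v1)%N -> (v1 <= v2)%N -> (v2 <= Y2)%N ->
    \sum_(v1 <= j < v2) wh x j <= \sum_(v1 <= j < v2) wh x' j + theta.
  move=> h1 h2 h3 h4 h5 h6 h7.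
  have := @weight_sums_close _ _ c _ _ eps N x x' v1 v2 e0 close_h h6.
  rewrite [eps * _]mulrC divfK//; apply.
  - by apply: (bnd _ (q Left) (q Right)); [by exists Left|by exists Right|rewrite XE1; move: h1|rewrite XE2; move: h2]; clear; lia.
  - by apply: (bnd _ (q Left) (q Right)); [by exists Left|by exists Right|rewrite XE1; move: h3|rewrite XE2; move: h4]; clear; lia.
  - apply: le_trans (bnd2 Bottom).1 _; rewrite YE1 ler_int; move: h5; clear; lia.
  - apply: le_trans (bnd2 Top).2; rewrite YE2 ler_int; move: h7; clear; lia.
have close_wv x x' v1 v2 :
    (Y1 <= x.+1)%N -> (x < Y2)%N -> (Y1 <= x'.+1)%N -> (x' < Y2)%N ->
    (X1 <= v1)%N -> (v1 <= v2)%N -> (v2 <= X2)%N ->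
    \sum_(v1 <= j < v2) tr wv x j <= \sum_(v1 <= j < v2) tr wv x' j + theta.
  move=> h1 h2 h3 h4 h5 h6 h7.
  have := @weight_sums_close _ _ c _ _ eps N x x' v1 v2 e0 close_v h6.
  rewrite [eps * _]mulrC divfK//; apply.
  - by apply: (bnd _ (q Bottom) (q Top)); [by exists Bottom|by exists Top|rewrite YE1; move: h1|rewrite YE2; move: h2]; clear; lia.
  - by apply: (bnd _ (q Bottom) (q Top)); [by exists Bottom|by exists Top|rewrite YE1; move: h3|rewrite YE2; move: h4]; clear; lia.
  - apply: le_trans (bnd2 Left).1 _; rewrite XE1 ler_int; move: h5; clear; lia.
  - apply: le_trans (bnd2 Right).2; rewrite XE2 ler_int; move: h7; clear; lia.
have [sL1 sL2 sR1 sR2] := side_bounds LR close_wh x1X x2X y1Y y2Y amin.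
have amin' b : in_box (2 * N) b -> box_energy (2 * N) (tr wv) (tr wh) (eps / gamma) (tr
    (fun i j => fine (cell_dist eps (int_rect (X1%:Z - N%:Z) (X2%:Z - N%:Z) (Y1%:Z - N%:Z) (Y2%:Z - N%:Z))
       (box_pt N i j)) / eps)) (inrect Y1 Y2 X1 X2) (inrect y1 y2 x1 x2) <=
    box_energy (2 * N) (tr wv) (tr wh) (eps / gamma) (tr
    (fun i j => fine (cell_dist eps (int_rect (X1%:Z - N%:Z) (X2%:Z - N%:Z) (Y1%:Z - N%:Z) (Y2%:Z - N%:Z))
       (box_pt N i j)) / eps)) (inrect Y1 Y2 X1 X2) b.
  move=> bM; have := amin (tr b).
  rewrite -(box_energy_tr _ wh wv _ _ _ (inrect _ _ _ _)) -(box_energy_tr _ wh wv _ _ _ (tr b)) !inrect_tr.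
  by apply=> i j /bM; rewrite andbC.
have [sB1 sB2 sT1 sT2] := side_bounds (large_rectangle_tr LR) close_wv y1Y y2Y x1X x2X amin'.
pose q' s := match s with Left => x1%:Z - N%:Z | Right => x2%:Z - N%:Z
  | Bottom => y1%:Z - N%:Z | Top => y2%:Z - N%:Z end.
have DXY := (lr_DX LR, lr_DY LR).
have arith (u v n : nat) : (4 * D <= v - u)%N -> delta <= eps * (v - u)%:R ->
    2 * (1 - eps * C) - theta <= eps / gamma * n.+1%:R * (v - u)%:R ->
    eps / gamma * n%:R * (v - u - 2 * D)%:R <= 2 * (1 + eps * C) + theta ->
    2 * gamma / (eps * (v - u)%:R) - 1 - eta <= n%:R /\ n%:R <= 2 * gamma / (eps * (v - u)%:R) + eta.
  move=> h1 h2 h3 h4.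
  apply: (@step_arith gamma delta eta theta eps C (v - u)%:R D%:R n%:R) => //; try exact: ltW.
    by rewrite natr1.
  move: h4; rewrite natrB// ?natrM//; move: h1; clear; lia.
exists q'; first by rewrite AE lattice_of_rect.
have EX : extent (side_pos eps q) Bottom = eps * (X2 - X1)%:R by rewrite /extent /side_pos -XR; ring.
have EY : extent (side_pos eps q) Left = eps * (Y2 - Y1)%:R by rewrite /extent /side_pos -YR; ring.
have fin s (n : nat) : inward s (side_pos eps q' s) - inward s (side_pos eps q s) = eps * n%:R ->
    2 * gamma / extent (side_pos eps q) s - 1 - eta <= n%:R /\
    n%:R <= 2 * gamma / extent (side_pos eps q) s + eta ->
    exists n : nat, [/\ inward s (side_pos eps q' s) - inward s (side_pos eps q s) = eps * n%:R,
      2 * gamma / extent (side_pos eps q) s - 1 - eta <= n%:R &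
      n%:R <= 2 * gamma / extent (side_pos eps q) s + eta].
  by move=> h [h1 h2]; exists n.
case.
- apply: (fin _ (x1 - X1)%N).
    rewrite /inward /side_pos /q' XE1 natrB; last by move: x1X; clear; lia.
    by rewrite !intrD !intrN; ring.
  by rewrite EY; apply: arith => //; exact: DXY.2.
- apply: (fin _ (X2 - x2)%N).
    rewrite /inward /side_pos /q' XE2 natrB; last by move: x2X; clear; lia.
    by rewrite !intrD !intrN; ring.
  by rewrite [extent _ _]EY; apply: arith => //; exact: DXY.2.
- apply: (fin _ (y1 - Y1)%N).
    rewrite /inward /side_pos /q' YE1 natrB; last by move: y1Y; clear; lia.
    by rewrite !intrD !intrN; ring.
  by rewrite EX; apply: arith => //; exact: DXY.1.
- apply: (fin _ (Y2 - y2)%N).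
    rewrite /inward /side_pos /q' YE2 natrB; last by move: y2Y; clear; lia.
    by rewrite !intrD !intrN; ring.
  by rewrite [extent _ _]EX; apply: arith => //; exact: DXY.1.
Qed.

End one_step.

(** * Coordinate rectangles *)

Section geometry.
Context {R : realType}.
Implicit Types (eps r : R) (q : side -> int) (p : side -> R) (x y : R * R) (A S : set (R * R)).

Lemma dist2_fst x y : `|x.1 - y.1| <= dist2 x y.
Proof.
rewrite -sqrtr_sqr ler_wsqrtr// lerDl; exact: sqr_ge0.
Qed.

Lemma dist2_snd x y : `|x.2 - y.2| <= dist2 x y.
Proof.
rewrite -sqrtr_sqr ler_wsqrtr// lerDr; exact: sqr_ge0.
Qed.

Lemma dist2_le x y : dist2 x y <= `|x.1 - y.1| + `|x.2 - y.2|.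
Proof.
rewrite /dist2; set a := x.1 - y.1; set b := x.2 - y.2.
rewrite -[leRHS]ger0_norm ?addr_ge0// -sqrtr_sqr ler_wsqrtr//.
have : 0 <= `|a| * `|b| by rewrite mulr_ge0.
by move=> h; rewrite [leRHS]sqrrD !real_normK ?num_real// -mulr_natl; lra.
Qed.

Lemma rect_cellsE eps q : 0 < eps -> rect_cells eps q =
  `[side_pos eps q Left, side_pos eps q Right[ `*` `[side_pos eps q Bottom, side_pos eps q Top[.
Proof.
move=> e0; have aux (u : R) (m n : int) :
    (m <= Num.floor (u / eps + 2^-1) < n) = (eps * (m%:~R - 2^-1) <= u < eps * (n%:~R - 2^-1)).
  rewrite floor_ge_int floor_lt_int ![eps * _]mulrC -ler_pdivlMr// -ltr_pdivrMr//.
  by rewrite lerBlDr ltrBrDr.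
apply/seteqP; split => x; rewrite /rect_cells /cells/= /int_rect/= !in_itv/= /side_pos.
  by rewrite !aux.
by rewrite !aux.
Qed.

Lemma rect_cells_at eps q : 0 < eps -> q Left < q Right -> q Bottom < q Top ->
  rectangle_at (side_pos eps q) (rect_cells eps q).
Proof.
move=> e0 qX qY; split.
- by rewrite /side_pos ltr_pM2l// ltrD2r ltr_int.
- by rewrite /side_pos ltr_pM2l// ltrD2r ltr_int.
- rewrite rect_cellsE// => x [/=]; rewrite !in_itv/= => /andP[a b] /andP[c d].
  by rewrite (ltW a) (ltW c).
- rewrite rect_cellsE// => x [/=]; rewrite !in_itv/= => /andP[a b] /andP[c d].
  by rewrite a c !ltW.
Qed.

Lemma itvs_meet (a b c d : R) : a < b -> c < d -> a < d -> c < b ->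
  exists t, a <= t < b /\ c < t < d.
Proof.
move=> ab cd ad cb.
exists ((Num.max a c + Num.min b d) / 2).
have [h1|h1] := leP a c; have [h2|h2] := leP b d; split; lra.
Qed.

Lemma rectangle_lattice_set eps p A : 0 < eps -> lattice_sets eps A -> rectangle_at p A ->
  exists q, [/\ A = rect_cells eps q, q Left < q Right & q Bottom < q Top].
Proof.
move=> e0 /(lattice_setsE _ e0)[I ->] [pX pY pA Ap].
have cellP z : I z <-> [/\ p Left <= eps * z.1%:~R - eps / 2, eps * z.1%:~R + eps / 2 <= p Right,
    p Bottom <= eps * z.2%:~R - eps / 2 & eps * z.2%:~R + eps / 2 <= p Top].
  have inI (u v : R) : eps * z.1%:~R - eps / 2 <= u < eps * z.1%:~R + eps / 2 ->
      eps * z.2%:~R - eps / 2 <= v < eps * z.2%:~R + eps / 2 -> cells eps I (u, v) <-> I z.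
    by move=> hu hv; rewrite /cells/= (_ : cell_index eps (u, v) = z)//; apply/(cell_indexP _ _ e0).
  split=> [Iz|[h1 h2 h3 h4]].
    have sub (u v : R) : eps * z.1%:~R - eps / 2 <= u < eps * z.1%:~R + eps / 2 ->
        eps * z.2%:~R - eps / 2 <= v < eps * z.2%:~R + eps / 2 ->
        (p Left <= u <= p Right) && (p Bottom <= v <= p Top).
      move=> hu hv; have := Ap _ ((inI _ _ hu hv).2 Iz).
      by move=> [/=]; rewrite !in_itv/= => -> ->.
    have base : forall w : R, w - eps / 2 <= w - eps / 2 < w + eps / 2.
      by move=> w; apply/andP; split; lra.
    have /andP[/andP[h1 _] /andP[h3 _]] := sub _ _ (base _) (base _).
    split=> //.
      (* The cell is half-open, so its right end is only approached from inside. *)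
      apply/ler_addgt0Pl => k k0.
      have [hk|hk] := leP k eps.
        have /andP[/andP[_ +] _] := @sub (eps * z.1%:~R + eps / 2 - k) _ ltac:(apply/andP; split; lra) (base _).
        by move=> h; lra.
      by have /andP[/andP[_ h] _] := sub _ _ (base _) (base _); lra.
    apply/ler_addgt0Pl => k k0.
    have [hk|hk] := leP k eps.
      have /andP[_ /andP[_ +]] := @sub _ (eps * z.2%:~R + eps / 2 - k) (base _) ltac:(apply/andP; split; lra).
      by move=> h; lra.
    by have /andP[_ /andP[_ h]] := sub _ _ (base _) (base _); lra.
  have [u [hu hu']] : exists t, eps * z.1%:~R - eps / 2 <= t < eps * z.1%:~R + eps / 2 /\
      p Left < t < p Right by apply: itvs_meet; lra.
  have [v [hv hv']] : exists t, eps * z.2%:~R - eps / 2 <= t < eps * z.2%:~R + eps / 2 /\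
      p Bottom < t < p Top by apply: itvs_meet; lra.
  by apply/(inI _ _ hu hv)/pA; split; rewrite /= in_itv.
pose q s := match s with
  | Left => Num.ceil (p Left / eps + 2^-1) | Right => Num.floor (p Right / eps - 2^-1) + 1
  | Bottom => Num.ceil (p Bottom / eps + 2^-1) | Top => Num.floor (p Top / eps - 2^-1) + 1 end.
have lowE (u : R) (m : int) : (Num.ceil (u / eps + 2^-1) <= m) = (u <= eps * m%:~R - eps / 2).
  rewrite ceil_le_int -lerBrDr ler_pdivrMr// mulrBl [_ * eps]mulrC; congr (_ <= _ - _).
  by rewrite mulrC.
have upE (u : R) (m : int) : (m < Num.floor (u / eps - 2^-1) + 1) = (eps * m%:~R + eps / 2 <= u).
  rewrite ltzD1 floor_ge_int lerBrDr ler_pdivlMr// mulrDl [_ * eps]mulrC; congr (_ + _ <= _).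
  by rewrite mulrC.
have IE : I = int_rect (q Left) (q Right) (q Bottom) (q Top).
  apply/seteqP; split => z; rewrite /int_rect/= !lowE !upE.
    by move=> /cellP[-> -> -> ->].
  by move=> [/andP[h1 h2] /andP[h3 h4]]; apply/cellP.
exists q; rewrite /rect_cells -IE.
have [z Iz] : exists z, I z.
  exists (cell_index eps ((p Left + p Right) / 2, (p Bottom + p Top) / 2)).
  by apply: (pA (_, _)); split; rewrite /= in_itv/=; apply/andP; split; lra.
move: Iz; rewrite IE /int_rect => -[/andP[h1 h2] /andP[h3 h4]].
by split=> //; [exact: le_lt_trans h2|exact: le_lt_trans h4].
Qed.

(** Points of [A] arbitrarily near one of its sides have points of [A'] within [r], so the
    corresponding side of [A'] cannot lie more than [r] further in. *)
Lemma sides_within p p' A A' r : rectangle_at p A -> rectangle_at p' A' ->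
  (forall x, A x -> exists2 y, A' y & dist2 x y <= r) ->
  forall s, inward s (p' s) <= inward s (p s) + r.
Proof.
move=> [pX pY pA Ap] [pX' pY' pA' Ap'] near.
have key (u v : R) : p Left < u < p Right -> p Bottom < v < p Top ->
    [/\ p' Left <= u + r, u - r <= p' Right, p' Bottom <= v + r & v - r <= p' Top].
  move=> hu hv; have [|y A'y xy] := near (u, v); first by apply: pA; split; rewrite /= in_itv.
  have [/=] := Ap' _ A'y; rewrite !in_itv/= => /andP[a b] /andP[c d].
  have := le_trans (dist2_fst _ _) xy; have := le_trans (dist2_snd _ _) xy.
  by rewrite /= !ler_norml => /andP[e f] /andP[g h]; split; lra.
have mX : p Left < (p Left + p Right) / 2 < p Right by apply/andP; split; lra.
have mY : p Bottom < (p Bottom + p Top) / 2 < p Top by apply/andP; split; lra.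
have small (P : R -> Prop) (a b : R) : a < b -> (forall k, 0 < k -> k < b - a -> P k) ->
    forall k, 0 < k -> exists2 k', k' <= k & P k'.
  move=> ab h k k0; have [hk|hk] := ltP k (b - a); first by exists k => //; exact: h.
  by exists ((b - a) / 2); [lra|apply: h; lra].
case; rewrite /inward.
- apply/ler_addgt0Pl => k k0.
  have [k' kk' h] := @small (fun k => p' Left <= p Left + k + r) _ _ pX
    ltac:(by move=> l l0 l1; have [] := key (p Left + l) _ ltac:(apply/andP; split; lra) mY) k k0.
  lra.
- apply/ler_addgt0Pl => k k0.
  have [k' kk' h] := @small (fun k => p Right - k - r <= p' Right) _ _ pX
    ltac:(by move=> l l0 l1; have [] := key (p Right - l) _ ltac:(apply/andP; split; lra) mY) k k0.
  lra.
- apply/ler_addgt0Pl => k k0.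
  have [k' kk' h] := @small (fun k => p' Bottom <= p Bottom + k + r) _ _ pY
    ltac:(by move=> l l0 l1; have [] := key _ (p Bottom + l) mX ltac:(apply/andP; split; lra)) k k0.
  lra.
- apply/ler_addgt0Pl => k k0.
  have [k' kk' h] := @small (fun k => p Top - k - r <= p' Top) _ _ pY
    ltac:(by move=> l l0 l1; have [] := key _ (p Top - l) mX ltac:(apply/andP; split; lra)) k k0.
  lra.
Qed.

Lemma inward_dist s (a b : R) r : inward s a <= inward s b + r -> inward s b <= inward s a + r ->
  `|a - b| <= r.
Proof. by case: s => /= h1 h2; rewrite ler_norml; apply/andP; split; lra. Qed.

Lemma hausdorff_sides p p' A A' r : rectangle_at p A -> rectangle_at p' A' ->
  (hausdorff_dist A A' < r%:E)%E -> forall s, `|p s - p' s| <= r.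
Proof.
move=> Ap Ap' /ereal_inf_lt[_ [r' [r'0 [h1 h2]] <-]]; rewrite lte_fin => /ltW r'r s.
apply: le_trans r'r; apply: (@inward_dist s).
  apply: (sides_within Ap' Ap) => y /h2[x Ax xy]; exists x => //.
  by move: xy; rewrite /dist2 -[x.1 - _]opprB sqrrN -[x.2 - _]opprB sqrrN.
exact: (sides_within Ap Ap').
Qed.

(** One [r] covers the distance between the ends, the other a step into the open interval, which may
    itself be shorter than [r]. *)
Lemma clamp_itv (a b a' b' x r : R) : a' < b' -> a <= x <= b -> `|a - a'| <= r -> `|b - b'| <= r ->
  0 < r -> exists2 y, a' < y < b' & `|x - y| <= 2 * r.
Proof.
move=> ab' /andP[ax xb]; rewrite !ler_norml => /andP[h1 h2] /andP[h3 h4] r0.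
have [k [k0 kr kab]] : exists k : R, [/\ 0 < k, k <= r & a' + k < b' - k].
  exists (Num.min r ((b' - a') / 4)); split; first by rewrite lt_min r0 divr_gt0// subr_gt0.
    by rewrite ge_min lexx.
  have : Num.min r ((b' - a') / 4) <= (b' - a') / 4 by rewrite ge_min lexx orbT.
  lra.
have [hx|hx] := ltP x (a' + k).
  exists (a' + k); first by apply/andP; split; lra.
  by rewrite ler_norml; apply/andP; split; lra.
have [hx'|hx'] := ltP (b' - k) x.
  exists (b' - k); first by apply/andP; split; lra.
  by rewrite ler_norml; apply/andP; split; lra.
exists x; first by apply/andP; split; lra.
by rewrite subrr normr0; lra.
Qed.

Lemma sides_hausdorff p p' A A' r : rectangle_at p A -> rectangle_at p' A' -> 0 < r ->
  (forall s, `|p s - p' s| <= r) -> (hausdorff_dist A A' <= (4 * r)%:E)%E.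
Proof.
have half p1 p2 A1 A2 : rectangle_at p1 A1 -> rectangle_at p2 A2 -> 0 < r ->
    (forall s, `|p1 s - p2 s| <= r) -> forall x, A1 x -> exists2 y, A2 y & dist2 x y <= 4 * r.
  move=> [_ _ _ A1p] [pX pY pA2 _] r0 pr x /A1p[/=]; rewrite !in_itv/= => h1 h2.
  have [u hu xu] := clamp_itv pX h1 (pr Left) (pr Right) r0.
  have [v hv xv] := clamp_itv pY h2 (pr Bottom) (pr Top) r0.
  exists (u, v); first by apply: pA2; split; rewrite /= in_itv.
  by apply: le_trans (dist2_le _ _) _ => /=; lra.
move=> Ap Ap' r0 pr; apply: ereal_inf_lbound; exists (4 * r) => //=.
split; first by rewrite mulr_ge0// ltW.
split; first exact: (half p p').
move=> y A'y; have [|x Ax xy] := half p' p A' A Ap' Ap r0 _ y A'y.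
  by move=> s; rewrite distrC.
exists x => //.
by move: xy; rewrite /dist2 -[y.1 - _]opprB sqrrN -[y.2 - _]opprB sqrrN.
Qed.

Section segment.
Variables (emb : R -> R * R) (pr : R * R -> R) (b c : R).
Hypotheses (emb_dist : forall s t, dist2 (emb s) (emb t) = `|s - t|)
  (pr_lip : forall x y, pr x - pr y <= dist2 x y) (embK : cancel emb pr) (bc : b <= c).

(** Each covering set projects into an interval no longer than its diameter, and these intervals
    cover [[b, c]]; countable subadditivity of Lebesgue measure concludes. *)
Lemma hausdorff1_segment_ge (delta : R) : 0 < delta -> delta <= 1 ->
  ((c - b)%:E <= ereal_inf [set (\sum_(0 <= n <oo) diam (U n))%E |
      U in [set U : (set (R * R))^nat | emb @` `[b, c] `<=` \bigcup_n U n /\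
                                        forall n, (diam (U n) <= delta%:E)%E]])%E.
Proof.
move=> d0 d1; apply: le_ereal_inf_tmp => _ [U [cover Ud] <-].
have diam_ge0 n : (0 <= diam (U n))%E by apply: ereal_sup_ubound; left.
have diamE n : diam (U n) = (fine (diam (U n)))%:E.
  by rewrite fineK// ge0_fin_numE// (le_lt_trans (Ud n))// ltry.
pose V n := pr @` U n.
have Vdiam n u v : V n u -> V n v -> u - v <= fine (diam (U n)).
  move=> [x Ux <-] [y Uy <-]; apply: le_trans (pr_lip _ _) _.
  by rewrite -lee_fin -diamE; apply: ereal_sup_ubound; right; exists x => //; exists y.
have Vub n u : V n u -> has_ubound (V n).
  by move=> Vu; exists (u + fine (diam (U n))) => v Vv; have := Vdiam n _ _ Vv Vu; lra.
have Vlb n u : V n u -> has_lbound (V n).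
  by move=> Vu; exists (u - fine (diam (U n))) => v Vv; have := Vdiam n _ _ Vu Vv; lra.
(* An empty projection has no meaningful infimum and supremum and is treated apart. *)
pose F n : set R := if `[< V n !=set0 >] then `[inf (V n), sup (V n)]%classic else set0.
have muF n : (lebesgue_measure (F n) <= diam (U n))%E.
  rewrite /F; case: asboolP => [[u Vu]|_]; last by rewrite measure0.
  rewrite lebesgue_measure_itv/= lte_fin; case: ifP => // _.
  rewrite diamE -EFinB lee_fin.
  have h v : V n v -> v - fine (diam (U n)) <= inf (V n).
    by move=> Vv; apply: lb_le_inf; [exists u|move=> w Vw; have := Vdiam n _ _ Vv Vw; lra].
  rewrite lerBlDr; apply: ge_sup; first by exists u.
  by move=> v /h; lra.
have -> : (c - b)%:E = lebesgue_measure (`[b, c]%classic : set R).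
  rewrite lebesgue_measure_itv/= lte_fin; case: ltP => // cb.
  by rewrite (_ : c = b) ?subrr//; apply/eqP; rewrite eq_le cb.
apply: (@le_trans _ _ (\sum_(0 <= n <oo) lebesgue_measure (F n))%E).
  apply: (@measure_sigma_subadditive _ _ _ (@lebesgue_measure R)).
  - by move=> n; rewrite /F; case: asboolP => _; [exact: measurable_itv|exact: measurable0].
  - exact: measurable_itv.
  - move=> t tbc; have [n _ Un] := cover (emb t) (ex_intro2 _ _ t tbc erefl).
    have Vt : V n t by exists (emb t) => //; exact: embK.
    exists n => //; rewrite /F asboolT; last by exists t.
    by rewrite /= in_itv/= ge_inf ?ub_le_sup//; [exact: Vub Vt|exact: Vlb Vt].
by apply: lee_nneseries => // n _; exact: measure_ge0.
Qed.

Lemma hausdorff1_segment_le (delta : R) : 0 < delta ->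
  (ereal_inf [set (\sum_(0 <= n <oo) diam (U n))%E |
      U in [set U : (set (R * R))^nat | emb @` `[b, c] `<=` \bigcup_n U n /\
                                        forall n, (diam (U n) <= delta%:E)%E]] <= (c - b)%:E)%E.
Proof.
move=> d0; pose m := (Num.bound ((c - b) / delta)).+1.
pose h := (c - b) / m%:R.
have m0 : 0 < m%:R :> R by rewrite ltr0n.
have h0 : 0 <= h by rewrite divr_ge0 ?subr_ge0// ltW.
have hd : h <= delta.
  rewrite ler_pdivrMr// mulrC -ler_pdivrMr// ltW//.
  apply: lt_le_trans (archi_boundP _) _; first by rewrite divr_ge0 ?subr_ge0// ltW.
  by rewrite ler_nat /m.
pose U n := if (n < m)%N then emb @` `[b + n%:R * h, b + n.+1%:R * h] else set0.
have diamU n : (diam (U n) <= (if (n < m)%N then h else 0)%:E)%E.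
  rewrite /U; case: ifPn => nm; apply: ge_ereal_sup => _ [->|[x Ux [y Uy <-]]]; rewrite ?lee_fin//.
  move: Ux Uy => [s + <-] [t + <-]; rewrite /= !in_itv/= emb_dist -natr1 mulrDl mul1r.
  by move=> /andP[s1 s2] /andP[t1 t2]; rewrite ler_norml; apply/andP; split; lra.
apply: (@le_trans _ _ (\sum_(0 <= n <oo) diam (U n))%E).
  apply: ereal_inf_lbound; exists U => //; split; last first.
    by move=> n; apply: le_trans (diamU n) _; case: ifP; rewrite lee_fin// ltW.
  move=> _ [t + <-]; rewrite /= in_itv/= => /andP[bt tc].
  have [bc0|bc0] := eqVneq b c.
    exists 0%N => //; exists t => //; rewrite /= in_itv/= mul0r addr0 bt mul1r.
    by rewrite (le_trans tc)// -bc0 lerDl.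
  have hp : 0 < h by rewrite divr_gt0// subr_gt0 lt_neqAle bc0.
  pose n := Num.truncn ((t - b) / h).
  have tb : 0 <= (t - b) / h by rewrite divr_ge0// subr_ge0.
  have /andP[n1 n2] := truncn_itv tb.
  have [nm|mn] := ltnP n m.
    exists n => //; rewrite /U nm; exists t => //; rewrite /= in_itv/=.
    by move: n1 n2; rewrite ler_pdivlMr// ltr_pdivrMr// -/n => n1 n2; apply/andP; split; lra.
  (* Only [t = c] has an index beyond the last piece; it is covered by that piece. *)
  have mh : m%:R * h = c - b by rewrite mulrC divfK// gt_eqF.
  have tE : t = c.
    apply/eqP; rewrite eq_le tc/=.
    have : m%:R * h <= n%:R * h by rewrite ler_pM2r// ler_nat.
    by move: n1; rewrite ler_pdivlMr// -/n; lra.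
  exists m.-1 => //; rewrite /U leqnn; exists t => //; rewrite /= in_itv/=.
  have mE : m.-1.+1 = m by [].
  rewrite mE tE; have : m.-1%:R * h <= m%:R * h by rewrite ler_pM2r// ler_nat.
  lra.
have nng k : (0 <= diam (U k))%E by apply: ereal_sup_ubound; left.
rewrite (nneseries_split 0 m)// eseries0 ?adde0; last first.
  move=> i mi _; apply/eqP; rewrite eq_le nng andbT; apply: le_trans (diamU i) _.
  by rewrite ltnNge -[m]add0n mi.
rewrite add0n; apply: (@le_trans _ _ (\sum_(0 <= k < m) h%:E)%E).
  rewrite big_nat_cond [leRHS]big_nat_cond; apply: lee_sum => k /andP[/andP[_ km] _].
  by apply: le_trans (diamU k) _; rewrite km.
by rewrite sumEFin sumr_const_nat subn0 -mulr_natl mulrC divfK// gt_eqF.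
Qed.

Lemma hausdorff1_segment : hausdorff1 (emb @` `[b, c]) = (c - b)%:E.
Proof.
apply/eqP; rewrite eq_le; apply/andP; split.
  by apply: ge_ereal_sup => _ [delta d0 <-]; exact: hausdorff1_segment_le.
apply: le_trans (@hausdorff1_segment_ge 1 ltr01 (lexx _)) _.
by apply: ereal_sup_ubound; exists 1 => //; exact: ltr01.
Qed.

End segment.

Lemma side_lengthE p s : p Left <= p Right -> p Bottom <= p Top -> side_length p s = extent p s.
Proof.
move=> pX pY.
have vert (a b c : R) : b <= c -> hausdorff1 ([set a] `*` `[b, c]) = (c - b)%:E.
  move=> bc; rewrite (_ : [set a] `*` _ = (fun t => (a, t)) @` `[b, c]).
    apply: (@hausdorff1_segment _ snd) => //.
      by move=> s' t; rewrite /dist2/= subrr expr0n add0r sqrtr_sqr.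
    by move=> x y; apply: le_trans (dist2_snd _ _); exact: ler_norm.
  by apply/seteqP; split => [[u v] [/= -> vbc]|_ [t tbc <-]]//; exists v.
have hor (a b c : R) : b <= c -> hausdorff1 (`[b, c] `*` [set a]) = (c - b)%:E.
  move=> bc; rewrite (_ : _ `*` [set a] = (fun t => (t, a)) @` `[b, c]).
    apply: (@hausdorff1_segment _ fst) => //.
      by move=> s' t; rewrite /dist2/= subrr expr0n addr0 sqrtr_sqr.
    by move=> x y; apply: le_trans (dist2_fst _ _); exact: ler_norm.
  by apply/seteqP; split => [[u v] [/= vbc ->]|_ [t tbc <-]]//; exists u.
by rewrite /side_length; case: s; rewrite /= ?vert ?hor.
Qed.

End geometry.

(** * Limits of rectangle evolutions *)

Lemma derive_right_bounds {R : realType} (f : R -> R) (t v a b h0 : R) :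
  is_derive t 1 f v -> 0 < h0 ->
  (forall h, 0 < h -> h < h0 -> h * a <= f (t + h) - f t <= h * b) -> a <= v <= b.
Proof.
move=> [df dv] h00 H.
have c : h^-1 *: (f (h *: 1 + t) - f t) @[h --> 0^'+] --> v.
  by apply: cvg_dnbhs_at_right; rewrite -dv; exact: df.
have near0 : \forall h \near 0^'+, a <= h^-1 *: (f (h *: 1 + t) - f t) <= b.
  near=> h; have hp : 0 < h by near: h; exact: nbhs_right_gt.
  have hh : h < h0 by near: h; exact: nbhs_right_lt.
  have /andP[h1 h2] := H h hp hh.
  rewrite [h *: 1]mulr1 [h + t]addrC [_ *: _]mulrC ler_pdivlMr// ler_pdivrMr// ![_ * h]mulrC.
  by rewrite h1.
apply/andP; split.
  apply: (ler_cvg_to (cvg_cst a) c); by apply: filterS near0 => h /andP[].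
apply: (ler_cvg_to c (cvg_cst b)); by apply: filterS near0 => h /andP[].
Unshelve. all: by end_near. Qed.

Section ultralimit.
Context {R : realType} {T : Type} (U : set_system T) {UU : UltraFilter U}.

(** Compactness gives a cluster point, and along an ultrafilter, which contains each set or its
    complement, a cluster point is a limit. *)
Lemma ultra_bounded_cvg (f : T -> R) (M : R) :
  (\forall j \near U, `|f j| <= M) -> f @ U --> lim (f @ U).
Proof.
move=> fM; have PU := @ultra_proper _ _ UU.
suff [l fl] : exists l : R, f @ U --> l by apply/cvg_ex; exists l.
have fI : (f @ U) `[- M, M]%classic.
  by apply: filterS fM => j; rewrite /= in_itv/= ler_norml.
have [l [_ fl]] := @segment_compact R (- M) M (f @ U) (fmap_proper_filter f PU) fI.
exists l; apply/cvgrPdist_le => e e0.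
have [//|h] := in_ultra_setVsetC [set j | `|l - f j| <= e] UU.
have hf : (f @ U) (f @` ~` [set j | `|l - f j| <= e]) by apply: (@filterS _ U _ _ _ _ h) => j hj; exists j.
have lb : nbhs (l : R) (ball (l : R) e) by exact: nbhsx_ballx.
have [z [zh]] := fl _ _ hf lb.
by move: zh => [j hj <-]; rewrite /ball/= => /ltW /hj.
Qed.

End ultralimit.

Section evolution_limit.
Context {R : realType}.
(** [y j k s] stands for the position of side [s] after [k] steps of flow [j], and [r j k] for the
    flow being then a rectangle with these sides. The hypothesis [step] is conditional on a lower
    bound for the extents, which is lost near extinction. *)
Variables (gamma : R) (eps : nat -> R) (y : nat -> nat -> side -> R)
  (r : nat -> nat -> Prop) (p0 : side -> R).
Hypotheses (gamma_gt0 : 0 < gamma) (eps_gt0 : forall j, 0 < eps j) (eps0 : eps @ \oo --> 0).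
Hypothesis step : forall delta Lam eta : R, 0 < delta -> 0 < Lam -> 0 < eta ->
  exists2 e0 : R, 0 < e0 & forall j k, eps j < e0 -> r j k ->
    (forall s, `|y j k s| <= Lam) -> (forall s, delta <= extent (y j k) s) ->
    r j k.+1 /\ step_bounds gamma eta (eps j) (y j k) (y j k.+1).
Hypotheses (r_extent : forall j k, r j k -> forall s, 0 < extent (y j k) s)
  (r0 : forall j, r j 0) (y0 : forall s, y j 0 s @[j --> \oo] --> p0 s)
  (p0_extent : forall s, 0 < extent p0 s).
Variable U : set_system nat.
Context {UU : UltraFilter U}.
Hypothesis U_oo : \oo `<=` U.

Let PU : ProperFilter U := @ultra_proper _ _ UU.
#[local] Existing Instance PU.

Definition step_index j (t : R) : nat := Num.truncn (t / (gamma * eps j)).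

Let x j k s := inward s (y j k s).

Lemma side_all (Q : side -> Prop) : Q Left -> Q Right -> Q Bottom -> Q Top -> forall s, Q s.
Proof. by move=> ? ? ? ?; case. Qed.

Lemma near_sides (F : set_system nat) (FF : Filter F) (Q : side -> nat -> Prop) :
  (forall s, \forall j \near F, Q s j) -> \forall j \near F, forall s, Q s j.
Proof.
move=> h; move: (h Left) (h Right) (h Bottom) (h Top) => hL hR hB hT.
near=> j; apply: side_all; near: j => //.
Unshelve. all: by end_near. Qed.

Lemma extent_diff (p p' : side -> R) (a b : R) :
  (forall s, a <= inward s (p' s) - inward s (p s) <= b) ->
  forall s, extent p s - 2 * b <= extent p' s /\ extent p' s <= extent p s - 2 * a.
Proof.
move=> h; have /andP[hL1 hL2] := h Left; have /andP[hR1 hR2] := h Right.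
have /andP[hB1 hB2] := h Bottom; have /andP[hT1 hT2] := h Top.
by move=> s; move: hL1 hL2 hR1 hR2 hB1 hB2 hT1 hT2; case: s => /= *; split; lra.
Qed.

Lemma step_bounds_ge0 eta j k : step_bounds gamma eta (eps j) (y j k) (y j k.+1) ->
  forall s, x j k s <= x j k.+1 s.
Proof.
move=> h s; have [n [e _ _]] := h s.
by rewrite -subr_ge0 e mulr_ge0 ?ler0n// ltW.
Qed.

Let Lam : R := `|p0 Left| + `|p0 Right| + `|p0 Bottom| + `|p0 Top| + 1.

Let Lam_gt0 : 0 < Lam.
Proof. by rewrite ltr_wpDl// !addr_ge0. Qed.

Lemma initial_near : \forall j \near U, forall s, `|y j 0 s| <= Lam.
Proof.
apply: near_sides => s; apply: U_oo.
have /cvgrPdist_le/(_ 1 ltr01) := y0 (s := s); apply: filterS => j h.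
have : `|y j 0 s| <= `|p0 s| + 1.
  have -> : y j 0 s = p0 s - (p0 s - y j 0 s) by rewrite subKr.
  by apply: le_trans (ler_normB _ _) _; rewrite lerD2l.
move=> /le_trans; apply; rewrite lerD2r; case: s {h} => /=;
  have := normr_ge0 (p0 Left); have := normr_ge0 (p0 Right);
  have := normr_ge0 (p0 Bottom); have := normr_ge0 (p0 Top); lra.
Qed.

Lemma eps_near (e : R) : 0 < e -> \forall j \near U, eps j < e.
Proof.
move=> e0; apply: U_oo; have /cvgrPdist_lt/(_ e e0) := eps0.
by apply: filterS => j; rewrite sub0r normrN gtr0_norm.
Qed.

Definition steps_ok (eta : R) j K := forall k, (k <= K)%N ->
  [/\ r j k, forall s, `|y j k s| <= Lam & r j k.+1 /\
    step_bounds gamma eta (eps j) (y j k) (y j k.+1)].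

(** [K] comes after [j] because the number of steps up to a given time depends on [j]. The sides
    only move inwards and keep their order, so the initial bound [Lam] persists and [step] can be
    iterated. *)
Lemma good_steps (delta eta : R) : 0 < delta -> 0 < eta ->
  \forall j \near U, forall K, (forall k, (k <= K)%N -> forall s, delta <= extent (y j k) s) ->
    steps_ok eta j K.
Proof.
move=> d0 eta0; have [e0 e00 H] := step d0 Lam_gt0 eta0.
move: initial_near (eps_near e00); apply: filterS2 => j y0L ej K ext.
have ok k : (k <= K)%N -> r j k /\ forall s, `|y j k s| <= Lam.
  elim: k => [|k IH] kK; first by split.
  have [rk yk] := IH (ltnW kK).
  have [rk1 sk] := H _ _ ej rk yk (ext _ (ltnW kK)); split=> //.
  have m := step_bounds_ge0 sk; have e := r_extent rk1.
  have := m Left; have := m Right; have := m Bottom; have := m Top.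
  have := e Left; have := e Bottom; rewrite /extent /x /=.
  have := yk Left; have := yk Right; have := yk Bottom; have := yk Top.
  rewrite !ler_norml => /andP[a1 a2] /andP[a3 a4] /andP[a5 a6] /andP[a7 a8] ? ? ? ? ? ?.
  by case; rewrite ler_norml; apply/andP; split; lra.
move=> k kK; have [rk yk] := ok k kK; split=> //.
exact: H ej rk yk (ext _ kK).
Qed.

Lemma steps_sum j (a b : R) s k1 k2 : (k1 <= k2)%N ->
  (forall k, (k1 <= k < k2)%N -> exists n : nat,
    [/\ x j k.+1 s - x j k s = eps j * n%:R, a <= n%:R & n%:R <= b]) ->
  eps j * (k2 - k1)%:R * a <= x j k2 s - x j k1 s <= eps j * (k2 - k1)%:R * b.
Proof.
move=> + h; elim: k2 h => [|k2 IH] h k12.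
  have -> : k1 = 0%N by move: k12; clear; lia.
  by rewrite !subrr !mulr0 !mul0r lexx.
have [E|k1k2] := eqVneq k1 k2.+1; first by rewrite -E subnn !subrr !mulr0 !mul0r lexx.
have k12' : (k1 <= k2)%N by move: k12 k1k2; clear; lia.
have /andP[i1 i2] := IH (fun k hk => h k ltac:(move: hk; clear; lia)) k12'.
have [n [en an nb]] := h k2 ltac:(by rewrite k12' ltnSn).
rewrite subSn// -natr1 mulrDr mulr1 !mulrDl.
have : eps j * a <= eps j * n%:R by rewrite ler_pM2l.
have : eps j * n%:R <= eps j * b by rewrite ler_pM2l.
by move: i1 i2 en => *; apply/andP; split; lra.
Qed.

Lemma step_index_le j t t' : t <= t' -> (step_index j t <= step_index j t')%N.
Proof. by move=> tt'; apply: le_truncn; rewrite ler_pM2r// invr_gt0 mulr_gt0. Qed.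

Lemma step_index_bounds j t : 0 <= t ->
  t / gamma - eps j < eps j * (step_index j t)%:R <= t / gamma.
Proof.
move=> t0; have ge0 : 0 < gamma * eps j by rewrite mulr_gt0.
have /truncn_itv/andP[h1 h2] : 0 <= t / (gamma * eps j) by rewrite divr_ge0// ltW.
rewrite -/(step_index _ _) in h1 h2.
have E : t / (gamma * eps j) = t / gamma / eps j by rewrite invfM mulrA.
move: h1 h2; rewrite E ler_pdivlMr// ltr_pdivrMr// -natr1 => h1 h2.
by apply/andP; split; lra.
Qed.

Lemma step_index_diff j t t' : 0 <= t -> t <= t' ->
  `|eps j * (step_index j t' - step_index j t)%:R - (t' - t) / gamma| <= eps j.
Proof.
move=> t0 tt'; rewrite natrB ?step_index_le//.
have /andP[h1 h2] := step_index_bounds j t0.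
have /andP[h3 h4] := step_index_bounds j (le_trans t0 tt').
by rewrite ler_norml; apply/andP; split; lra.
Qed.

(** The regime in which [step] can be iterated up to time [t]; the extinction time is defined from
    it. *)
Definition good delta t : Prop := \forall j \near U,
  forall k, (k <= step_index j t)%N -> forall s, delta <= extent (y j k) s.

Lemma good_le delta delta' t t' : delta' <= delta -> t' <= t -> good delta t -> good delta' t'.
Proof.
move=> dd tt; apply: filterS => j h k kt s.
by apply: le_trans dd _; apply: h; apply: leq_trans kt _; exact: step_index_le.
Qed.

Lemma good_steps_at (delta eta t : R) : 0 < delta -> 0 < eta -> good delta t ->
  \forall j \near U, steps_ok eta j (step_index j t).
Proof. by move=> d0 e0; apply: filterS2 (good_steps d0 e0) => j; apply. Qed.

Lemma steps_ok_extent_le eta j K k k' s : steps_ok eta j K ->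
  (k <= k')%N -> (k' <= K)%N -> extent (y j k') s <= extent (y j k) s.
Proof.
move=> ok; elim: k' => [|k' IH]; first by rewrite leqn0 => /eqP ->.
rewrite leq_eqVlt => /orP[/eqP -> //|kk'] k'K.
apply: le_trans (IH kk' (ltnW k'K)).
have [_ _ [_ sb]] := ok k' (ltnW k'K).
have m := step_bounds_ge0 sb.
have := m Left; have := m Right; have := m Bottom; have := m Top.
by rewrite /x /=; case: s {IH}; rewrite /extent => *; lra.
Qed.

(* Convergence along [U] needs no subsequence; one that serves all times at once is
   extracted at the end, in [limit_subsequence]. *)
Definition limit_position (t : R) s : R := lim (y j (step_index j t) s @[j --> U]).
Notation p := limit_position.

Lemma limit_position_cvg delta t s : 0 < delta -> good delta t ->
  y j (step_index j t) s @[j --> U] --> p t s.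
Proof.
move=> d0 gt; apply: (@ultra_bounded_cvg _ _ _ _ _ Lam).
by apply: filterS (good_steps_at d0 ltr01 gt) => j /(_ _ (leqnn _))[].
Qed.

Lemma inward_cvg (F : set_system nat) (FF : Filter F) (f : nat -> R) (l : R) s :
  f @ F --> l -> inward s (f j) @[j --> F] --> inward s l.
Proof. by case: s => //= h; exact: cvgN. Qed.

Lemma extent_cvg (F : set_system nat) (FF : Filter F) (f : nat -> side -> R) (l : side -> R) s :
  (forall s, f j s @[j --> F] --> l s) -> extent (f j) s @[j --> F] --> extent l s.
Proof. by move=> h; case: s => /=; exact: cvgB. Qed.

Lemma limit_extent_ge delta t s : 0 < delta -> good delta t -> delta <= extent (p t) s.
Proof.
move=> d0 gt.
apply: (@ler_cvg_to _ U _ _ (fun=> delta) (fun j => extent (y j (step_index j t)) s)).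
- exact: cvg_cst.
- by apply: extent_cvg => s'; exact: limit_position_cvg gt.
- by apply: filterS gt => j; apply.
Qed.

(* The bounds [a] and [b] on the number of cells crossed in each step
   pass to the limit because the number of steps between [t] and [t'] is
   [(t' - t) / (gamma * eps j)] up to one. *)
Lemma limit_increment delta (a b : R) s t t' : 0 < delta -> 0 <= t -> t <= t' -> good delta t' ->
  (\forall j \near U, forall k, (step_index j t <= k < step_index j t')%N -> exists n : nat,
    [/\ x j k.+1 s - x j k s = eps j * n%:R, a <= n%:R & n%:R <= b]) ->
  (t' - t) / gamma * a <= inward s (p t' s) - inward s (p t s) <= (t' - t) / gamma * b.
Proof.
move=> d0 t0 tt' gt' h; have gt := good_le (lexx _) tt' gt'.
have xc : x j (step_index j t') s - x j (step_index j t) s @[j --> U] -->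
    inward s (p t' s) - inward s (p t s).
  by apply: cvgB; apply: inward_cvg; apply: limit_position_cvg d0 _.
have ec : eps j * (step_index j t' - step_index j t)%:R @[j --> U] --> (t' - t) / gamma.
  apply/cvgrPdist_le => e e0; apply: filterS (eps_near e0) => j /ltW; apply: le_trans.
  by rewrite distrC step_index_diff.
have hs : \forall j \near U,
    eps j * (step_index j t' - step_index j t)%:R * a <= x j (step_index j t') s - x j (step_index j t) s
    <= eps j * (step_index j t' - step_index j t)%:R * b.
  by apply: filterS h => j; apply: steps_sum; exact: step_index_le.
apply/andP; split.
  apply: (ler_cvg_to _ xc); first by apply: cvgM; [exact: ec|exact: cvg_cst].
  by apply: filterS hs => j /andP[].
apply: (ler_cvg_to xc); first by apply: cvgM; [exact: ec|exact: cvg_cst].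
by apply: filterS hs => j /andP[].
Qed.

(** With [eta = 1] a side of length at least [delta] crosses at most [2 * gamma / delta + 1] cells
    per step, and a step lasts [gamma * eps j]. *)
Lemma limit_lipschitz delta s t t' : 0 < delta -> 0 <= t -> t <= t' -> good delta t' ->
  0 <= inward s (p t' s) - inward s (p t s) <= (2 / delta + gamma^-1) * (t' - t).
Proof.
move=> d0 t0 tt' gt'.
have : (t' - t) / gamma * 0 <= inward s (p t' s) - inward s (p t s) <=
    (t' - t) / gamma * (2 * gamma / delta + 1).
  apply: (limit_increment d0) => //.
  apply: filterS2 gt' (good_steps_at d0 ltr01 gt') => j ext ok k /andP[_ kt'].
  have [_ _ [_ /(_ s)[n [en _ nb]]]] := ok k (ltnW kt').
  exists n; split=> //; apply: le_trans nb _; rewrite lerD2r.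
  by rewrite ler_pM2l ?mulr_gt0// lef_pV2 ?posrE ?(lt_le_trans d0)// ext// ltnW.
rewrite mulr0 => /andP[-> /=] /le_trans; apply.
have -> : (t' - t) / gamma * (2 * gamma / delta + 1) = (2 / delta + gamma^-1) * (t' - t).
  by field; rewrite !gt_eqF.
exact: lexx.
Qed.

Lemma good_start : exists2 delta, 0 < delta & good delta 0.
Proof.
pose delta := Num.min (Num.min (extent p0 Left) (extent p0 Bottom)) 1 / 2.
have d0 : 0 < delta by rewrite divr_gt0// !lt_min !p0_extent ltr01.
exists delta => //.
have : forall s, \forall j \near U, delta <= extent (y j 0) s.
  move=> s; apply: U_oo.
  have yc : extent (y j 0) s @[j --> \oo] --> extent p0 s.
    by apply: extent_cvg => s'; exact: y0.
  have : delta < extent p0 s.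
    have hL : 2 * delta <= extent p0 Left by rewrite mulrC divfK// !ge_min lexx.
    have hB : 2 * delta <= extent p0 Bottom by rewrite mulrC divfK// !ge_min lexx orbT.
    by case: s yc => _; move: hL hB; rewrite /extent; lra.
  move=> h; have /cvgrPdist_le/(_ (extent p0 s - delta)) := yc; rewrite subr_gt0 => /(_ h).
  by apply: filterS => j; rewrite ler_norml => /andP[_]; lra.
move=> /near_sides; apply: filterS => j h k.
by rewrite /step_index mul0r truncn0 leqn0 => /eqP ->.
Qed.

(** [h] depends on [delta] only, which allows continuation past a given time. While the extents
    exceed [delta / 2], a step crosses at most [B] cells; in time [gamma * e0] a side moves by at
    most [2 * e0 * B = delta / 4], so an extent loses at most [delta / 2]. *)
Lemma good_extend delta : 0 < delta -> exists2 h, 0 < h &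
  forall t, 0 <= t -> good delta t -> good (delta / 2) (t + h).
Proof.
move=> d0; pose B := 4 * gamma / delta + 1.
have B0 : 0 < B by rewrite ltr_wpDl// divr_ge0 ?mulr_ge0// ltW.
pose e0 := delta / (8 * B); have e00 : 0 < e0 by rewrite divr_gt0// mulr_gt0.
exists (gamma * e0); first by rewrite mulr_gt0.
move=> t t0 gt; have d2 : 0 < delta / 2 by rewrite divr_gt0.
near=> j.
have ext : forall k, (k <= step_index j t)%N -> forall s, delta <= extent (y j k) s by near: j.
have ok : forall K, (forall k, (k <= K)%N -> forall s, delta / 2 <= extent (y j k) s) ->
    steps_ok 1 j K.
  by near: j; exact: good_steps d2 ltr01.
have ej : eps j < e0 by near: j; exact: eps_near.
have th : t <= t + gamma * e0 by rewrite lerDl mulr_ge0// ltW.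
have dist := step_index_diff j t0 th.
have eE : (t + gamma * e0 - t) / gamma = e0.
  by rewrite addrAC subrr add0r mulrC mulKf// gt_eqF.
rewrite eE in dist.
(* The speed bound for the earlier steps needs their extents, hence strong induction. *)
elim/ltn_ind => k IH kK s.
have [kt|kt] := leqP k (step_index j t).
  by apply: le_trans (ext _ kt s); rewrite ler_pdivrMr// ler_peMr ?ler1n// ltW.
have k1 : k.-1.+1 = k by move: kt; clear; lia.
have okk := ok k.-1 (fun k' hk' => IH k' ltac:(move: hk' k1; clear; lia) ltac:(move: hk' k1 kK; clear; lia)).
have all s' : 0 <= x j k s' - x j (step_index j t) s' <= eps j * (k - step_index j t)%:R * B.
  have := @steps_sum j 0 B s' _ _ (ltnW kt); rewrite mulr0; apply => k' /andP[h1 h2].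
  have [_ _ [_ /(_ s')[n [en _ nb]]]] := okk k' ltac:(move: h2 k1; clear; lia).
  exists n; split=> //; apply: le_trans nb _; rewrite lerD2r.
  have -> : 4 * gamma / delta = 2 * gamma / (delta / 2) by field; rewrite gt_eqF.
  rewrite ler_pM2l ?mulr_gt0// lef_pV2 ?posrE//.
    exact: IH h2 (leq_trans (ltnW h2) kK) _.
  exact: lt_le_trans d2 (IH _ h2 (leq_trans (ltnW h2) kK) _).
have [+ _] := extent_diff all s.
have : eps j * (k - step_index j t)%:R * B <= 2 * e0 * B.
  rewrite ler_pM2r//.
  have : eps j * (k - step_index j t)%:R <= eps j * (step_index j (t + gamma * e0) - step_index j t)%:R.
    by rewrite ler_pM2l// ler_nat leq_sub2r.
  by move: dist; rewrite ler_norml => /andP[_]; lra.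
have -> : 2 * e0 * B = delta / 4 by rewrite /e0; field; rewrite gt_eqF.
by have := ext _ (leqnn _) s; lra.
Unshelve. all: by end_near. Qed.

Lemma near_le_nat (F : set_system nat) (FF : Filter F) (Q : nat -> nat -> Prop) m :
  (forall i, (i <= m)%N -> \forall j \near F, Q i j) ->
  \forall j \near F, forall i, (i <= m)%N -> Q i j.
Proof.
elim: m => [|m IH] h.
  by apply: filterS (h 0%N (leqnn _)) => j hj i; rewrite leqn0 => /eqP ->.
apply: filterS2 (IH (fun i im => h i (leqW im))) (h m.+1 (leqnn _)) => j h1 h2 i.
by rewrite leq_eqVlt => /orP[/eqP ->|/h1].
Qed.

Lemma steps_ok_inward_le eta j K k k' s : steps_ok eta j K ->
  (k <= k')%N -> (k' <= K)%N -> x j k s <= x j k' s.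
Proof.
move=> ok; elim: k' => [|k' IH]; first by rewrite leqn0 => /eqP ->.
rewrite leq_eqVlt => /orP[/eqP -> //|kk'] k'K.
apply: le_trans (IH kk' (ltnW k'K)) _.
by have [_ _ [_ /step_bounds_ge0]] := ok k' (ltnW k'K).
Qed.

Lemma inward_le_dist s (a b e : R) : `|a - b| <= e -> inward s a <= inward s b + e.
Proof. by rewrite ler_norml => /andP[h1 h2]; case: s => /=; lra. Qed.

Lemma limit_extent_le delta s t t' : 0 < delta -> 0 <= t -> t <= t' -> good delta t' ->
  extent (p t) s - 2 * ((2 / delta + gamma^-1) * (t' - t)) <= extent (p t') s /\
  extent (p t') s <= extent (p t) s.
Proof.
move=> d0 t0 tt' gt'.
have [h1 h2] := extent_diff (fun s' => limit_lipschitz s' d0 t0 tt' gt') s.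
by split=> //; apply: le_trans h2 _; rewrite mulr0 subr0.
Qed.

(** Convergence on a finite grid of times suffices: between two grid times the discrete positions
    are monotone and the limit moves by at most [e / 2]. *)
Lemma uniform_close delta (T1 e : R) : 0 < delta -> 0 <= T1 -> good delta T1 -> 0 < e ->
  \forall j \near U, forall t, 0 <= t -> t <= T1 ->
    r j (step_index j t) /\ forall s, `|y j (step_index j t) s - p t s| <= e.
Proof.
move=> d0 T10 gT e0; pose B := 2 / delta + gamma^-1.
have B0 : 0 < B by rewrite addr_gt0 ?invr_gt0// divr_gt0.
pose kap := e / (2 * B); have k0 : 0 < kap by rewrite divr_gt0// mulr_gt0.
have Bk : B * kap = e / 2 by rewrite /kap; field; rewrite gt_eqF.
pose tau i := Num.min (i%:R * kap) T1.
have tau0 i : 0 <= tau i by rewrite le_min T10 andbT mulr_ge0// ltW.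
have tauT i : tau i <= T1 by rewrite ge_min lexx orbT.
have e2 : 0 < e / 2 by rewrite divr_gt0.
pose m := Num.bound (T1 / kap).
near=> j.
have ok : steps_ok 1 j (step_index j T1) by near: j; exact: good_steps_at d0 ltr01 gT.
have grid : forall i, (i <= m.+1)%N -> forall s, `|y j (step_index j (tau i)) s - p (tau i) s| <= e / 2.
  near: j; apply: near_le_nat => i _; apply: near_sides => s.
  have /cvgrPdist_le/(_ _ e2) := @limit_position_cvg _ (tau i) s d0 (good_le (lexx _) (tauT i) gT).
  by apply: filterS => j; rewrite distrC.
move=> t t0 tT; split; first by have [] := ok _ (step_index_le j tT).
move=> s; pose i := Num.truncn (t / kap).
have /truncn_itv/andP[i1 i2] : 0 <= t / kap by rewrite divr_ge0// ltW.
rewrite -/i ler_pdivlMr// in i1; rewrite -/i ltr_pdivrMr// in i2.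
have im : (i <= m)%N.
  have : i%:R < m%:R :> R.
    apply: (@le_lt_trans _ _ (T1 / kap)).
      by rewrite ler_pdivlMr//; exact: le_trans tT.
    by apply: archi_boundP; rewrite divr_ge0// ltW.
  by rewrite ltr_nat => /ltnW.
have tau1 : tau i = i%:R * kap by rewrite /tau; apply/min_idPl; exact: le_trans tT.
have tau2 : t <= tau i.+1 by rewrite le_min tT ltW.
have tau3 : tau i.+1 <= tau i + kap.
  by rewrite tau1 /tau ge_min -natr1 mulrDl mul1r lexx.
have ti : tau i <= t by rewrite tau1.
have g1 := grid i (leqW im) s; have g2 := grid i.+1 im s.
have gt := good_le (lexx _) tT gT; have gt2 := good_le (lexx _) (tauT i.+1) gT.
have /andP[_ l1] := limit_lipschitz s d0 (tau0 i) ti gt.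
have /andP[_ l2] := limit_lipschitz s d0 t0 tau2 gt2.
rewrite -/B in l1 l2.
have b1 : B * (t - tau i) <= e / 2 by rewrite -Bk ler_pM2l//; lra.
have b2 : B * (tau i.+1 - t) <= e / 2 by rewrite -Bk ler_pM2l//; lra.
apply: (@inward_dist _ s).
  have m1 := steps_ok_inward_le s ok (step_index_le j tau2) (step_index_le j (tauT i.+1)).
  have := inward_le_dist s g2; rewrite -[inward s (y j (step_index j (tau i.+1)) s)]/(x _ _ _) => h.
  by move: m1 h l2 b2; rewrite /x; lra.
have m1 := steps_ok_inward_le s ok (step_index_le j ti) (step_index_le j tT).
rewrite distrC in g1; have h := inward_le_dist s g1.
by move: m1 h l1 b1; rewrite /x; lra.
Unshelve. all: by end_near. Qed.

(** Supremum of the times reached with extents bounded away from zero; [limit_extinction] shows that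
    a length vanishes there if it is finite. *)
Definition extinction_time : \bar R :=
  ereal_sup [set t%:E | t in [set t | 0 <= t /\ exists2 delta, 0 < delta & good delta t]].
Notation Text := extinction_time.

Lemma lifespan_good t : lifespan Text t -> exists2 delta, 0 < delta & good delta t.
Proof.
move=> [t0 /ereal_sup_gt[_ [t' [_ [delta d0 gt']] <-]]]; rewrite lte_fin => /ltW tt'.
by exists delta => //; exact: good_le gt'.
Qed.

Lemma good_lifespan t delta : 0 <= t -> 0 < delta -> good delta t -> exists2 t', t < t' & lifespan Text t'.
Proof.
move=> t0 d0 gt; have [h h0 H] := good_extend d0.
exists (t + h / 2); first by rewrite ltrDl divr_gt0.
split; first by rewrite addr_ge0// ltW// divr_gt0.
apply: (@lt_le_trans _ _ (t + h)%:E); first by rewrite lte_fin; lra.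
apply: ereal_sup_ubound; exists (t + h) => //; split; first by rewrite addr_ge0// ltW.
by exists (delta / 2); [rewrite divr_gt0|exact: H].
Qed.

Lemma extinction_time_gt0 : (0 < Text)%E.
Proof.
have [delta d0 g0] := good_start.
have [t' t0 [_ lt]] := good_lifespan (lexx _) d0 g0.
by apply: lt_trans lt; rewrite lte_fin.
Qed.

Lemma limit_extent_gt0 t s : lifespan Text t -> 0 < extent (p t) s.
Proof.
move=> /lifespan_good[delta d0 gt]; exact: lt_le_trans d0 (limit_extent_ge s d0 gt).
Qed.

(** If all limit extents stayed above [2 * delta], the discrete ones would be at least [delta] up to
    a time at most [h / 2] before [T0], and [good_extend] would reach beyond [T0]. So one extent
    takes arbitrarily small values and, being nonincreasing, tends to zero. *)
Lemma limit_extinction (T0 : R) : Text = T0%:E -> exists s, extent (p t) s @[t --> T0^'-] --> 0.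
Proof.
move=> TE; have T00 : 0 < T0 by have := extinction_time_gt0; rewrite TE lte_fin.
have [s hs] : exists s, forall delta, 0 < delta ->
    exists2 t, 0 <= t < T0 & extent (p t) s < delta.
  apply: contrapT => /forallNP hn.
  have low s : exists2 delta, 0 < delta & forall t, 0 <= t < T0 -> delta <= extent (p t) s.
    apply: contrapT => h; apply: (hn s) => delta d0; apply: contrapT => h'.
    apply: h; exists delta => // t tT; rewrite leNgt; apply/negP => lt; apply: h'.
    by exists t.
  have [[dL dL0 hL] [dB dB0 hB]] := (low Left, low Bottom).
  pose delta := Num.min dL dB / 2.
  have d0 : 0 < delta by rewrite divr_gt0// lt_min dL0 dB0.
  have low2 t s : 0 <= t < T0 -> 2 * delta <= extent (p t) s.
    move=> tT; rewrite mulrC divfK//.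
    have := hL _ tT; have := hB _ tT.
    have : Num.min dL dB <= dL by rewrite ge_min lexx.
    have : Num.min dL dB <= dB by rewrite ge_min lexx orbT.
    by case: s; rewrite /extent; lra.
  have [h h0 H] := good_extend d0.
  pose t := Num.max 0 (T0 - h / 2).
  have t0 : 0 <= t by rewrite le_max lexx.
  have tT : t < T0 by rewrite gt_max T00; lra.
  have th : T0 - h / 2 <= t by rewrite le_max lexx orbT.
  have [d1 d10 g1] : exists2 delta, 0 < delta & good delta t.
    by apply: lifespan_good; split=> //; rewrite TE lte_fin.
  have gt : good delta t.
    near=> j.
    have ok : steps_ok 1 j (step_index j t) by near: j; exact: good_steps_at d10 ltr01 g1.
    have close : forall s, `|extent (p t) s - extent (y j (step_index j t)) s| <= delta.
      near: j; apply: near_sides => s.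
      have c : extent (y j (step_index j t)) s @[j --> U] --> extent (p t) s.
        by apply: extent_cvg => s'; exact: limit_position_cvg g1.
      by have /cvgrPdist_le/(_ _ d0) := c.
    move=> k kt s; apply: le_trans (steps_ok_extent_le s ok kt (leqnn _)).
    have := close s; have := low2 t s; rewrite t0 tT => /(_ isT).
    by rewrite ler_norml => ? /andP[_]; lra.
  have : ((t + h)%:E <= Text)%E.
    apply: ereal_sup_ubound; exists (t + h) => //; split; first by rewrite addr_ge0// ltW.
    by exists (delta / 2); [rewrite divr_gt0|exact: H].
  by rewrite TE lee_fin; lra.
exists s; apply/cvgrPdist_le => e e0; have [t /andP[t0 tT] te] := hs e e0.
near=> u; have tu : t < u by near: u; exact: nbhs_left_gt.
have uT : u < T0 by near: u; exact: nbhs_left_lt.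
have lu : lifespan Text u by split; [exact: le_trans (ltW tu)|rewrite TE lte_fin].
have [d1 d10 gu] := lifespan_good lu.
have [_ h] := limit_extent_le s d10 t0 (ltW tu) gu.
rewrite sub0r normrN gtr0_norm ?limit_extent_gt0//; lra.
Unshelve. all: by end_near. Qed.

Lemma lifespan_cofinal : exists2 T : nat -> R, forall n, lifespan Text (T n) &
  forall t, lifespan Text t -> \forall n \near \oo, t <= T n.
Proof.
have T0 := extinction_time_gt0.
case E : Text T0 => [T0| |] // T00.
  rewrite lte_fin in T00.
  exists (fun n => Num.max 0 (T0 - n.+1%:R^-1)).
    move=> n; split; first by rewrite le_max lexx.
    by rewrite lte_fin gt_max T00/= ltrBlDr ltrDl invr_gt0 ltr0Sn.
  move=> t [t0]; rewrite lte_fin => tT.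
  have tT' : 0 < T0 - t by rewrite subr_gt0.
  have := near_infty_natSinv_lt (PosNum tT').
  apply: filterS => n /= h; have {}h : n.+1%:R^-1 < T0 - t := h.
  by rewrite le_max lerBrDr addrC -lerBrDr (ltW h) orbT.
exists (fun n => n%:R); first by move=> n; split=> //; rewrite ltry.
by move=> t _; exact: nbhs_infty_ger.
Qed.

(** Just after [t] the lengths are close to [L], so every step crosses between [q - 1 - eta] and
    [q + eta] cells. If [q] is not an integer, a single integer is left and the velocity is exact;
    otherwise the bounds survive as [eta] tends to zero. *)
Lemma limit_velocity delta s (T1 t v : R) : 0 < delta -> 0 <= t -> t < T1 -> good delta T1 ->
  is_derive t 1 (fun u => inward s (p u s)) v -> velocity_inclusion gamma (extent (p t) s) v.
Proof.
move=> d0 t0 tT gT dv.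
have gt := good_le (lexx _) (ltW tT) gT.
set L := extent (p t) s; pose q := 2 * gamma / L.
have dL : delta <= L by exact: limit_extent_ge.
have L0 : 0 < L by exact: lt_le_trans dL.
have q0 : 0 < q by rewrite divr_gt0// mulr_gt0.
have g_neq0 : gamma != 0 by rewrite gt_eqF.
pose B := 2 / delta + gamma^-1.
have B0 : 0 < B by rewrite addr_gt0 ?invr_gt0// divr_gt0.
have qcvg t' : t' <= T1 -> 2 * gamma / extent (y j (step_index j t')) s @[j --> U] -->
    2 * gamma / extent (p t') s.
  move=> tT'; have gt' := good_le (lexx _) tT' gT.
  apply: cvgM; first exact: cvg_cst.
  apply: cvgV; first by rewrite gt_eqF// (lt_le_trans d0)// limit_extent_ge.
  by apply: extent_cvg => s'; exact: limit_position_cvg gt'.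
have rate (eta : R) : 0 < eta -> exists2 h0, 0 < h0 & forall h, 0 < h -> h < h0 ->
    t + h <= T1 /\
    \forall j \near U, forall k, (step_index j t <= k < step_index j (t + h))%N -> exists n : nat,
      [/\ x j k.+1 s - x j k s = eps j * n%:R, q - 1 - eta <= n%:R & n%:R <= q + eta].
  (* The second bound on [h] lets [2 * gamma / extent] grow by at most [eta / 4] up to time [t + h];
     the convergence of the extents and the step bounds take a quarter each. *)
  move=> eta0; pose h0 := Num.min (T1 - t) (eta * (delta * delta) / (16 * gamma * B)).
  have h00 : 0 < h0.
    by rewrite lt_min subr_gt0 tT/= divr_gt0// mulr_gt0// mulr_gt0.
  exists h0 => // h hp; rewrite lt_min ltrBrDl => /andP[/ltW hT hB].
  split=> //; have th : t <= t + h by rewrite lerDl ltW.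
  have gh := good_le (lexx _) hT gT.
  have qh : 2 * gamma / extent (p (t + h)) s <= q + eta / 4.
    have [l1 _] := limit_extent_le s d0 t0 th gh.
    have l2 : delta <= extent (p (t + h)) s by exact: limit_extent_ge.
    have l0 := lt_le_trans d0 l2.
    rewrite ler_pdivrMr// mulrDl /q.
    move: hB; rewrite ltr_pdivlMr ?mulr_gt0// => /ltW hB.
    have e1 : 2 * gamma / L * L = 2 * gamma by rewrite divfK// gt_eqF.
    have h1 : 2 * gamma / L * (L - extent (p (t + h)) s) <= 2 * gamma / L * (2 * (B * h)).
      rewrite ler_pM2l//; move: l1; rewrite -/L -/B addrAC subrr add0r; lra.
    have h2 : 2 * gamma / L * (2 * (B * h)) <= 2 * gamma / delta * (2 * (B * h)).
      by rewrite ler_pM2r ?mulr_gt0// ler_pM2l ?mulr_gt0// lef_pV2.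
    have h3 : 2 * gamma / delta * (2 * (B * h)) <= eta / 4 * delta.
      rewrite -(ler_pM2r d0).
      have -> : 2 * gamma / delta * (2 * (B * h)) * delta = h * (16 * gamma * B) / 4.
        by field; rewrite gt_eqF.
      by lra.
    have h4 : eta / 4 * delta <= eta / 4 * extent (p (t + h)) s by rewrite ler_pM2l// divr_gt0.
    lra.
  near=> j.
  have ok : steps_ok (eta / 4) j (step_index j (t + h)).
    by near: j; apply: good_steps_at d0 _ gh; rewrite divr_gt0.
  have ext k : (k <= step_index j (t + h))%N -> 0 < extent (y j k) s.
    by move=> kt; have [/r_extent] := ok k kt.
  have c1 : `|q - 2 * gamma / extent (y j (step_index j t)) s| <= eta / 4.
    by near: j; have /cvgrPdist_le := qcvg t (ltW tT); apply; rewrite divr_gt0.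
  have c2 : `|2 * gamma / extent (p (t + h)) s - 2 * gamma / extent (y j (step_index j (t + h))) s| <= eta / 4.
    by near: j; have /cvgrPdist_le := qcvg (t + h) hT; apply; rewrite divr_gt0.
  move=> k /andP[k1 k2]; have [_ _ [_ /(_ s)[n [en na nb]]]] := ok k (ltnW k2).
  have m1 : 2 * gamma / extent (y j (step_index j t)) s <= 2 * gamma / extent (y j k) s.
    rewrite ler_pM2l ?mulr_gt0// lef_pV2 ?posrE ?ext ?(ltnW k2) ?step_index_le//.
    exact: (steps_ok_extent_le s ok k1 (ltnW k2)).
  have m2 : 2 * gamma / extent (y j k) s <= 2 * gamma / extent (y j (step_index j (t + h))) s.
    rewrite ler_pM2l ?mulr_gt0// lef_pV2 ?posrE ?ext ?(ltnW k2)//.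
    exact: (steps_ok_extent_le s ok (ltnW k2) (leqnn _)).
  exists n; split=> //; move: c1 c2; rewrite !ler_norml => /andP[? ?] /andP[? ?]; lra.
have both (eta : R) : 0 < eta -> q - 1 - eta <= gamma * v <= q + eta.
  move=> eta0; have [h0 h00 H] := rate eta eta0.
  have : (q - 1 - eta) / gamma <= v <= (q + eta) / gamma.
    apply: (derive_right_bounds dv h00) => h hp hh; have [hT near] := H h hp hh.
    have th : t <= t + h by rewrite lerDl ltW.
    have := limit_increment d0 t0 th (good_le (lexx _) hT gT) near.
    by rewrite addrAC subrr add0r ![h / gamma * _]mulrAC !mulrA.
  by rewrite ler_pdivrMr// ler_pdivlMr// mulrC.
have qm1 : q - 1 <= gamma * v.
  by apply/ler_addgt0Pl => eta /both/andP[+ _]; lra.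
have qv : gamma * v <= q.
  by apply/ler_addgt0Pl => eta /both/andP[_]; lra.
split=> [qN|_]; last first.
  by rewrite ler_pdivrMl// ler_pdivlMl// qm1.
rewrite -/q in qN *; set m := Num.floor q.
have /andP[mq qm] := floor_itv q; rewrite -/m intrD in mq qm.
have mq' : m%:~R < q.
  rewrite lt_neqAle mq andbT; apply/eqP => E; move/negP: qN; apply.
  have m0 : 0 <= m by rewrite -(ler_int R) E ltW.
  by rewrite -E -(gez0_abs m0); exact: natr_nat.
(* With this [eta] the only integer between [q - 1 - eta] and [q + eta] is [m]. *)
pose eta := Num.min (q - m%:~R) (m%:~R + 1 - q) / 2.
have eta0 : 0 < eta by rewrite divr_gt0// lt_min !subr_gt0 mq'.
have e1 : 2 * eta <= q - m%:~R by rewrite mulrC divfK// ge_min lexx.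
have e2 : 2 * eta <= m%:~R + 1 - q by rewrite mulrC divfK// ge_min lexx orbT.
have [h0 h00 H] := rate eta eta0.
suff : m%:~R / gamma <= v <= m%:~R / gamma by move=> h; apply/eqP; rewrite eq_le mulrC andbC.
apply: (derive_right_bounds dv h00) => h hp hh; have [hT near] := H h hp hh.
have th : t <= t + h by rewrite lerDl ltW.
have : (t + h - t) / gamma * m%:~R <= inward s (p (t + h) s) - inward s (p t s) <= (t + h - t) / gamma * m%:~R.
  apply: (limit_increment d0 t0 th (good_le (lexx _) hT gT)).
  apply: filterS near => j hj k kk; have [n [en na nb]] := hj k kk.
  exists n; split=> //.
    have : m%:~R < (n%:Z + 1)%:~R :> R by rewrite intrD -[(n%:Z)%:~R]/(n%:R); lra.
    by rewrite ltr_int -[n%:R]/((n%:Z)%:~R) ler_int; clear; lia.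
  have : (n%:Z)%:~R < (m + 1)%:~R :> R by rewrite intrD -[(n%:Z)%:~R]/(n%:R); lra.
  by rewrite ltr_int -[n%:R]/((n%:Z)%:~R) ler_int; clear; lia.
by rewrite addrAC subrr add0r ![h / gamma * _]mulrAC !mulrA.
Unshelve. all: by end_near. Qed.

Lemma limit_locally_lipschitz s : locally_lipschitz_on (lifespan Text) (fun t => inward s (p t s)).
Proof.
move=> t lt; have [t0 _] := lt; have [d1 d10 g1] := lifespan_good lt.
have [T1 tT lT] := good_lifespan t0 d10 g1; have [delta d0 gT] := lifespan_good lT.
exists `]-oo, T1[%classic; first by apply: open_nbhs_nbhs; split; [exact: interval_open|rewrite /= in_itv].
have Dt : (lifespan Text `&` `]-oo, T1[) t by split=> //; rewrite /= in_itv.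
have FF := globally_properfilter ((conj Dt Dt) :
  ((lifespan Text `&` `]-oo, T1[) `*` (lifespan Text `&` `]-oo, T1[)) (t, t)).
apply: (@klipschitzW _ _ _ (2 / delta + gamma^-1)).
have wlog u u' : 0 <= u -> u <= u' -> u' <= T1 ->
    `|inward s (p u s) - inward s (p u' s)| <= (2 / delta + gamma^-1) * `|u - u'|.
  move=> u0 uu uT; have /andP[h1 h2] := limit_lipschitz s d0 u0 uu (good_le (lexx _) uT gT).
  by rewrite distrC ger0_norm// distrC ger0_norm// subr_ge0.
move=> [u u'] [/= [[u0 _] +] [[u0' _] +]]; rewrite /= !in_itv/= => uT uT'.
have [uu|/ltW uu] := leP u u'; first by apply: wlog => //; exact: ltW.
by rewrite distrC [`|u - _|]distrC; apply: wlog => //; exact: ltW.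
Qed.

(** Clamping time to [[0, T n]] makes each position nondecreasing and Lipschitz on the whole line.
    Clamped and true positions agree near every interior time, and [t = 0] is discarded as a null
    set. *)
Lemma limit_ae_velocity : {ae (@lebesgue_measure R), forall t, lifespan Text t -> forall s,
  is_derive t 1 (fun t => inward s (p t s)) ('D_1 (fun t => inward s (p t s)) t) /\
  velocity_inclusion gamma (extent (p t) s) ('D_1 (fun t => inward s (p t s)) t)}.
Proof.
have [T lT cof] := lifespan_cofinal.
pose cl n (t : R) := Num.min (Num.max 0 t) (T n).
have cl0 n t : 0 <= cl n t by rewrite le_min le_max lexx (lT n).1.
have clT n t : cl n t <= T n by rewrite ge_min lexx orbT.
have clE n t : 0 <= t -> t <= T n -> cl n t = t.
  by move=> t0 tT; rewrite /cl (max_idPr t0); exact/min_idPl.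
have cl_homo n t t' : t <= t' -> cl n t <= cl n t' /\ cl n t' - cl n t <= t' - t.
  move=> tt'; rewrite /cl.
  have hmax : Num.max 0 t <= Num.max 0 t' /\ Num.max 0 t' - Num.max 0 t <= t' - t.
    by case: (leP 0 t) => ?; case: (leP 0 t') => ?; split; lra.
  move: (Num.max 0 t) (Num.max 0 t') hmax => u u' [h1 h2].
  by case: (leP u (T n)) => ?; case: (leP u' (T n)) => ?; split; lra.
have ae_s n s : {ae (@lebesgue_measure R), forall t, derivable (fun t => inward s (p (cl n t) s)) t 1}.
  have [delta d0 gT] := lifespan_good (lT n).
  have B0 : 0 < 2 / delta + gamma^-1 by rewrite addr_gt0 ?invr_gt0// divr_gt0.
  have lip t t' : t <= t' -> 0 <= inward s (p (cl n t') s) - inward s (p (cl n t) s) <=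
      (2 / delta + gamma^-1) * (t' - t).
    move=> /(cl_homo n)[h1 h2].
    have /andP[-> h3] := limit_lipschitz s d0 (cl0 n t) h1 (good_le (lexx _) (clT n t') gT).
    by apply: le_trans h3 _; rewrite ler_pM2l.
  apply: (@nondecreasing_lipschitz_ae_derivable _ _ (2 / delta + gamma^-1)).
    by move=> t t' /lip/andP[+ _]; rewrite subr_ge0.
  by move=> t t' /lip/andP[_].
have FF : Filter (nbhs (almost_everywhere (@lebesgue_measure R))) := ae_filter_ringOfSetsType _.
have ae_n n : {ae (@lebesgue_measure R), forall t s, derivable (fun t => inward s (p (cl n t) s)) t 1}.
  have hBT : {ae (@lebesgue_measure R), forall t, derivable (fun t => inward Bottom (p (cl n t) Bottom)) t 1 /\
      derivable (fun t => inward Top (p (cl n t) Top)) t 1}.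
    by apply: filterS2 (ae_s n Bottom) (ae_s n Top) => t.
  by apply: filterS3 (ae_s n Left) (ae_s n Right) hBT => t hL hR [hB hT]; case.
have /ae_foralln H := ae_n.
have neq0 : {ae (@lebesgue_measure R), forall t, t != 0}.
  exists [set 0]; split; [exact: measurable_set1|exact: lebesgue_measure_set1|].
  by move=> t /= /negP; rewrite negbK => /eqP.
apply: filterS2 H neq0 => t H t_neq0 lt s.
have [t0 _] := lt; have [d1 d10 g1] := lifespan_good lt.
have tgt0 : 0 < t by rewrite lt_neqAle eq_sym t_neq0.
have [T1 tT1 lT1] := good_lifespan t0 d10 g1.
have [n _ /(_ n (leqnn _)) T1n] := cof _ lT1.
have tTn := lt_le_trans tT1 T1n.
have der : derivable (fun t => inward s (p t s)) t 1.
  apply: near_eq_derivable (H n s).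
  have : \forall u \near t, 0 < u < T n.
    have /near_in_itvoo : t \in `]0, T n[ by rewrite in_itv/= tgt0.
    by apply: filterS => u; rewrite in_itv.
  by apply: filterS => u /andP[u0 uT]; rewrite clE ?ltW.
have [delta d0 gT] := lifespan_good (lT n).
have dv := derivableP der; split=> //.
exact: limit_velocity d0 t0 tTn gT dv.
Qed.

(** Closeness within [1 / (n + 1)] up to time [T n] holds for a set of indices in [U], and such a
    set is unbounded because [U] refines [\oo]; a diagonal choice then gives increasing indices. *)
Lemma limit_subsequence : exists phi : nat -> nat, {homo phi : m n / (m < n)%N} /\
  forall T1, lifespan Text T1 -> forall e : R, 0 < e ->
  \forall j \near \oo, forall t, 0 <= t -> t <= T1 ->
    r (phi j) (step_index (phi j) t) /\
    forall s, `|y (phi j) (step_index (phi j) t) s - p t s| <= e.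
Proof.
have [T lT cof] := lifespan_cofinal.
pose V n := [set j | forall t, 0 <= t -> t <= T n ->
    r j (step_index j t) /\ forall s, `|y j (step_index j t) s - p t s| <= n.+1%:R^-1].
have UV n : U (V n).
  have [delta d0 gT] := lifespan_good (lT n).
  by apply: uniform_close d0 (lT n).1 gT _; rewrite invr_gt0.
have pick (nm : nat * nat) : exists j, V nm.1 j /\ (nm.2 < j)%N.
  have : U (V nm.1 `&` [set j | (nm.2 < j)%N]).
    by apply: filterI => //; apply: U_oo; exact: nbhs_infty_gt.
  by move=> /filter_ex[j [h1 h2]]; exists j.
have [g gP] := choice pick.
pose phi := fix phi n := if n is n'.+1 then g (n, phi n') else g (0%N, 0%N).
have phiV n : V n (phi n).
  by case: n => [|n]; [have [] := gP (0, 0)%N|have [] := gP (n.+1, phi n)].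
exists phi; split.
  by apply: homo_ltn; [move=> a b c; exact: ltn_trans|move=> n; have [] := gP (n.+1, phi n)].
move=> T1 lT1 e e0.
have := near_infty_natSinv_lt (PosNum e0); have := cof _ lT1.
apply: filterS2 => n Tn /ltW en t t0 tT.
have [rt h] := phiV n t t0 (le_trans tT Tn); split=> // s.
exact: le_trans (h s) en.
Qed.

Lemma limit_position0 : p 0 = p0.
Proof.
apply/funext => s; have [delta d0 g0] := good_start.
have h1 := @limit_position_cvg _ 0 s d0 g0.
have h2 : y j (step_index j 0) s @[j --> U] --> p0 s.
  rewrite (_ : (fun j => _) = (fun j => y j 0 s)); first by apply: cvg_trans (y0 (s := s)) => A; exact: U_oo.
  by apply/funext => j; rewrite /step_index mul0r truncn0.
exact: cvg_unique h1 h2.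
Qed.

End evolution_limit.

(** * Convergence of discrete flat flows *)

Section flat_flow_limit.
Context {R : realType}.
Implicit Types (gamma C : R) (A : set (R * R)) (p : side -> R).

Lemma rectangle_at_unique p p' A : rectangle_at p A -> rectangle_at p' A -> p = p'.
Proof.
move=> Ap Ap'; apply/funext => s.
have near0 x : A x -> exists2 y, A y & dist2 x y <= 0.
  by exists x => //; rewrite /dist2 !subrr expr0n addr0 sqrtr0.
have := inward_dist (sides_within Ap' Ap near0 s) (sides_within Ap Ap' near0 s).
by rewrite normr_le0 subr_eq0 => /eqP.
Qed.

Lemma rectangle_extent p A : rectangle_at p A -> forall s, 0 < extent p s.
Proof. by move=> [pX pY _ _]; case; rewrite subr_gt0. Qed.

Lemma extent_rectangle p : (forall s, 0 < extent p s) ->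
  rectangle_at p (`[p Left, p Right] `*` `[p Bottom, p Top]).
Proof.
move=> h; have := h Left; have := h Bottom; rewrite /extent !subr_gt0 => pX pY.
by split=> // x [/=]; rewrite !in_itv/= => /andP[a b] /andP[e f]; rewrite !ltW.
Qed.

(** In lattice units both the window and the admissible difference are of order [1 / eps];
    multiplied by [eps], the difference is the constant [theta]. *)
Definition fluctuations_vanish (e : int -> int -> R * R) (c : R * R -> R) : Prop :=
  forall Lam theta : R, 0 < Lam -> 0 < theta -> exists2 eps0, 0 < eps0 &
    forall eps, 0 < eps -> eps < eps0 -> line_sums_close e c (Lam / eps) (theta / eps).

Section flow.
Variables (gamma C : R) (c : R * R -> R).
Hypotheses (gamma_gt0 : 0 < gamma) (C_ge0 : 0 <= C) (C_gamma : 4 * C * gamma < 1)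
  (c_le : forall xi, dual_lattice xi -> `|c xi| <= C)
  (c_hor : fluctuations_vanish (fun x y => hedge (x, y)) c)
  (c_vert : fluctuations_vanish (fun x y => vedge (y, x)) c).

(** Passes from index rectangles to rectangles given by their sides. A side moves by at most
    [eps * b], so [eps < delta / (2 * b)] keeps the minimizer nondegenerate. *)
Lemma rectangle_step (delta Lam eta : R) : 0 < delta -> 0 < Lam -> 0 < eta ->
  exists2 eps0, 0 < eps0 & forall eps A A' p, 0 < eps -> eps < eps0 ->
    lattice_sets eps A -> rectangle_at p A -> (forall s, `|p s| <= Lam) ->
    (forall s, delta <= extent p s) -> minimizer c gamma eps A A' ->
    exists2 p', rectangle_at p' A' & step_bounds gamma eta eps p p'.
Proof.
move=> d0 L0 eta0.
pose theta := Num.min 1 (eta * delta / (4 * gamma)).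
have t0 : 0 < theta by rewrite lt_min ltr01 divr_gt0 ?mulr_gt0.
have t1 : theta <= 1 by rewrite ge_min lexx.
have gt : gamma * theta <= eta * delta / 4.
  have : theta <= eta * delta / (4 * gamma) by rewrite ge_min lexx orbT.
  rewrite ler_pdivlMr ?mulr_gt0//; lra.
have [e1 e10 H1] := minimizer_step gamma_gt0 C_ge0 C_gamma d0 L0 t0 t1 gt.
have L1 : 0 < Lam + 1 by rewrite addr_gt0.
have [e2 e20 H2] := c_hor L1 t0.
have [e3 e30 H3] := c_vert L1 t0.
pose b := 2 * gamma / delta + eta.
have b0 : 0 < b by rewrite addr_gt0// divr_gt0// mulr_gt0.
exists (Num.min (Num.min e1 e2) (Num.min e3 (delta / (2 * b)))).
  by rewrite !lt_min e10 e20 e30 divr_gt0// mulr_gt0.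
move=> eps A A' p e0; rewrite !lt_min => /andP[/andP[ee1 ee2] /andP[ee3 ee4]] lA Ap pL pd Amin.
have [q [AE qX qY]] := rectangle_lattice_set e0 lA Ap.
have qp : side_pos eps q = p.
  by apply: (rectangle_at_unique (rect_cells_at e0 qX qY)); rewrite -AE.
rewrite -qp in pL pd *; rewrite AE in Amin.
have [q' A'E sb] := H1 eps c q A' e0 ee1 c_le (H2 _ e0 ee2) (H3 _ e0 ee3) pL pd Amin.
exists (side_pos eps q') => //; rewrite A'E.
have h s : 0 <= inward s (side_pos eps q' s) - inward s (side_pos eps q s) <= eps * b.
  have [n [-> _ nb]] := sb s; rewrite mulr_ge0 ?ler0n ?(ltW e0)//= ler_pM2l//.
  apply: le_trans nb _; rewrite lerD2r ler_pM2l ?mulr_gt0// lef_pV2 ?posrE ?pd//.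
  exact: lt_le_trans (pd s).
have pos s : 0 < extent (side_pos eps q') s.
  have [+ _] := extent_diff h s; have := pd s.
  move: ee4; rewrite ltr_pdivlMr ?mulr_gt0//; lra.
have := pos Left; have := pos Bottom; rewrite /extent !subr_gt0 /side_pos !ltr_pM2l// !ltrD2r !ltr_int.
by move=> qX' qY'; exact: rect_cells_at.
Qed.

Theorem flat_flow_limit (eps : nat -> R) (A0 : nat -> set (R * R)) (A : set (R * R))
    (Aflow : nat -> R -> set (R * R)) :
  (forall j, 0 < eps j) -> eps @ \oo --> 0 ->
  (forall j, lattice_sets (eps j) (A0 j) /\ coordinate_rectangle (A0 j)) ->
  coordinate_rectangle A ->
  (fun j => hausdorff_dist (A0 j) A) @ \oo --> 0%E ->
  (forall j, discrete_flat_flow c gamma (eps j) (A0 j) (Aflow j)) ->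
  exists (phi : nat -> nat) (Text : \bar R) (At : R -> set (R * R)),
    [/\ {homo phi : m n / (m < n)%N}, (0 < Text)%E,
        converges_locally_in_time Text (fun j => Aflow (phi j)) At &
        rectangle_evolution gamma A Text At].
Proof.
move=> eps_gt0 eps0 A0rect [p0 Ap0] hd flow.
have [Ak AkP] := choice flow.
have Ak0 j : Ak j 0 = A0 j by have [] := AkP j.
have Akmin j k : minimizer c gamma (eps j) (Ak j k) (Ak j k.+1) by have [] := AkP j.
have AkE j t : 0 <= t -> Aflow j t = Ak j (step_index gamma eps j t).
  by have [_ _] := AkP j; exact.
have Aklat j k : lattice_sets (eps j) (Ak j k).
  by case: k => [|k]; [rewrite Ak0; have [] := A0rect j|have [] := Akmin j k].
(* [p0] is a dummy value for steps at which the set is no rectangle, as may happen near or after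
   extinction. *)
pose y j k := xget p0 [set p | rectangle_at p (Ak j k)].
pose r j k := rectangle_at (y j k) (Ak j k).
have yE j k p : rectangle_at p (Ak j k) -> r j k /\ y j k = p.
  move=> h; have rjk : r j k by exact: (@xgetI _ p0 [set p | rectangle_at p (Ak j k)] p h).
  by split=> //; exact: rectangle_at_unique rjk h.
have r0 j : r j 0.
  by have [_ [p h]] := A0rect j; have [] := yE j 0 p; rewrite ?Ak0.
have r_extent j k : r j k -> forall s, 0 < extent (y j k) s by exact: rectangle_extent.
have p0_extent : forall s, 0 < extent p0 s by exact: rectangle_extent Ap0.
have y0 s : y j 0 s @[j --> \oo] --> p0 s.
  apply/cvgrPdist_le => e e0.
  have : \forall j \near \oo, (hausdorff_dist (A0 j) A < e%:E)%E.
    have n0 : nbhs 0%E (fun u : \bar R => (u < e%:E)%E) by apply: open_ereal_lt'; rewrite lte_fin.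
    exact: hd n0.
  apply: filterS => j h; rewrite distrC; apply: (hausdorff_sides _ Ap0 h).
  by rewrite -Ak0; exact: r0.
have step (delta Lam eta : R) : 0 < delta -> 0 < Lam -> 0 < eta ->
    exists2 e0 : R, 0 < e0 & forall j k, eps j < e0 -> r j k ->
    (forall s, `|y j k s| <= Lam) -> (forall s, delta <= extent (y j k) s) ->
    r j k.+1 /\ step_bounds gamma eta (eps j) (y j k) (y j k.+1).
  move=> d0 L0 eta0; have [e0 e00 H] := rectangle_step d0 L0 eta0.
  exists e0 => // j k ej rjk yL yd.
  have [p' rp' sb] := H _ _ _ _ (eps_gt0 j) ej (Aklat j k) rjk yL yd (Akmin j k).
  by have [r1 ->] := yE _ _ _ rp'.
have [U [UU U_oo]] := @ultraFilterLemma nat \oo _.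
pose p := limit_position gamma eps y U.
pose Text := extinction_time gamma eps y U.
have [phi [phi_homo phiP]] := limit_subsequence gamma_gt0 eps_gt0 eps0 step r_extent r0 y0 p0_extent U_oo.
have p_extent t s : lifespan Text t -> 0 < extent (p t) s.
  exact: (limit_extent_gt0 gamma_gt0 eps_gt0 eps0 step r_extent r0 y0 U_oo).
have p00 : p 0 = p0 by exact: (@limit_position0 _ gamma _ _ _ _ eps_gt0 eps0 step r_extent r0 y0 p0_extent _ _ U_oo).
(* [A] may contain any part of its boundary, so at time zero the closed rectangle need not be
   [A]. *)
pose At t := if t == 0 then A else `[p t Left, p t Right] `*` `[p t Bottom, p t Top].
have AtP t : lifespan Text t -> rectangle_at (p t) (At t).
  move=> lt; rewrite /At; have [->|_] := eqVneq t 0; first by rewrite p00.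
  by apply: extent_rectangle => s; exact: p_extent.
have lengthE t s : lifespan Text t -> side_length (p t) s = extent (p t) s.
  move=> lt; have [pX pY _ _] := AtP t lt.
  by apply: side_lengthE; exact: ltW.
have Text_gt0 : (0 < Text)%E.
  exact: (extinction_time_gt0 gamma_gt0 eps_gt0 eps0 step r_extent r0 y0 p0_extent U_oo).
exists phi, Text, At; split=> //.
- move=> K Kcomp Klife e e0.
  have [[t1 Kt1]|/nonemptyPn K0] := pselect (K !=set0); last by near=> j => t; rewrite K0.
  have [|T1 KT1 Kmax] := @compact_EVT_max _ R id K (ex_intro _ t1 Kt1) Kcomp.
    by apply: continuous_subspaceT => u; exact: cvg_id.
  rewrite inE in KT1.
  (* [sides_hausdorff] loses a factor four, and the final inequality is strict. *)
  have e8 : 0 < e / 8 by rewrite divr_gt0.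
  have := phiP T1 (Klife _ KT1) (e / 8) e8; apply: filterS => j H t Kt.
  have [t0 _] := Klife _ Kt.
  have [rt close] := H t t0 (Kmax t (mem_set Kt)).
  rewrite AkE//; apply: (@le_lt_trans _ _ (4 * (e / 8))%:E); last by rewrite lte_fin; lra.
  by apply: sides_hausdorff rt (AtP _ (Klife _ Kt)) e8 close.
- exists p, (fun s t => 'D_1 (fun t => inward s (p t s)) t); split=> //.
  + by rewrite /At eqxx.
  + move=> s; exact: (limit_locally_lipschitz gamma_gt0 eps_gt0 eps0 step r_extent r0 y0 U_oo).
  + have [N [mN N0 NV]] := limit_ae_velocity gamma_gt0 eps_gt0 eps0 step r_extent r0 y0 p0_extent U_oo.
    exists N; split=> // t nt; apply: NV => H; apply: nt => lt s.
    by rewrite lengthE//; exact: H.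
  + move=> T0 TE.
    have T00 : 0 < T0 by rewrite -lte_fin -TE.
    have [s hs] := limit_extinction gamma_gt0 eps_gt0 eps0 step r_extent r0 y0 p0_extent U_oo TE.
    exists s; apply: cvg_trans hs; apply: near_eq_cvg; near=> t.
    rewrite lengthE//; split; first by apply: ltW; near: t; exact: nbhs_left_gt.
    by rewrite TE lte_fin; near: t; exact: nbhs_left_lt.
Unshelve. all: by end_near. Qed.

End flow.
End flat_flow_limit.

(** * One null set for all scales and precisions *)

Section field_lines.
Context {d : measure_display} {T : measurableType d} {R : realType} {P : probability T R}.

Lemma fluctuations_vanish_ae (c : R * R -> {RV P >-> R}) (alpha : nat -> R) (e : int -> int -> R * R) (A M0 : R) :
  (forall x y, dual_lattice (e x y)) ->
  (forall x y y' : int, dist2 (e x y) (e x y') = (`|y - y'|%N)%:R) ->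
  (forall x y, exists z, e x y = e 0 0 + zpt z) ->
  stationary c -> alpha_mixing c alpha -> (forall n, \sum_(1 <= k < n) alpha k <= A) -> 0 < M0 ->
  {ae P, forall w, (forall xi, dual_lattice xi -> `|c xi w| <= M0) ->
    fluctuations_vanish e (fun xi => c xi w)}.
Proof.
move=> e_dual e_dist e_shift c_stat c_mix cA M00.
(* Countably many parameters keep the exceptional set null; real [Lam] and [theta] are afterwards
   compared with [m.+1] and the inverse of [k.+1]. *)
have H : {ae P, forall w, forall (k m : nat), (forall xi, dual_lattice xi -> `|c xi w| <= M0) ->
    exists n0 : R, forall n : R, n0 <= n -> forall (x x' k0 : int) (l : nat),
    `|x|%:~R <= m.+1%:R * n -> `|x'|%:~R <= m.+1%:R * n ->
    - (m.+1%:R * n) <= k0%:~R -> (k0 + l%:Z)%:~R <= m.+1%:R * n ->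
    \sum_(0 <= i < l) c (e x (k0 + i%:Z)) w <= \sum_(0 <= i < l) c (e x' (k0 + i%:Z)) w + k.+1%:R^-1 * n}.
  apply: ae_foralln => k; apply: ae_foralln => m.
  by apply: (parallel_lines_ae e_dual e_dist e_shift c_stat c_mix cA M00); rewrite ?invr_gt0.
apply: filterS H => w H cM Lam theta L0 t0.
have tV : 0 <= theta^-1 by rewrite invr_ge0 ltW.
have [n0 hn] := H (Num.bound theta^-1) (Num.bound Lam) cM.
have n1 : 0 < Num.max n0 1 by rewrite lt_max ltr01 orbT.
exists (Num.max n0 1)^-1; first by rewrite invr_gt0.
move=> eps e0 ee.
have n0e : n0 <= eps^-1.
  apply: (@le_trans _ _ (Num.max n0 1)); first by rewrite le_max lexx.
  by rewrite -[leLHS]invrK lef_pV2 ?posrE ?invr_gt0// ltW.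
have Lb : Lam / eps <= (Num.bound Lam).+1%:R * eps^-1.
  rewrite ler_pM2r ?invr_gt0// ltW//; apply: lt_le_trans (archi_boundP (ltW L0)) _.
  by rewrite ler_nat.
have tb : (Num.bound theta^-1).+1%:R^-1 * eps^-1 <= theta / eps.
  rewrite ler_pM2r ?invr_gt0// -[leRHS]invrK lef_pV2 ?posrE ?invr_gt0//.
  by apply: le_trans (ltW (archi_boundP tV)) _; rewrite ler_nat.
move=> x x' k0 l xB x'B k0B lB.
have := hn _ n0e x x' k0 l (le_trans xB Lb) (le_trans x'B Lb) _ (le_trans lB Lb).
move=> /(_ (le_trans _ k0B)); rewrite lerN2 => /(_ Lb)/le_trans; apply.
by rewrite lerD2l.
Qed.

End field_lines.

(** Three null sets are discarded, one for the bound on the field and one for each orientation of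
    edges; outside them the field is a fixed function, and [flat_flow_limit] applies to all
    sequences and flows at once. *)
Theorem theorem2p6 (R : realType) (d : measure_display) (T : measurableType d)
    (P : probability T R) (gamma : R) (c : R * R -> {RV P >-> R})
    (alpha : nat -> R) :
  measure_is_complete P ->
  0 < gamma ->
  {ae P, forall w,
    (ereal_sup [set `|c xi w|%:E | xi in dual_lattice] < (4 * gamma)^-1%:E)%E} ->
  stationary c ->
  alpha_mixing c alpha ->
  (\sum_(1 <= n <oo) (alpha n)%:E < +oo)%E ->
  {ae P, forall w,
    forall (eps : nat -> R) (A0 : nat -> set (R * R)) (A : set (R * R))
           (Aflow : nat -> R -> set (R * R)),
    (forall j, 0 < eps j) -> nonincreasing_seq eps -> eps @ \oo --> 0 ->
    (forall j, lattice_sets (eps j) (A0 j) /\ coordinate_rectangle (A0 j)) ->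
    coordinate_rectangle A ->
    (fun j => hausdorff_dist (A0 j) A) @ \oo --> 0%E ->
    (forall j, discrete_flat_flow (fun xi => c xi w) gamma (eps j)
                 (A0 j) (Aflow j)) ->
    exists (phi : nat -> nat) (Text : \bar R) (At : R -> set (R * R)),
      [/\ {homo phi : m n / (m < n)%N},
          (0 < Text)%E,
          converges_locally_in_time Text (fun j => Aflow (phi j)) At &
          rectangle_evolution gamma A Text At]}.
Proof.
move=> _ gamma_gt0 c_bounded c_stat c_mix alpha_sum.
have a0 n : 0 <= alpha n by exact: alpha_ge0 c_mix.
pose S := (\sum_(1 <= n <oo) (alpha n)%:E)%E.
have S0 : (0 <= S)%E by apply: nneseries_ge0 => n _ _; rewrite lee_fin.
have SA n : \sum_(1 <= k < n) alpha k <= fine S.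
  rewrite -lee_fin fineK ?ge0_fin_numE// -sumEFin.
  by apply: nneseries_lim_ge => k _ _; rewrite lee_fin.
have g4' : 0 < 4 * gamma by rewrite mulr_gt0.
have g4 : 0 < (4 * gamma)^-1 by rewrite invr_gt0.
have hor : {ae P, forall w, (forall xi, dual_lattice xi -> `|c xi w| <= (4 * gamma)^-1) ->
    fluctuations_vanish (fun x y => hedge (x, y)) (fun xi => c xi w)}.
  apply: (fluctuations_vanish_ae _ _ _ c_stat c_mix SA g4) => [x y|x y y'|x y].
  - exact: hedge_dual.
  - by rewrite /dist2/= subrr expr0n add0r -intrB sqrtr_sqr -intr_norm -abszE.
  - by exists (x, y); rewrite /hedge /zpt; congr pair => /=; rewrite add0r// addrC.
have vert : {ae P, forall w, (forall xi, dual_lattice xi -> `|c xi w| <= (4 * gamma)^-1) ->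
    fluctuations_vanish (fun x y => vedge (y, x)) (fun xi => c xi w)}.
  apply: (fluctuations_vanish_ae _ _ _ c_stat c_mix SA g4) => [x y|x y y'|x y].
  - exact: vedge_dual.
  - by rewrite /dist2/= subrr expr0n addr0 -intrB sqrtr_sqr -intr_norm -abszE.
  - by exists (y, x); rewrite /vedge /zpt; congr pair => /=; rewrite add0r// addrC.
apply: filterS3 c_bounded hor vert => w cw hw vw eps A0 A Aflow eps_gt0 _.
set B := ereal_sup _ in cw.
have cB xi : dual_lattice xi -> (`|c xi w|%:E <= B)%E.
  by move=> dxi; apply: ereal_sup_ubound; exists xi.
have B0 : (0 <= B)%E by apply: le_trans (cB _ (hedge_dual (0, 0))); rewrite lee_fin.
have Bfin : B = (fine B)%:E by rewrite fineK// ge0_fin_numE// (lt_trans cw)// ltry.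
have cC xi : dual_lattice xi -> `|c xi w| <= fine B by rewrite -lee_fin -Bfin; exact: cB.
have C0 : 0 <= fine B by rewrite fine_ge0.
(* The fluctuation estimates use the bound [(4 * gamma)^-1], fixed before [w]; the strict inequality
   for the supremum at [w] yields the constant [C]. *)
have C1 : fine B < (4 * gamma)^-1 by rewrite -lte_fin -Bfin.
have cM xi : dual_lattice xi -> `|c xi w| <= (4 * gamma)^-1.
  by move=> /cC/le_trans; apply; exact: ltW.
apply: flat_flow_limit gamma_gt0 C0 _ cC (hw cM) (vw cM) _ _ _ _ eps_gt0.
move: C1; rewrite -(ltr_pM2r g4') mulVf ?gt_eqF//.
lra.
Qed.
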